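(* Fix $m\ge1$ and a real $\ell>0$. Let $n\to+\infty$ and $k\to+\infty$ (with $m\le n/2$) in such a way that $n/(2k)\to\ell$. Then $$\lim\lambda_k^{(n)}=4\,\frac{\ell+1/m}{(\ell+2/m)^2}.$$
   Context: For $1\le m\le n/2$: $\mathcal G_{m,n}$ is the Grassmannian of $m$-subspaces of $\mathbb R^n$; $y_i(p,q)=\cos^2\theta_i$ for principal angles; $V_n^\lambda$ irreducible $O(n,\mathbb R)$-representation indexed by $\lambda$, $L^2(\mathcal G_{m,n})\cong\bigoplus_\kappa V_n^{2\kappa}$ over partitions $\kappa$ with at most $m$ parts. $P_\kappa$ is the zonal polynomial: symmetric in $y_1,\dots,y_m$, degree $|\kappa|$, $P_\kappa(1,\dots,1)=1$, $p\mapsto P_\kappa(y(p,q))$ in the component $\cong V_n^{2\kappa}$. $S_k$ is the space of symmetric polynomials in $y_1,\dots,y_m$ of degree $\le k$, with inner product $[f,g]=\int_{[0,1]^m}f\bar g\,d\mu$, $d\mu=c\prod_{i<j}|y_i-y_j|\prod_iy_i^{-1/2}(1-y_i)^{n/2-m-1/2}dy_i$ (normalized to mass $1$). $T_k^{(n)}:S_k\to S_k$ is $P\mapsto\mathrm{pr}_{S_k}(\sigma P)$ with $\sigma=y_1+\dots+y_m$ and $\mathrm{pr}_{S_k}$ the orthogonal projection, and $\lambda_k^{(n)}$ is its largest eigenvalue. *)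

(* Defs.v *)
From HB Require Import structures.
From mathcomp Require Import all_boot all_order all_algebra all_fingroup.
From mathcomp Require Import all_classical all_reals all_analysis.
Unset Printing Implicit Defensive.
Import Order.TTheory GRing.Theory Num.Theory.
Import numFieldNormedType.Exports.
Local Open Scope classical_set_scope.
Local Open Scope ring_scope.

Section Grass.
Variable R : realType.

Definition upd (m : nat) (y : 'I_m -> R) (j : nat) (t : R) : 'I_m -> R :=
  fun i => if val i == j then t else y i.

Fixpoint iter_int (m : nat) (j : nat) (G : ('I_m -> R) -> R) (y : 'I_m -> R) : R :=
  match j with
  | 0 => G y
  | j'.+1 => (\int[@lebesgue_measure R]_(t in `[0%R, 1%R]) iter_int m j' G (upd m y j' t))%R
  end.

Definition cube_int (m : nat) (G : ('I_m -> R) -> R) : R :=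
  iter_int m m G (fun _ => 0).

Definition weight (m n : nat) (y : 'I_m -> R) : R :=
  (\prod_(i < m) \prod_(j < m | (i < j)%N) `|y i - y j|) *
  \prod_(i < m) (powR (y i) (- (1 / 2)) *
                 powR (1 - y i) (n%:R / 2 - m%:R - 1 / 2)).

Definition cst (m n : nat) : R := (cube_int m (weight m n))^-1.

Definition ip (m n : nat) (f g : ('I_m -> R) -> R) : R :=
  cst m n * cube_int m (fun y => f y * g y * weight m n y).

Definition poly_le (m k : nat) (P : ('I_m -> R) -> R) : Prop :=
  exists c : {ffun 'I_m -> 'I_k.+1} -> R,
    P = fun y => \sum_(a : {ffun 'I_m -> 'I_k.+1} | (\sum_(i < m) (a i : nat) <= k)%N)
                   c a * \prod_(i < m) y i ^+ a i.

Definition symmetric_fun (m : nat) (P : ('I_m -> R) -> R) : Prop :=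
  forall (s : {perm 'I_m}) (y : 'I_m -> R), P (fun i => y (s i)) = P y.

Definition S_k (m k : nat) : set (('I_m -> R) -> R) :=
  [set P | poly_le m k P /\ symmetric_fun m P].

Definition sigma (m : nat) (y : 'I_m -> R) : R := \sum_(i < m) y i.

Definition is_proj (m n k : nat) (f Q : ('I_m -> R) -> R) : Prop :=
  S_k m k Q /\ forall Rp, S_k m k Rp -> ip m n (fun y => f y - Q y) Rp = 0.

(* eigenvalues of T_k^{(n)} : P |-> pr_{S_k}(sigma P) on S_k *)
Definition T_eigenvalues (m n k : nat) : set R :=
  [set lam | exists P, S_k m k P /\ P <> (fun _ => 0) /\
             is_proj m n k (fun y => sigma m y * P y) (fun y => lam * P y)].

Definition lambda_max (m n k : nat) : R := sup (T_eigenvalues m n k).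

End Grass.

(* Main.v *)
(* The largest eigenvalue is the maximum of the Rayleigh quotient of sigma on S_k
   for the weight |Delta| prod_i y_i^(-1/2) (1 - y_i)^a, Delta the Vandermonde
   product.  The moments of sigma against f^2 times a weight form a log-convex
   sequence, so replacing f by sigma^r f with r a small multiple of k shows that
   multiplying the weight by a factor comparable to 1, up to a factor C that is
   polynomial in k, changes the maximal quotient by at most C^(1/(2r)), which tends
   to 1.  By a Nikolskii type inequality
   |Delta| is such a factor, and the problem reduces to a product weight.  There the
   multiplication by y_i is a Jacobi matrix with explicit entries (even Gegenbauer
   polynomials in x with y = x^2): row sums and the convexity of 1/x^2 bound the
   quotient above with k/m as the typical degree in each variable, and a product of
   plateaus of consecutive orthonormal polynomials attains this bound asymptotically. *)
Require Import Defs.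
From HB Require Import structures.
From mathcomp Require Import all_boot all_order all_algebra all_fingroup.
From mathcomp Require Import all_classical all_reals all_analysis.
From mathcomp Require Import measurable_realfun ring lra zify.
Import Order.TTheory GRing.Theory Num.Theory.
Import numFieldNormedType.Exports.
Local Open Scope classical_set_scope.
Local Open Scope ring_scope.
Set Implicit Arguments.
Unset Strict Implicit.

Local Arguments upd {R m}.
Local Arguments iter_int {R m}.
Local Arguments cube_int {R m}.
Local Arguments sigma {R m}.
Local Arguments poly_le {R m}.
Local Arguments symmetric_fun {R m}.

(** The weight itself moves: the Gegenbauer parameter [n / 2 - m] grows like [l k], so limit
    theorems for a fixed weight do not apply and every constant is tracked explicitly in the
    parameter. In one variable the edge at Gegenbauer degree [j] is [4 gam j = 1 - lam (lam - 1) /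
    ((j + lam) (j + lam - 1))]. Degree [k / m] in [y] means [j = 2 k / m]; with [lam = l k] the sum
    over the [m] variables tends to [m (1 - l^2 / (l + 2 / m)^2)], which equals the announced limit.
    The power [r] obeys two opposite constraints: [C^(1/(2r))] must be close to 1, yet [sigma^r f]
    has degree up to [k + r], so [r / k] must be small. Hence a second parameter [p]: [r] is [7 m^2]
    times the integer part of [k / (p + 1)], the comparison costs a factor [1 + 1 / (p + 1)], the
    degree is off by a proportion of at most [7 m^2 / (p + 1)], and [p] tends to infinity only after
    [k]. Orthogonality is developed for an abstract positive functional satisfying Pearson's
    identity, so that the integration by parts is done once, on the unit interval. *)

Lemma schur_test (R : realDomainType) (T : finType) (A : T -> T -> R) (c : T -> R) :
  (forall i j, 0 <= A i j) -> (forall i j, A i j = A j i) ->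
  \sum_i \sum_j c i * c j * A i j <= \sum_i c i ^+ 2 * \sum_j A i j.
Proof.
move=> A0 Asym.
(* Pointwise [2 c_i c_j <= c_i^2 + c_j^2]; by symmetry of [A] both squares contribute the same sum
   [S]. *)
pose S := \sum_i \sum_j c i ^+ 2 * A i j.
have -> : \sum_i c i ^+ 2 * \sum_j A i j = S.
  by apply: eq_bigr => i _; rewrite mulr_sumr.
have E : S = \sum_i \sum_j c j ^+ 2 * A i j.
  rewrite exchange_big /=; apply: eq_bigr => i _; apply: eq_bigr => j _.
  by rewrite Asym.
rewrite -(ler_pM2l (ltr0n R 2)).
have -> : 2 * S = S + \sum_i \sum_j c j ^+ 2 * A i j by rewrite -E; ring.
rewrite /S -big_split /=.
rewrite mulr_sumr; apply: ler_sum => i _.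
rewrite mulr_sumr -big_split /=; apply: ler_sum => j _.
rewrite mulrA -mulrDl; apply: ler_wpM2r; first exact: A0.
by have := sqr_ge0 (c i - c j); nra.
Qed.

Lemma sqr_sum_le (R : realDomainType) (n : nat) (u : 'I_n -> R) :
  (\sum_i u i) ^+ 2 <= n%:R * \sum_i u i ^+ 2.
Proof.
have := @schur_test R 'I_n (fun _ _ => 1) u (fun _ _ => ler01) (fun _ _ => erefl).
rewrite expr2 mulr_suml; under eq_bigr do under eq_bigr do rewrite mulr1.
under [X in _ -> X <= _]eq_bigr do rewrite mulr_sumr.
move=> /le_trans; apply; rewrite mulr_sumr; apply: ler_sum => i _.
by rewrite sumr_const card_ord mulrC.
Qed.

Lemma triangular_span (R : fieldType) (q : nat -> {poly R}) (d : nat) (p : {poly R}) :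
  (forall i, size (q i) = i.+1) -> (size p <= d)%N ->
  exists c : nat -> R, p = \sum_(i < d) c i *: q i.
Proof.
move=> sq; elim: d p => [|d IH] p sp.
  exists (fun=> 0); rewrite big_ord0; apply/eqP; rewrite -size_poly_eq0.
  by rewrite -leqn0.
(* The multiple of [q d] that cancels the coefficient of degree [d]. *)
pose u := p`_d / lead_coef (q d).
have [|c Hc] := IH (p - u *: q d).
  apply/leq_sizeP => j; rewrite leq_eqVlt coefB coefZ => /predU1P[<-|dj].
    have qd : (q d)`_d = lead_coef (q d) by rewrite lead_coefE sq.
    rewrite qd /u divfK ?subrr// lead_coef_eq0 -size_poly_eq0 sq//.
  rewrite !nth_default ?mulr0 ?subrr//; first by rewrite sq.
  exact: leq_trans sp _.
exists (fun i => if (i < d)%N then c i else u).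
rewrite big_ord_recr /= ltnn -[LHS](subrK (u *: q d)) Hc; congr (_ + _).
by apply: eq_bigr => i _; rewrite ltn_ord.
Qed.

Lemma onem_sqr_ge0 (R : realFieldType) (x : R) : -1 <= x <= 1 -> 0 <= 1 - x ^+ 2.
Proof.
move=> /andP[x1 x2]; have -> : 1 - x ^+ 2 = (1 - x) * (1 + x) by ring.
by apply: mulr_ge0; lra.
Qed.

(** * Gegenbauer polynomials *)

Section Gegenbauer.
Variables (R : rcfType) (lam : R).
Hypothesis lam1 : 1 < lam.

(* Coefficient of the recurrence P_(j+1) = x P_j - gam_j P_(j-1) of the monic orthogonal
   polynomials for the weight (1 - x^2)^(lam - 1/2) on [-1, 1]. *)
Definition gam (j : nat) : R :=
  j%:R * (j%:R - 1 + 2 * lam) / (4 * (j%:R + lam) * (j%:R - 1 + lam)).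

(** Consecutive polynomials are carried in pairs, which turns the three-term recurrence into a
    structural recursion. *)
Fixpoint geg2 (j : nat) : {poly R} * {poly R} :=
  if j is i.+1 then let: (p, q) := geg2 i in (q, 'X * q - gam i.+1 *: p)
  else (1, 'X).
Definition geg j := (geg2 j).1.

Lemma gam0 : gam 0 = 0. Proof. by rewrite /gam !mul0r. Qed.

Lemma gegS j : geg j.+1 = 'X * geg j - gam j *: geg j.-1.
Proof.
case: j => [|j]; first by rewrite gam0 scale0r subr0 /geg /= mulr1.
have E i : (geg2 i).2 = geg i.+1 by rewrite /geg /=; case: (geg2 i).
by rewrite /= -!E /=; rewrite /geg; case: (geg2 j).
Qed.

Lemma gam_gt0 j : 0 < gam j.+1.
Proof.
have l1 := lam1.
have j0 := ler0n R j.
rewrite /gam -natr1 addrK; apply: divr_gt0; apply: mulr_gt0; try lra.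
all: lra.
Qed.

Lemma gam_ge0 j : 0 <= gam j.
Proof. by case: j => [|j]; [rewrite gam0|exact/ltW/gam_gt0]. Qed.

(** In this form monotonicity in [j] and the bound [4 gam j < 1] are visible, and so is the limit
    when [j] and [lam] grow proportionally. *)
Lemma gamE j : 1 - 4 * gam j = lam * (lam - 1) / ((j%:R + lam) * (j%:R + lam - 1)).
Proof.
have l1 := lam1.
have j0 := ler0n R j.
rewrite /gam; field; apply/andP; split; apply: lt0r_neq0; lra.
Qed.

Lemma gam_le i j : (i <= j)%N -> gam i <= gam j.
Proof.
have l1 := lam1.
move=> ij; have ij' : (i%:R : R) <= j%:R by rewrite ler_nat.
have i0 := ler0n R i.
suff : 1 - 4 * gam j <= 1 - 4 * gam i by lra.
rewrite !gamE; apply: ler_wpM2l; first by apply: mulr_ge0; lra.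
by rewrite lef_pV2 ?posrE; [apply: ler_pM; lra|apply: mulr_gt0; lra|apply: mulr_gt0; lra].
Qed.

Lemma gam_lt j : 4 * gam j < 1.
Proof.
have l1 := lam1.
have j0 := ler0n R j.
rewrite -subr_gt0 gamE; apply: divr_gt0; apply: mulr_gt0; lra.
Qed.

Lemma size_geg j : size (geg j) = j.+1.
Proof.
suff [//] : size (geg j) = j.+1 /\ size (geg j.+1) = j.+2.
elim: j => [|j [IH1 IH2]]; first by rewrite gegS gam0 scale0r subr0 /geg /= mulr1 size_poly1 size_polyX.
split => //; rewrite gegS size_polyDl mulrC size_mulX ?IH2// -?size_poly_eq0 ?IH2//.
by rewrite size_polyN (leq_ltn_trans (size_scale_leq _ _))// IH1.
Qed.

(** The classical structure relation, proved from the recurrence alone by an induction over two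
    consecutive indices. Combined with Pearson's identity it gives orthogonality, and it also
    controls derivatives in the Bernstein-type bound below. *)
Lemma deriv_geg j : (1 - 'X^2) * (geg j)^`() =
  - j%:R *: ('X * geg j) + (2 * (j%:R + lam) * gam j) *: geg j.-1.
Proof.
have l1 := lam1.
pose Q i := (1 - 'X^2) * (geg i)^`() =
  - i%:R *: ('X * geg i) + (2 * (i%:R + lam) * gam i) *: geg i.-1.
suff [] : Q j /\ Q j.+1 by [].
have Q0 : Q 0 by rewrite /Q gam0 mulr0 scale0r oppr0 scale0r addr0 /geg /= derivC mulr0.
elim: j => [|j [Qj QSj]].
  split=> //; rewrite /Q gegS gam0 scale0r subr0 /geg /= mulr1 derivX mulr1 scaleN1r.
  have -> : 2 * (1 + lam) * gam 1 = 1.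
    rewrite /gam; field; apply/andP; split; apply: lt0r_neq0; lra.
  by rewrite scale1r addrC expr2.
split=> //; rewrite /Q [geg j.+2]gegS derivB derivM derivX derivZ mul1r.
(* The recurrence trades [geg j.-1] for [geg j.+1], so that only [geg j] and [geg j.+1] remain after
   differentiating the recurrence. *)
have B : (1 - 'X^2) * (geg j)^`() =
    (j%:R + 2 * lam) *: ('X * geg j) - (2 * (j%:R + lam)) *: geg j.+1.
  rewrite Qj gegS -!mul_polyC !(polyCM, polyCN, polyCD); ring.
(* The one identity between coefficients that closes the induction; it is where the explicit value
   of [gam] enters. *)
have S : 2 * (j.+2%:R + lam) * gam j.+2 = 1 + 2 * (j%:R + lam) * gam j.+1.
  have j0 := ler0n R j.
  rewrite /gam -[j.+2%:R]natr1 -[j.+1%:R]natr1; field.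
  by repeat (apply/andP; split); apply: lt0r_neq0; lra.
rewrite [_.+2.-1]/= [_.+1.-1]/= S.
transitivity ((1 - 'X^2) * geg j.+1 + 'X * ((1 - 'X^2) * (geg j.+1)^`()) -
  gam j.+1 *: ((1 - 'X^2) * (geg j)^`())).
  by rewrite -!mul_polyC; ring.
rewrite QSj B [_.+1.-1]/= -[j.+2%:R]natr1 -[j.+1%:R]natr1.
rewrite -!mul_polyC !(polyCM, polyCN, polyCD); ring.
Qed.

(** The even-index polynomials are polynomials in [x^2], which become the Jacobi polynomials in [y].
    The odd ones are carried along for the induction. *)
Lemma geg_parity j : exists E Od : {poly R},
  geg j.*2 = E \Po 'X^2 /\ geg j.*2.+1 = 'X * (Od \Po 'X^2).
Proof.
elim: j => [|j [E [Od [HE HO]]]].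
  by exists 1, 1; rewrite !comp_polyC mulr1.
pose E' := 'X * Od - gam j.*2.+1 *: E.
have HE' : geg j.+1.*2 = E' \Po 'X^2.
  rewrite doubleS gegS HO /= HE /E' comp_polyB comp_polyZ comp_polyM comp_polyX.
  by rewrite mulrA -expr2.
exists E', (E' - gam j.+1.*2 *: Od); split => //.
rewrite gegS HE' [X in geg X.-1]doubleS /= HO.
rewrite [(E' - _) \Po _]comp_polyB comp_polyZ [RHS]mulrBr.
by rewrite -scalerAr.
Qed.

(** * Orthonormal polynomials of a positive functional satisfying Pearson's identity *)

Section Orthogonality.
Variable Lx : {poly R} -> R.
Hypothesis LxD : forall P Q, Lx (P + Q) = Lx P + Lx Q.
Hypothesis LxZ : forall c P, Lx (c *: P) = c * Lx P.
Hypothesis Lx_ge0 : forall P, (forall x, -1 <= x <= 1 -> 0 <= P.[x]) -> 0 <= Lx P.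
Hypothesis Lx1 : 0 < Lx 1.
(** Integration by parts for the weight [w = (1 - x^2)^(lam - 1/2)]: the argument of [Lx] times [w]
    is the derivative of [(1 - x^2)^(lam + 1/2) r], which vanishes at both ends. *)
Hypothesis pearson : forall r,
  Lx ((1 - 'X^2) * r^`() - (2 * lam + 1) *: ('X * r)) = 0.

Lemma Lx0 : Lx 0 = 0.
Proof. by rewrite -(scale0r 0) LxZ mul0r. Qed.

Lemma LxZl c P Q : Lx (c *: P * Q) = c * Lx (P * Q).
Proof. by rewrite -scalerAl LxZ. Qed.

Lemma LxN P : Lx (- P) = - Lx P.
Proof. by rewrite -scaleN1r LxZ mulN1r. Qed.

Lemma LxB P Q : Lx (P - Q) = Lx P - Lx Q.
Proof. by rewrite LxD LxN. Qed.

Lemma Lx_sum (I : Type) (s : seq I) (F : I -> {poly R}) :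
  Lx (\sum_(i <- s) F i) = \sum_(i <- s) Lx (F i).
Proof. exact: (big_morph Lx LxD Lx0). Qed.

Lemma le_Lx P Q : (forall x, -1 <= x <= 1 -> P.[x] <= Q.[x]) -> Lx P <= Lx Q.
Proof.
move=> PQ; rewrite -subr_ge0 -LxB; apply: Lx_ge0 => x x1.
by rewrite hornerD hornerN subr_ge0 PQ.
Qed.

(** Pearson's identity at [geg i] relates the values at [i + 1] and [i - 1] with factor
    [(i - 1) gam i]. This factor vanishes at [i = 0] and at [i = 1], so both parity chains start at
    zero. *)
Lemma Lx_geg j : (0 < j)%N -> Lx (geg j) = 0.
Proof.
have l1 := lam1.
have rec i : (2 * (i%:R + lam) - i%:R + 1) * Lx (geg i.+1) =
    (i%:R - 1) * gam i * Lx (geg i.-1).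
  have := pearson (geg i); rewrite deriv_geg.
  have -> : - i%:R *: ('X * geg i) + (2 * (i%:R + lam) * gam i) *: geg i.-1 -
     (2 * lam + 1) *: ('X * geg i) =
     - (2 * (i%:R + lam) - i%:R + 1) *: geg i.+1 + ((i%:R - 1) * gam i) *: geg i.-1.
    rewrite gegS -!mul_polyC !(polyCM, polyCN, polyCD); ring.
  by rewrite LxD !LxZ => H; lra.
case: j => // j _.
suff [//] : Lx (geg j.+1) = 0 /\ Lx (geg j.+2) = 0.
have nz i : (2 * (i%:R + lam) - i%:R + 1) != 0 :> R.
  by have i0 : (0 : R) <= i%:R by []; apply: lt0r_neq0; lra.
have zero i : (i%:R - 1) * gam i * Lx (geg i.-1) = 0 -> Lx (geg i.+1) = 0.
  by move=> H; apply: (mulfI (nz i)); rewrite rec H mulr0.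
elim: j => [|j [IH1 IH2]].
  by split; apply: zero; rewrite ?gam0 ?subrr ?(mulr0, mul0r).
by split => //; apply: zero; rewrite IH1 mulr0.
Qed.

(** One factor ['X] is moved onto [geg j] by the recurrence; the index changes by one while the
    exponent drops by one, so the strict inequality survives. *)
Lemma Lx_Xn_geg i j : (i < j)%N -> Lx ('X^i * geg j) = 0.
Proof.
elim: i j => [|i IH] j ij; first by rewrite expr0 mul1r Lx_geg.
have -> : 'X^(i.+1) * geg j = 'X^i * geg j.+1 + gam j *: ('X^i * geg j.-1).
  by rewrite gegS exprS -!mul_polyC; ring.
rewrite LxD LxZ !IH ?mulr0 ?addr0//; last exact: leq_trans (ltnW ij) _.
by case: j ij.
Qed.

Lemma Lx_geg_lt (q : {poly R}) j : (size q <= j)%N -> Lx (q * geg j) = 0.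
Proof.
move=> sq; rewrite -[q]coefK poly_def mulr_suml Lx_sum big1// => i _.
by rewrite -scalerAl LxZ Lx_Xn_geg ?mulr0//; exact: leq_trans (ltn_ord i) sq.
Qed.

Definition gegnorm j := Lx (geg j ^+ 2).

Lemma gegnormS j : gegnorm j.+1 = gam j.+1 * gegnorm j.
Proof.
have -> : gegnorm j.+1 = Lx (('X * geg j) * geg j.+1).
  rewrite /gegnorm expr2 {1}gegS mulrBl LxB -scalerAl LxZ [Lx (geg j.-1 * _)]Lx_geg_lt.
    by rewrite mulr0 subr0.
  by rewrite size_geg; case: j.
have -> : 'X * geg j * geg j.+1 = geg j * geg j.+2 + gam j.+1 *: geg j ^+ 2.
  by rewrite [geg j.+2]gegS /= -!mul_polyC; ring.
by rewrite LxD LxZ Lx_geg_lt ?add0r// size_geg.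
Qed.

Lemma gegnorm_gt0 j : 0 < gegnorm j.
Proof.
elim: j => [|j IH]; first by rewrite /gegnorm /geg /= expr1n.
by rewrite gegnormS mulr_gt0 ?gam_gt0.
Qed.

Lemma Lx_gegM i j : i != j -> Lx (geg i * geg j) = 0.
Proof.
rewrite neq_ltn => /orP[ij|ji]; first by rewrite Lx_geg_lt// size_geg.
by rewrite mulrC Lx_geg_lt// size_geg.
Qed.

Fact phi_key : unit. Proof. exact: tt. Qed.

(* Locked, so that rewriting with the [*:] lemmas does not unfold it. *)
Definition phi : nat -> {poly R} :=
  locked_with phi_key (fun j => (Num.sqrt (gegnorm j))^-1 *: geg j).

Lemma phiE j : phi j = (Num.sqrt (gegnorm j))^-1 *: geg j.
Proof. by rewrite /phi unlock. Qed.

Definition reccoef j : R := Num.sqrt (gam j).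

Let sh_neq0 j : Num.sqrt (gegnorm j) != 0.
Proof. by rewrite gt_eqF// sqrtr_gt0 gegnorm_gt0. Qed.

Lemma size_phi j : size (phi j) = j.+1.
Proof. by rewrite phiE size_scale ?size_geg// invr_eq0. Qed.

Lemma phi_orth i j : Lx (phi i * phi j) = (i == j)%:R.
Proof.
rewrite !phiE -scalerAl -scalerAr !LxZ.
have [->|ij] := eqVneq i j; last by rewrite Lx_gegM ?mulr0.
rewrite -expr2 -/(gegnorm j) mulrA -invfM -expr2 sqr_sqrtr ?mulVf//.
  by rewrite gt_eqF ?gegnorm_gt0.
by rewrite ltW ?gegnorm_gt0.
Qed.

Lemma reccoef_ge0 j : 0 <= reccoef j. Proof. exact: sqrtr_ge0. Qed.

Lemma reccoef_sqr j : reccoef j ^+ 2 = gam j.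
Proof. by rewrite sqr_sqrtr ?gam_ge0. Qed.

Lemma reccoef0 : reccoef 0 = 0.
Proof. by rewrite /reccoef gam0 sqrtr0. Qed.

Lemma reccoef_le i j : (i <= j)%N -> reccoef i <= reccoef j.
Proof. by move=> ij; rewrite ler_wsqrtr ?gam_le. Qed.

Let sqrt_gegnormS j : Num.sqrt (gegnorm j.+1) = reccoef j.+1 * Num.sqrt (gegnorm j).
Proof. by rewrite gegnormS sqrtrM ?gam_ge0. Qed.

Let reccoef_neq0 j : reccoef j.+1 != 0.
Proof. by rewrite gt_eqF// sqrtr_gt0 gam_gt0. Qed.

Lemma phi_rec j : 'X * phi j = reccoef j.+1 *: phi j.+1 + reccoef j *: phi j.-1.
Proof.
rewrite !phiE !scalerA sqrt_gegnormS invfM mulrA divff// mul1r.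
have -> : reccoef j / Num.sqrt (gegnorm j.-1) = gam j / Num.sqrt (gegnorm j).
  case: j => [|j]; first by rewrite reccoef0 gam0 !mul0r.
  by rewrite sqrt_gegnormS -reccoef_sqr; field; rewrite sh_neq0 reccoef_neq0.
rewrite gegS -!mul_polyC !(polyCM, polyCN, polyCD); ring.
Qed.

Lemma deriv_phi j : (1 - 'X^2) * (phi j)^`() =
  - j%:R *: ('X * phi j) + (2 * (j%:R + lam) * reccoef j) *: phi j.-1.
Proof.
rewrite !phiE derivZ -scalerAr deriv_geg scalerDr !scalerA.
have -> : 2 * (j%:R + lam) * reccoef j / Num.sqrt (gegnorm j.-1) =
    (Num.sqrt (gegnorm j))^-1 * (2 * (j%:R + lam) * gam j).
  case: j => [|j]; first by rewrite reccoef0 gam0 !(mul0r, mulr0).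
  by rewrite sqrt_gegnormS -reccoef_sqr /=; field; rewrite sh_neq0 reccoef_neq0.
by congr (_ + _); rewrite -!mul_polyC !(polyCM, polyCN, polyCD); ring.
Qed.

Lemma jacobi_entry j l : Lx ('X^2 * phi j * phi l) =
  reccoef j.+1 * reccoef j.+2 * (j.+2 == l)%:R + (reccoef j.+1 ^+ 2 + reccoef j ^+ 2) * (j == l)%:R
  + reccoef j * reccoef j.-1 * (j == l.+2)%:R.
Proof.
have -> : 'X^2 * phi j = (reccoef j.+1 * reccoef j.+2) *: phi j.+2 +
    (reccoef j.+1 ^+ 2 + reccoef j ^+ 2) *: phi j + (reccoef j * reccoef j.-1) *: phi j.-2.
  have E2 : reccoef j *: ('X * phi j.-1) = reccoef j *: (reccoef j *: phi j + reccoef j.-1 *: phi j.-2).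
    by case: j => [|j]; [rewrite reccoef0 !scale0r|rewrite phi_rec].
  have Z c q : 'X * (c *: q) = c *: ('X * q) :> {poly R} by rewrite -scalerAr.
  rewrite expr2 -mulrA phi_rec mulrDr (Z (reccoef j.+1)) (Z (reccoef j)) E2 phi_rec /=.
  rewrite -!mul_polyC !(polyCM, polyCN, polyCD); ring.
rewrite ![in LHS]mulrDl !LxD !LxZl !phi_orth; congr (_ + _).
(* For [j = 0, 1] the truncated predecessor would give a spurious entry; the factor [reccoef 0 = 0]
   removes it. *)
by case: j => [|[|j]]; rewrite /= ?reccoef0 ?(mul0r, mulr0) ?eqSS.
Qed.

Lemma sum_indicator (f : nat -> nat) (i N : nat) : injective f ->
  \sum_(l < N) (i == f l)%:R = [exists l : 'I_N, i == f l]%:R :> R.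
Proof.
move=> injf; case: existsP => [[l /eqP il]|H].
  rewrite (bigD1 l) //= il eqxx big1 ?addr0// => k kl.
  by rewrite (inj_eq injf) val_eqE eq_sym (negbTE kl).
by rewrite big1// => l _; case: eqP => // il; case: H; exists l; rewrite il.
Qed.

Lemma jacobi_row (f : nat -> nat) j N : injective f ->
  \sum_(l < N) Lx ('X^2 * phi j * phi (f l)) =
  reccoef j.+1 * reccoef j.+2 * [exists l : 'I_N, j.+2 == f l]%:R +
  (reccoef j.+1 ^+ 2 + reccoef j ^+ 2) * [exists l : 'I_N, j == f l]%:R +
  reccoef j * reccoef j.-1 * [exists l : 'I_N, j == (f l).+2]%:R.
Proof.
move=> injf; under eq_bigr do rewrite jacobi_entry.
rewrite !big_split /= -!mulr_sumr !sum_indicator// (@sum_indicator (fun l => (f l).+2))//.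
by move=> x y [] /injf.
Qed.

(** A row has at most three nonzero entries, made of four products of [reccoef] of index at most
    [j + 2]. The map [f] selects the columns: [id] for all polynomials in [x], [double] for the even
    ones. *)
Lemma jacobi_row_le (f : nat -> nat) j N : injective f ->
  \sum_(l < N) Lx ('X^2 * phi j * phi (f l)) <= 4 * gam j.+2.
Proof.
move=> injf; rewrite jacobi_row//.
have b0 := reccoef_ge0 j; have b1 := reccoef_ge0 j.+1; have b2 := reccoef_ge0 j.-1.
have c1 := reccoef_le (leqnSn j.+1); have c2 := reccoef_le (leqnSn j); have c3 := reccoef_le (leq_pred j).
rewrite -reccoef_sqr.
apply: (@le_trans _ _ (reccoef j.+1 * reccoef j.+2 + (reccoef j.+1 ^+ 2 + reccoef j ^+ 2) + reccoef j * reccoef j.-1)).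
  have k1 : 0 <= reccoef j.+1 * reccoef j.+2 by apply: mulr_ge0 => //; exact: reccoef_ge0.
  have k2 : 0 <= reccoef j.+1 ^+ 2 + reccoef j ^+ 2 by apply: addr_ge0; exact: sqr_ge0.
  have k3 : 0 <= reccoef j * reccoef j.-1 by apply: mulr_ge0.
  by rewrite !lerD ?ler_piMr// lern1 leq_b1.
by nra.
Qed.

Lemma jacobi_entry_ge0 j l : 0 <= Lx ('X^2 * phi j * phi l).
Proof.
by rewrite jacobi_entry !addr_ge0 ?mulr_ge0 ?addr_ge0 ?sqr_ge0 ?reccoef_ge0.
Qed.

Lemma phi_expand d (p : {poly R}) : (size p <= d)%N ->
  exists c : nat -> R, p = \sum_(i < d) c i *: phi i.
Proof. by apply: triangular_span; exact: size_phi. Qed.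

Lemma phi_parseval d (c : nat -> R) :
  Lx ((\sum_(i < d) c i *: phi i) ^+ 2) = \sum_(i < d) c i ^+ 2.
Proof.
rewrite expr2 mulr_suml Lx_sum; apply: eq_bigr => i _.
rewrite mulr_sumr Lx_sum (bigD1 i)//= -scalerAl -scalerAr !LxZ phi_orth eqxx mulr1.
rewrite big1 ?addr0 ?expr2// => j ji.
rewrite -scalerAl -scalerAr !LxZ phi_orth val_eqE eq_sym (negbTE ji).
by rewrite !mulr0.
Qed.

(** Schur's test with the row bound. As [4 gam < 1], the factor [1 - x^2] has a mean bounded away
    from zero on polynomials of bounded degree, which Pearson's identity needs below. *)
Lemma Lx_X2_le d (p : {poly R}) : (size p <= d)%N ->
  Lx ('X^2 * p ^+ 2) <= 4 * gam d.+1 * Lx (p ^+ 2).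
Proof.
move=> /phi_expand[c ->]; rewrite phi_parseval mulr_sumr.
have -> : Lx ('X^2 * (\sum_(i < d) c i *: phi i) ^+ 2) =
    \sum_(i < d) \sum_(j < d) c i * c j * Lx ('X^2 * phi i * phi j).
  rewrite [X in _ * X]expr2 mulr_suml mulr_sumr Lx_sum; apply: eq_bigr => i _.
  rewrite mulr_sumr mulr_sumr Lx_sum; apply: eq_bigr => j _.
  by rewrite -LxZ -!mul_polyC !(polyCM, polyCN, polyCD); congr Lx; ring.
apply: le_trans (schur_test _ _ _) _.
- by move=> i j; exact: jacobi_entry_ge0.
- by move=> i j; congr Lx; ring.
apply: ler_sum => i _; rewrite mulrC ler_wpM2r ?sqr_ge0//.
apply: le_trans (@jacobi_row_le id _ _ _) _; rewrite ?ler_pM2l//; apply: gam_le.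
by rewrite ltnS; exact: ltn_ord.
Qed.

(** A Bernstein-type inequality: [deriv_phi] bounds each basis element, and Cauchy-Schwarz over the
    [d] terms costs the factor [d]. *)
Lemma Lx_deriv_le d (p : {poly R}) : (size p <= d)%N ->
  Lx (((1 - 'X^2) * p^`()) ^+ 2) <= 4 * d%:R * (d%:R + lam) ^+ 2 * Lx (p ^+ 2).
Proof.
have l1 := lam1.
move=> /phi_expand[c ->]; rewrite phi_parseval.
pose U (i : 'I_d) := (1 - 'X^2) * (phi i)^`().
have -> : (1 - 'X^2) * (\sum_(i < d) c i *: phi i)^`() = \sum_(i < d) c i *: U i.
  by rewrite raddf_sum mulr_sumr; apply: eq_bigr => i _; rewrite /= derivZ -scalerAr.
have HU (i : 'I_d) : Lx (U i ^+ 2) <= 4 * (d%:R + lam) ^+ 2.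
  rewrite /U deriv_phi.
  pose k : R := 2 * (i%:R + lam) * reccoef i.
  apply: (@le_trans _ _ (Lx ((2 * i%:R ^+ 2) *: phi i ^+ 2 + (2 * k ^+ 2) *: phi i.-1 ^+ 2))).
    apply: le_Lx => x /onem_sqr_ge0 x0.
    rewrite !(hornerD, hornerZ, hornerN, hornerM, hornerX, hornerC, horner_exp) -/k.
    have := sqr_ge0 (i%:R * (x * (phi i).[x]) + k * (phi i.-1).[x]).
    have : i%:R ^+ 2 * ((1 - x ^+ 2) * (phi i).[x] ^+ 2) >= 0.
      by exact: mulr_ge0 (sqr_ge0 _) (mulr_ge0 x0 (sqr_ge0 _)).
    move: (phi i).[x] (phi i.-1).[x] (i%:R : R) => A B I; nra.
  rewrite LxD !LxZ !expr2 !phi_orth !eqxx !mulr1 -!expr2.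
  have i0 := ler0n R i.
  have id : (i%:R : R) <= d%:R by rewrite ler_nat ltnW.
  have g4 := gam_lt i; have g0 := gam_ge0 i.
  have -> : k ^+ 2 = 4 * (i%:R + lam) ^+ 2 * gam i by rewrite -reccoef_sqr /k; ring.
  have e1 : 4 * (i%:R + lam) ^+ 2 * gam i <= (i%:R + lam) ^+ 2.
    by have := sqr_ge0 (i%:R + lam : R); nra.
  have e2 : (i%:R + lam) ^+ 2 <= (d%:R + lam) ^+ 2 :> R.
    by rewrite ler_pXn2r ?nnegrE//; lra.
  have e3 : (i%:R : R) ^+ 2 <= (d%:R + lam) ^+ 2.
    by rewrite ler_pXn2r ?nnegrE//; lra.
  lra.
apply: (@le_trans _ _ (Lx (d%:R *: \sum_(i < d) (c i *: U i) ^+ 2))).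
  apply: le_Lx => x _; rewrite hornerZ horner_exp !horner_sum.
  under [X in _ <= _ * X]eq_bigr do rewrite horner_exp.
  exact: sqr_sum_le.
have -> : 4 * d%:R * (d%:R + lam) ^+ 2 * (\sum_(i < d) c i ^+ 2) =
  d%:R * (4 * (d%:R + lam) ^+ 2 * (\sum_(i < d) c i ^+ 2)) by ring.
rewrite LxZ Lx_sum; apply: ler_wpM2l => //.
rewrite mulr_sumr; apply: ler_sum => i _.
by rewrite exprZn LxZ mulrC ler_wpM2r ?sqr_ge0.
Qed.

(* Not sharp: only the growth below exponential matters. *)
Definition nikcst (d : nat) : R :=
  (32 * d%:R * (d%:R + lam) ^+ 2 + 2 * (2 * lam + 1) ^+ 2) / (1 - 4 * gam d.+1) ^+ 2.

Lemma nikcst_ge1 d : 1 <= nikcst d.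
Proof.
have l1 := lam1.
have g := gam_lt d.+1; have g0 := gam_ge0 d.+1.
have d0 := ler0n R d.
rewrite /nikcst ler_pdivlMr ?exprn_gt0 ?subr_gt0// mul1r.
apply: (@le_trans _ _ 1); first by apply: exprn_ile1; lra.
have : 0 <= 32 * d%:R * (d%:R + lam) ^+ 2.
  by apply: mulr_ge0 (sqr_ge0 _); apply: mulr_ge0.
nra.
Qed.

(* Pearson's identity applied to (x - b) P^2, in Cauchy-Schwarz form. *)
Lemma Lx_nikolskii d (p : {poly R}) (b : R) : (size p <= d)%N ->
  Lx (p ^+ 2) <= nikcst d * Lx (('X - b%:P) ^+ 2 * p ^+ 2).
Proof.
have l1 := lam1.
move=> sp; pose c := 1 - 4 * gam d.+1; have c0 : 0 < c by rewrite subr_gt0 gam_lt.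
pose B : R := 32 * d%:R * (d%:R + lam) ^+ 2 + 2 * (2 * lam + 1) ^+ 2.
have d0 := ler0n R d.
have B0 : 0 < B.
  apply: ltr_wpDl; first by apply: mulr_ge0 (sqr_ge0 _); apply: mulr_ge0.
  by rewrite mulr_gt0// exprn_gt0//; lra.
pose q := ('X - b%:P) * p.
pose v := 2 *: ((1 - 'X^2) * p^`()) - (2 * lam + 1) *: ('X * p).
have E1 : c * Lx (p ^+ 2) <= Lx ((1 - 'X^2) * p ^+ 2).
  have -> : Lx ((1 - 'X^2) * p ^+ 2) = Lx (p ^+ 2) - Lx ('X^2 * p ^+ 2).
    by rewrite mulrBl mul1r LxB.
  by have := Lx_X2_le sp; rewrite /c; lra.
(* With [q = (x - b) p], Pearson's expression for [(x - b) p^2] splits as [(1 - x^2) p^2 + q v]: the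
   whole dependence on the small factor is in [q]. *)
have E2 : Lx ((1 - 'X^2) * p ^+ 2) = - Lx (q * v).
  have := pearson (('X - b%:P) * p ^+ 2).
  have -> : (1 - 'X^2) * (('X - b%:P) * p ^+ 2)^`() -
      (2 * lam + 1) *: ('X * (('X - b%:P) * p ^+ 2)) = (1 - 'X^2) * p ^+ 2 + q * v.
    rewrite derivM derivB derivX derivC subr0 mul1r expr2 derivM /q /v.
    by rewrite -!mul_polyC; ring.
  by rewrite LxD => H; lra.
have E3 : Lx (v ^+ 2) <= B * Lx (p ^+ 2).
  apply: (@le_trans _ _ (Lx (8 *: ((1 - 'X^2) * p^`()) ^+ 2 +
      (2 * (2 * lam + 1) ^+ 2) *: p ^+ 2))).
    apply: le_Lx => x /onem_sqr_ge0 x0; rewrite /v !(hornerD, hornerZ, hornerN, hornerM, hornerX, hornerC, horner_exp).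
    move: (_ * p^`().[x]) (p.[x]) => A P.
    have : (2 * lam + 1) ^+ 2 * ((1 - x ^+ 2) * P ^+ 2) >= 0.
      by exact: mulr_ge0 (sqr_ge0 _) (mulr_ge0 x0 (sqr_ge0 _)).
    have := sqr_ge0 (2 * A + (2 * lam + 1) * (x * P)).
    nra.
  rewrite LxD !LxZ; have := Lx_deriv_le sp; rewrite /B.
  lra.
(* The weights of this arithmetic-geometric inequality make the [v^2] term at most half of the lower
   bound in [E1], where it is absorbed. *)
have E4 : - Lx (q * v) <= B / (2 * c) * Lx (q ^+ 2) + c / (2 * B) * Lx (v ^+ 2).
  rewrite -LxN -!LxZ -LxD; apply: le_Lx => x _.
  rewrite hornerN hornerD !hornerZ !horner_exp hornerM.
  move: (q.[x]) (v.[x]) => Q V.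
  have -> : B / (2 * c) * Q ^+ 2 + c / (2 * B) * V ^+ 2 =
      (B * Q + c * V) ^+ 2 / (2 * B * c) - Q * V.
    by field; rewrite !gt_eqF.
  rewrite lerDr divr_ge0 ?sqr_ge0// !mulr_ge0// ltW//.
have E5 : c / (2 * B) * Lx (v ^+ 2) <= c / 2 * Lx (p ^+ 2).
  apply: (@le_trans _ _ (c / (2 * B) * (B * Lx (p ^+ 2)))).
    by apply: ler_wpM2l => //; rewrite divr_ge0 ?mulr_ge0// ltW.
  by rewrite le_eqVlt; apply/orP; left; apply/eqP; field; rewrite gt_eqF.
have E6 : c / 2 * Lx (p ^+ 2) <= B / (2 * c) * Lx (q ^+ 2) by lra.
have -> : ('X - b%:P) ^+ 2 * p ^+ 2 = q ^+ 2 by rewrite -exprMn.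
have -> : nikcst d * Lx (q ^+ 2) = 2 / c * (B / (2 * c) * Lx (q ^+ 2)).
  by rewrite /nikcst -/B -/c; field; rewrite gt_eqF.
apply: (@le_trans _ _ (2 / c * (c / 2 * Lx (p ^+ 2)))).
  by rewrite le_eqVlt; apply/orP; left; apply/eqP; field; rewrite gt_eqF.
by apply: ler_wpM2l => //; rewrite divr_ge0// ltW.
Qed.

Lemma psi_subproof j : exists p : {poly R}, phi j.*2 = p \Po 'X^2.
Proof.
have [E [Od [HE _]]] := geg_parity j.
by exists ((Num.sqrt (gegnorm j.*2))^-1 *: E); rewrite phiE HE comp_polyZ.
Qed.

(** Under [y = x^2] these are the orthonormal Jacobi polynomials for [y^(-1/2) (1 - y)^(lam - 1/2)]
    on the unit interval. *)
Definition psi j : {poly R} := sval (cid (psi_subproof j)).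

Lemma psiE j : psi j \Po 'X^2 = phi j.*2.
Proof. by rewrite /psi; case: cid. Qed.

Lemma size_psi j : size (psi j) = j.+1.
Proof.
have : (size (psi j \Po 'X^2)).-1 = ((size (psi j)).-1 * 2)%N.
  by rewrite size_comp_poly size_polyXn.
rewrite psiE size_phi /= -muln2 => /eqP; rewrite eqn_pmul2r// => /eqP e.
rewrite {2}e prednK// lt0n size_poly_eq0; apply/eqP => p0.
by have := size_phi j.*2; rewrite -psiE p0 comp_poly0 size_poly0.
Qed.

Definition Ly (p : {poly R}) := Lx (p \Po 'X^2).

Lemma Ly_psi_orth i j : Ly (psi i * psi j) = (i == j)%:R.
Proof. by rewrite /Ly comp_polyM !psiE phi_orth (inj_eq double_inj). Qed.

Lemma Ly_psi_entry i j : Ly ('X * psi i * psi j) = Lx ('X^2 * phi i.*2 * phi j.*2).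
Proof. by rewrite /Ly !comp_polyM !psiE comp_polyX. Qed.

Lemma Ly_psi_entry_ge0 i j : 0 <= Ly ('X * psi i * psi j).
Proof. by rewrite Ly_psi_entry jacobi_entry_ge0. Qed.

Lemma Ly_psi_row_le j N : \sum_(l < N) Ly ('X * psi j * psi l) <= 4 * gam j.*2.+2.
Proof.
under eq_bigr do rewrite Ly_psi_entry.
exact: (@jacobi_row_le double _ _ double_inj).
Qed.

(** Since [b >= 0], [x^2 - b] factors as [(x + s) (x - s)] with [s] the square root of [b]; the
    inequality in [x] is applied once per factor, hence the square of the constant. *)
Lemma Ly_nikolskii d (p : {poly R}) (b : R) : (size p <= d)%N -> 0 <= b ->
  Ly (p ^+ 2) <= nikcst d.*2 ^+ 2 * Ly (('X - b%:P) ^+ 2 * p ^+ 2).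
Proof.
move=> sp b0; pose s := Num.sqrt b; pose P := p \Po 'X^2.
(* One unit below [d.*2] leaves room for the factor ['X - s%:P] in the second application. *)
have sP : (size P <= d.*2.-1)%N.
  have [p0|p0] := eqVneq p 0; first by rewrite /P p0 comp_poly0 size_poly0.
  have P1 : (size P).-1 = ((size p).-1 * 2)%N by rewrite size_comp_poly size_polyXn.
  have := P1; move: sp; rewrite -size_poly_gt0 in p0.
  by move: (size P) (size p) p0 => x y; lia.
have sP2 : (size (('X - s%:P) * P)%R <= d.*2)%N.
  have [P0|P0] := eqVneq P 0; first by rewrite P0 mulr0 size_poly0.
  rewrite mulrC size_Mmonic ?monicXsubC// size_XsubC addn2 /=; move: sP; rewrite -size_poly_gt0 in P0.
  by move: (size P) P0 => x; lia.
have sP1 : (size P <= d.*2)%N by apply: leq_trans sP _; exact: leq_pred.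
have comp_sqr (q : {poly R}) : q ^+ 2 \Po 'X^2 = (q \Po 'X^2) ^+ 2.
  by rewrite !expr2 comp_polyM.
rewrite /Ly comp_sqr [X in _ <= _ * Lx X]comp_polyM !comp_sqr comp_polyB comp_polyX comp_polyC -/P.
have -> : 'X^2 - b%:P = ('X - (- s)%:P) * ('X - s%:P) :> {poly R}.
  rewrite -[b in LHS](sqr_sqrtr b0) -/s polyCN rmorphXn /=; ring.
have -> : (('X - (- s)%:P) * ('X - s%:P)) ^+ 2 * P ^+ 2 =
  ('X - (- s)%:P) ^+ 2 * (('X - s%:P) * P) ^+ 2 by ring.
have n0 : 0 <= nikcst d.*2 by apply: le_trans (nikcst_ge1 _).
apply: le_trans (Lx_nikolskii s sP1) _.
rewrite [nikcst _ ^+ 2]expr2 -[leRHS]mulrA; apply: ler_wpM2l => //.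
by rewrite -exprMn; exact: Lx_nikolskii.
Qed.

(** Constant coefficients make the quadratic form of the Jacobi matrix a sum of row sums. The length
    [M + 2] leaves [M] interior rows that have both neighbours inside the window. *)
Definition window e M : {poly R} := \sum_(j < M.+2) psi (e + j).

Lemma size_window e M : (size (window e M) <= (e + M).+2)%N.
Proof.
apply: leq_trans (size_sum _ _ _) _; apply/bigmax_leqP => j _.
by rewrite size_psi; have := ltn_ord j; lia.
Qed.

Lemma Ly_window e M : Ly (window e M ^+ 2) = M.+2%:R.
Proof.
rewrite expr2 /window mulr_suml /Ly raddf_sum Lx_sum /=.
transitivity (\sum_(i < M.+2) (1 : R)); last by rewrite sumr_const card_ord.
apply: eq_bigr => i _.
rewrite mulr_sumr raddf_sum Lx_sum /= (bigD1 i)//= [Lx _]Ly_psi_orth eqxx.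
rewrite big1 ?addr0// => j ji; rewrite [Lx _]Ly_psi_orth eqn_add2l val_eqE.
by rewrite eq_sym (negbTE ji).
Qed.

Lemma Ly_X_window_ge e M :
  M%:R * (4 * gam e.*2) <= Ly ('X * window e M ^+ 2).
Proof.
have -> : Ly ('X * window e M ^+ 2) =
    \sum_(i < M.+2) \sum_(j < M.+2) Lx ('X^2 * phi (e + i).*2 * phi (e + j).*2).
  rewrite expr2 mulrA /window [X in Ly (X * _)]mulr_sumr mulr_suml /Ly raddf_sum Lx_sum /=.
  apply: eq_bigr => i _; rewrite mulr_sumr raddf_sum Lx_sum /=.
  by apply: eq_bigr => j _; rewrite -/(Ly _) Ly_psi_entry.
have r0 (i : nat) : 0 <= \sum_(j < M.+2) Lx ('X^2 * phi (e + i).*2 * phi (e + j).*2).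
  by apply: sumr_ge0 => j _; exact: jacobi_entry_ge0.
(* The two boundary rows are incomplete; they are only bounded below by zero. *)
rewrite [leRHS]big_ord_recl -[leLHS]add0r; apply: lerD; first exact: r0.
rewrite [leRHS]big_ord_recr -[leLHS]addr0; apply: lerD; last exact: r0.
have -> : M%:R * (4 * gam e.*2) = \sum_(i < M) 4 * gam e.*2.
  by rewrite sumr_const card_ord mulr_natl.
apply: ler_sum => i _.
pose J := (e + i).+1.*2.
have EJ : (e + bump 0 i).*2 = J by rewrite /J /bump /= add1n addnS.
rewrite EJ (@jacobi_row (fun j => (e + j).*2)); last by move=> x y /double_inj /addnI.
have iM := ltn_ord i.
rewrite (_ : [exists l : 'I_M.+2, J.+2 == (e + l).*2] = true); last first.
  have h : (i.+2 < M.+2)%N by [].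
  by apply/existsP; exists (Ordinal h); rewrite /J /= !addnS doubleS.
rewrite (_ : [exists l : 'I_M.+2, J == (e + l).*2] = true); last first.
  have h : (i.+1 < M.+2)%N by lia.
  by apply/existsP; exists (Ordinal h); rewrite /J /= addnS.
rewrite (_ : [exists l : 'I_M.+2, J == (e + l).*2.+2] = true); last first.
  have h : (i < M.+2)%N by lia.
  by apply/existsP; exists (Ordinal h); rewrite /J /= doubleS.
rewrite !mulr1 -reccoef_sqr.
have b0 := reccoef_ge0 e.*2.
have c1 : reccoef e.*2 <= reccoef J.-1 by apply: reccoef_le; rewrite /J; lia.
have c2 : reccoef J.-1 <= reccoef J by apply: reccoef_le; rewrite /J; lia.
have c3 : reccoef J <= reccoef J.+1 by apply: reccoef_le.
have c4 : reccoef J.+1 <= reccoef J.+2 by apply: reccoef_le.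
nra.
Qed.

End Orthogonality.
End Gegenbauer.

(** * The weight t^(-1/2) (1 - t)^a on the unit interval *)

Section JacobiWeight.
Variable R : realType.
Local Notation mu := (@lebesgue_measure R).

Lemma is_derive_onem (x : R) : is_derive x (1 : R) (fun t : R => 1 - t) (-1).
Proof.
have -> : (-1 : R) = 0 - 1 by rewrite sub0r.
exact: is_deriveB.
Qed.

Lemma is_derive_powR_onem (p x : R) : x < 1 ->
  is_derive x 1 (fun t : R => powR (1 - t) p) (- (p * powR (1 - x) (p - 1))).
Proof.
move=> x1; have x0 : 0 < 1 - x by rewrite subr_gt0.
have D1 := is_derive_onem x.
have D2 : is_derive (1 - x) (1 : R) (@powR R ^~ p) (p * powR (1 - x) (p - 1)).
  exact: is_derive1_powR.
by have := @is_derive1_comp R (@powR R ^~ p) (fun t => 1 - t) x _ _ D2 D1; rewrite mulrN1.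
Qed.

Lemma continuous_powR_gt0 (p x : R) : 0 < x -> {for x, continuous (@powR R ^~ p : R -> R)}.
Proof.
move=> x0; apply: differentiable_continuous; apply/derivable1_diffP.
by apply: derivable_powR; rewrite in_itv/= x0.
Qed.

Lemma continuous_powR_onem (p x : R) : x < 1 ->
  {for x, continuous ((fun t => powR (1 - t) p) : R -> R)}.
Proof.
move=> x1; apply: differentiable_continuous; apply/derivable1_diffP.
by have [] := is_derive_powR_onem p x1.
Qed.

Lemma powR_onem_cvg1 (p : R) : 1 <= p ->
  powR (1 - t) p @[t --> (1 : R)^'-] --> (0 : R).
Proof.
move=> p1; apply: (@squeeze_cvgr _ _ _ R (fun=> 0) (fun t => 1 - t)).
- near=> t; rewrite powR_ge0 /=; apply: ge1r_powR => //.
  have t1 : t < 1 by near: t; exact: nbhs_left_lt.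
  have t0 : 0 < t by near: t; exact: nbhs_left_gt.
  by rewrite subr_gt0 t1 /= lerBlDr lerDl ltW.
- exact: cvg_cst.
- rewrite -[X in _ --> X](subrr (1 : R)).
  by apply: cvgB; [exact: cvg_cst|exact: cvg_at_left_filter].
Unshelve. all: by end_near. Qed.

Definition jac (a t : R) : R := powR t (- (1 / 2)) * powR (1 - t) a.

Lemma jac_ge0 a t : 0 <= jac a t.
Proof. by rewrite mulr_ge0 ?powR_ge0. Qed.

Lemma measurable_jac a : measurable_fun setT (jac a).
Proof.
apply: measurable_funM; first exact: measurable_powR.
apply: (measurableT_comp (measurable_powR _)) => //.
exact: measurable_funB.
Qed.

(** The singularity of [t^(-1/2)] is cut off at [e]. At the right end, [1 <= a] squeezes [(1 - t)^a]
    between [0] and [1 - t]. *)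
Lemma within_continuous_jac a e : 1 <= a -> 0 < e < 1 ->
  {within `[e, 1], continuous (jac a)}.
Proof.
move=> a1 /andP[e0 e1]; apply/continuous_within_itvP => //; split.
- move=> x; rewrite in_itv/= => /andP[ex x1].
  apply: cvgM; first by apply: continuous_powR_gt0; exact: lt_trans ex.
  exact: continuous_powR_onem.
- apply: cvg_at_right_filter; apply: cvgM; first exact: continuous_powR_gt0.
  exact: continuous_powR_onem.
- rewrite {2}/jac subrr powR0 ?gt_eqF ?(lt_le_trans ltr01)//.
  apply: cvgM; first by apply: cvg_at_left_filter; exact: continuous_powR_gt0.
  exact: powR_onem_cvg1.
Qed.

Lemma is_derive_powR_half (t : R) : 0 < t ->
  is_derive t 1 (fun t : R => 2 * powR t (1 / 2)) (powR t (- (1 / 2))).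
Proof.
move=> t0.
have D1 : is_derive t 1 (@powR R ^~ (1 / 2 : R)) (1 / 2 * powR t (1 / 2 - 1)).
  exact: is_derive1_powR.
apply: (is_derive_eq (is_deriveZ 2 D1)).
rewrite /GRing.scale /=; have -> : 1 / 2 - 1 = - (1 / 2) :> R by lra.
by lra.
Qed.

(** The half-open interval is exhausted by compact ones; on each, the antiderivative [2 t^(1/2)]
    bounds the integral by 2, and monotone convergence concludes. *)
Lemma integrable_powR_mhalf :
  mu.-integrable `[0, 1] (EFin \o (fun t : R => powR t (- (1 / 2)))).
Proof.
pose f t : R := powR t (- (1 / 2)).
have mf : measurable_fun setT f by exact: measurable_powR.
apply/integrableP; split.
  by apply/measurable_EFinP; apply: measurable_funS mf.
under eq_integral do rewrite /= ger0_norm ?powR_ge0//.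
rewrite -integral_itv_obnd_cbnd; last first.
  by apply/measurable_EFinP; apply: measurable_funS mf.
(* Starting at [i.+2] keeps the left end strictly below 1, as the fundamental theorem of calculus
   requires. *)
pose F i : set R := [set` `[(i.+2%:R)^-1, 1%R]].
have FE : \bigcup_i F i = `]0%R, 1%R]%classic.
  apply/seteqP; split => x /=.
  - move=> [i _]; rewrite /F /= !in_itv/= => /andP[xi ->]; rewrite andbT.
    by apply: lt_le_trans xi; rewrite invr_gt0.
  - rewrite in_itv/= => /andP[x0 x1]; exists (Num.trunc x^-1) => //.
    rewrite /F /= in_itv/= x1 andbT -[leRHS]invrK lef_pV2 ?posrE ?invr_gt0//.
    apply: ltW; apply: lt_le_trans (_ : (Num.trunc x^-1).+1%:R <= _).
      exact: truncnS_gt.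
    by rewrite ler_nat.
rewrite -FE.
have cv := @ge0_nondecreasing_set_cvg_integral _ (measurableTypeR R) R F (fun t => (f t)%:E) (@lebesgue_measure R).
have le2 i : (\int[mu]_(x in F i) (f x)%:E <= 2%:E)%E.
  have i0 : 0 < (i.+2%:R : R)^-1 by rewrite invr_gt0.
  have i1 : (i.+2%:R : R)^-1 < 1 by rewrite invf_lt1// ltr1n.
  rewrite (@continuous_FTC2 _ f (fun t : R => 2 * powR t (1 / 2))) //.
  - rewrite powR1 mulr1 -EFinB lee_fin gerBl mulr_ge0 ?powR_ge0//.
  - apply: continuous_in_subspaceT => x; rewrite inE /= in_itv/= => /andP[x0 _].
    by apply: continuous_powR_gt0; exact: lt_le_trans x0.
  - split.
    + move=> x; rewrite in_itv/= => /andP[x0 _].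
      by have [] := is_derive_powR_half (lt_trans i0 x0).
    + apply: cvg_at_right_filter; apply: cvgM; first exact: cvg_cst.
      exact: continuous_powR_gt0.
    + apply: cvg_at_left_filter; apply: cvgM; first exact: cvg_cst.
      exact: continuous_powR_gt0.
  - move=> x; rewrite in_itv/= => /andP[x0 _].
    have D := is_derive_powR_half (lt_trans i0 x0).
    by rewrite derive1E derive_val.
apply: (@le_lt_trans _ _ 2%:E); last exact: ltry.
apply: (cvge_to_le (cv _ _ _ _)).
- move=> i j ij; apply/subsetPset => x; rewrite /F /= !in_itv/= => /andP[ix ->].
  rewrite andbT; apply: le_trans ix; rewrite lef_pV2 ?posrE// ler_nat.
  by rewrite !ltnS.
- by move=> i; exact: measurable_itv.
- by move=> i; apply/measurable_EFinP; apply: measurable_funS mf.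
- by move=> i x _; rewrite lee_fin powR_ge0.
- by near=> i; exact: le2.
Unshelve. all: by end_near. Qed.

Lemma within_continuous_bounded (h : R -> R) :
  {within `[0, 1], continuous h} -> exists M, forall t, 0 <= t <= 1 -> `|h t| <= M.
Proof.
move=> ch; have cn : {within `[0, 1], continuous (fun t => `|h t|)}.
  by move=> x; apply: cvg_norm; exact: ch.
have [c _ H] := EVT_max ler01 cn.
by exists `|h c| => t t01; apply: H; rewrite in_itv.
Qed.

(** Domination by a multiple of [t^(-1/2)]: [h] is bounded on the compact interval and
    [(1 - t)^a <= 1] there. *)
Lemma integrable_jac (a : R) (h : R -> R) : 0 <= a -> {within `[0, 1], continuous h} ->
  mu.-integrable `[0, 1] (EFin \o (fun t => h t * jac a t)).
Proof.
move=> a0 ch; have [M hM] := within_continuous_bounded ch.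
have mh : measurable_fun (`[0%R, 1%R] : set (measurableTypeR R)) h.
  exact: subspace_continuous_measurable_fun.
have I1 : mu.-integrable `[0, 1]
    (EFin \o (fun t : R => M * powR t (- (1 / 2)))).
  pose f (t : R) := powR t (- (1 / 2)).
  rewrite (_ : EFin \o _ = (fun t => M%:E * (EFin \o f) t)%E) //.
  by apply: integrableZl => //; exact: integrable_powR_mhalf.
apply: le_integrable I1 => //.
  apply/measurable_EFinP; apply: measurable_funM => //.
  by apply: measurable_funS (measurable_jac a).
move=> t; rewrite /= in_itv/= => t01; rewrite lee_fin.
rewrite [leRHS]ger0_norm; last first.
  by rewrite mulr_ge0 ?powR_ge0// (le_trans _ (hM _ t01)).
rewrite normrM ler_pM// ?hM// ger0_norm ?jac_ge0// /jac.
rewrite ler_piMr ?powR_ge0//; case/andP: t01 => t0 t1.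
have [->|t1'] := eqVneq t 1.
  rewrite subrr; have [->|az] := eqVneq a 0; first by rewrite powRr0.
  by rewrite powR0.
have u0 : 0 < 1 - t by rewrite subr_gt0 lt_neqAle t1'.
rewrite -[leRHS](powRr0 (1 - t)); apply: ger_powR a0.
by rewrite u0 /= lerBlDr lerDl.
Qed.


Definition I1 (a : R) (h : R -> R) : R := \int[mu]_(t in `[0%R, 1%R]) (h t * jac a t).

Lemma is_derive_pearson (a : R) (j : nat) (x : R) : 0 < x < 1 ->
  is_derive x 1 (fun t => powR t (j%:R + 1 / 2) * powR (1 - t) (a + 1))
    (((j%:R + 1 / 2) * x ^+ j - (j%:R + a + 3 / 2) * x ^+ j.+1) * jac a x).
Proof.
move=> /andP[x0 x1].
have D1 : is_derive x 1 (@powR R ^~ (j%:R + 1 / 2))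
    ((j%:R + 1 / 2) * powR x (j%:R + 1 / 2 - 1)) by exact: is_derive1_powR.
have D2 := is_derive_powR_onem (a + 1) x1.
apply: (is_derive_eq (is_deriveM D1 D2)).
have x10 : 0 < 1 - x by rewrite subr_gt0.
rewrite /jac /GRing.scale /= addrK.
have -> : powR x (j%:R + 1 / 2) = x ^+ j.+1 * powR x (- (1 / 2)).
  rewrite -powR_mulrn ?ltW// -powRD; last by rewrite (gt_eqF x0) implybT.
  by congr powR; rewrite -(natr1 j); lra.
have -> : powR x (j%:R + 1 / 2 - 1) = x ^+ j * powR x (- (1 / 2)).
  rewrite -powR_mulrn ?ltW// -powRD; last by rewrite (gt_eqF x0) implybT.
  by congr powR; lra.
have -> : powR (1 - x) (a + 1) = powR (1 - x) a * (1 - x).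
  rewrite powRD; last by rewrite (gt_eqF x10) implybT.
  by rewrite powRr1// ltW.
by rewrite exprS; field.
Qed.

Lemma continuous_poly_seg (f : R -> R) : continuous f -> {within `[0, 1], continuous f}.
Proof. by move=> cf; apply: continuous_subspaceT. Qed.

(** The integrand is the derivative of [t^(j + 1/2) (1 - t)^(a + 1)], which vanishes at both ends.
    Because of the singular weight at 0, the fundamental theorem is used on [[e, 1]] and then [e]
    tends to 0 from the right. *)
Lemma jac_pearson (a : R) (j : nat) : 1 <= a ->
  I1 a (fun t => (j%:R + 1 / 2) * t ^+ j - (j%:R + a + 3 / 2) * t ^+ j.+1) = 0.
Proof.
move=> a1; set h : R -> R := fun t => _.
have a0 : 0 <= a by apply: le_trans a1.
have ch : continuous h.
  by move=> x; apply: cvgB; apply: cvgM; try exact: cvg_cst; exact: exprn_continuous.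
have ih := integrable_jac a0 (continuous_poly_seg ch).
pose F (t : R) : R := powR t (j%:R + 1 / 2) * powR (1 - t) (a + 1).
have F1 : F 1 = 0 by rewrite /F subrr powR0 ?mulr0// gt_eqF//; lra.
have j0 : (0 : R) < j%:R + 1 / 2 by apply: ltr_wpDl => //; lra.
have FTC e : 0 < e < 1 ->
    \int[mu]_(t in `[e, 1%R]) (h t * jac a t) = - F e.
  move=> /andP[e0 e1]; rewrite /Rintegral.
  rewrite (@continuous_FTC2 _ (fun t => h t * jac a t) F)//.
  - by rewrite F1 sub0e.
  - move=> x; apply: cvgM; last first.
      by apply: within_continuous_jac => //; rewrite e0.
    by move: x; apply: continuous_subspaceT.
  - have e01 : 0 < e < 1 by rewrite e0.
    split.
    + move=> x; rewrite in_itv/= => /andP[ex x1].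
      have x01 : 0 < x < 1 by rewrite x1 (lt_trans e0).
      by have [] := is_derive_pearson a j x01.
    + apply: cvg_at_right_filter; apply: cvgM; first exact: continuous_powR_gt0.
      exact: continuous_powR_onem.
    + rewrite F1 -(mulr0 (powR 1 (j%:R + 1 / 2))).
      apply: cvgM; first by apply: cvg_at_left_filter; exact: continuous_powR_gt0.
      by apply: powR_onem_cvg1; rewrite ler_wpDl.
  - move=> x; rewrite in_itv/= => /andP[ex x1].
    have x01 : 0 < x < 1 by rewrite x1 (lt_trans e0).
    have D := is_derive_pearson a j x01.
    by rewrite derive1E derive_val.
have E e : 0 < e < 1 ->
    I1 a h = parameterized_integral mu 0 e (fun t => h t * jac a t) - F e.
  move=> /andP[e0 e1]; rewrite /parameterized_integral.
  rewrite addrC; apply/eqP; rewrite -subr_eq; apply/eqP.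
  rewrite -FTC ?e0// /I1 Rintegral_itvB ?bnd_simp ?ltW//.
  apply: Rintegral_itv_obnd_cbnd.
  apply: integrableS ih => //.
  move=> x; rewrite /= !in_itv/= => /andP[ex ->]; rewrite andbT.
  by apply: ltW; exact: lt_trans ex.
have L1 : (parameterized_integral mu 0 e (fun t => h t * jac a t) - F e)
    @[e --> (0 : R)^'+] --> (0 - 0 * powR (1 - 0) (a + 1) : R).
  apply: cvgB.
    by apply: cvg_at_right_filter; apply: parameterized_integral_cvg_left.
  apply: cvgM; first exact: powR_cvg0.
  by apply: cvg_at_right_filter; exact: continuous_powR_onem.
have L2 : I1 a h @[e --> (0 : R)^'+] --> (0 : R).
  rewrite [X in _ --> X](_ : 0 = 0 - 0 * powR (1 - 0) (a + 1)); last first.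
    by rewrite mul0r subr0.
  apply: cvg_trans L1; apply: near_eq_cvg; near=> e; rewrite -E//.
  apply/andP; split; near: e; [exact: nbhs_right_gt|exact: nbhs_right_lt].
apply: cvg_unique (cvg_cst _) L2; exact: Rhausdorff.
Unshelve. all: by end_near. Qed.


Definition C01 (h : R -> R) : Prop := {within `[0, 1], continuous h}.

Section Functional.
Variable a : R.
Hypothesis a1 : 1 <= a.

Let a0 : 0 <= a. Proof. exact: le_trans a1. Qed.


Lemma I1_ge0 h : (forall t, 0 <= t <= 1 -> 0 <= h t) -> 0 <= I1 a h.
Proof.
move=> h0; apply: Rintegral_ge0 => t; rewrite /= in_itv/= => t01.
by rewrite mulr_ge0 ?jac_ge0 ?h0.
Qed.

Lemma eq_I1 h g : (forall t, 0 <= t <= 1 -> h t = g t) -> I1 a h = I1 a g.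
Proof.
move=> hg; apply: eq_Rintegral => t; rewrite inE /= in_itv/= => t01.
by rewrite hg.
Qed.

Lemma I1D h g : C01 h -> C01 g -> I1 a (fun t => h t + g t) = I1 a h + I1 a g.
Proof.
move=> ch cg; rewrite /I1 -RintegralD//; [|exact: integrable_jac..].
by apply: eq_Rintegral => t _; rewrite mulrDl.
Qed.

Lemma I1Z c h : C01 h -> I1 a (fun t => c * h t) = c * I1 a h.
Proof.
move=> ch; rewrite /I1 -RintegralZl//; last exact: integrable_jac.
by apply: eq_Rintegral => t _; rewrite mulrA.
Qed.

Lemma I1_0 : I1 a (fun=> 0) = 0.
Proof.
rewrite -[RHS](mul0r (I1 a (fun=> 0))) -I1Z.
  by apply: eq_I1 => t _; rewrite mul0r.
by apply: continuous_poly_seg => x; exact: cvg_cst.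
Qed.

Lemma C01_cst c : C01 (fun=> c : R).
Proof. by apply: continuous_poly_seg => x; exact: cvg_cst. Qed.

Arguments C01_cst : clear implicits.

Lemma C01D h g : C01 h -> C01 g -> C01 (fun t => h t + g t).
Proof. by move=> ch cg x; exact: (cvgD (ch x) (cg x)). Qed.

Lemma C01N h : C01 h -> C01 (fun t => - h t).
Proof. by move=> ch x; apply: cvgN; exact: ch. Qed.

Lemma C01_horner (p : {poly R}) : C01 (horner p).
Proof. by apply: continuous_poly_seg; exact: continuous_horner. Qed.

Lemma I1B h g : C01 h -> C01 g -> I1 a (fun t => h t - g t) = I1 a h - I1 a g.
Proof.
move=> ch cg; rewrite I1D//; last exact: C01N.
rewrite -[in RHS]mulN1r -I1Z//; congr (_ + _).
by apply: eq_I1 => t _; rewrite mulN1r.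
Qed.

Lemma le_I1 h g : C01 h -> C01 g -> (forall t, 0 <= t <= 1 -> h t <= g t) ->
  I1 a h <= I1 a g.
Proof.
move=> ch cg hg; rewrite -subr_ge0 -I1B//.
by apply: I1_ge0 => t t01; rewrite subr_ge0 hg.
Qed.

Lemma I1_norm_le h M : C01 h -> (forall t, 0 <= t <= 1 -> `|h t| <= M) ->
  `|I1 a h| <= M * I1 a (fun=> 1).
Proof.
move=> ch hM; rewrite -I1Z; last exact: C01_cst.
have cM := C01_cst (M * 1); rewrite ler_norml; apply/andP; split.
- rewrite -mulN1r -I1Z//; apply: le_I1 => //; first exact: C01_cst.
  by move=> t /hM; rewrite mulr1 mulN1r ler_norml => /andP[].
- by apply: le_I1 => // t /hM; rewrite mulr1 ler_norml => /andP[].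
Qed.

(** On [[1/4, 1/2]] the weight is at least [(1/2)^a], and this interval already has positive
    length. *)
Lemma I1_1_gt0 : 0 < I1 a (fun=> 1).
Proof.
pose c := powR (1 / 2) a : R; have c0 : 0 < c by apply: powR_gt0; lra.
have fg := integrable_jac a0 (C01_cst 1).
pose A : set R := [set` `[1 / 4, 1 / 2]].
have sA : A `<=` `[0%R, 1%R].
  by move=> t; rewrite /A /= !in_itv/= => /andP[? ?]; apply/andP; split; lra.
suff H : ((c / 4)%:E <= \int[mu]_(t in `[0%R, 1%R]) (1 * jac a t)%:E)%E.
  apply: lt_le_trans (_ : c / 4 <= _); first by apply: divr_gt0 => //; lra.
  by rewrite -lee_fin /I1 /Rintegral fineK //; apply: integrable_fin_num fg.
apply: (@le_trans _ _ (\int[mu]_(t in A) (1 * jac a t)%:E)%E); last first.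
  apply: ge0_subset_integral => //.
  - by apply: measurable_itv.
  - by case/integrableP : fg.
  - by move=> t _; rewrite lee_fin mul1r jac_ge0.
apply: (@le_trans _ _ (\int[mu]_(t in A) (cst c%:E t))%E).
  rewrite integral_cst; last exact: measurable_itv.
  rewrite [X in (_ * X)%E](_ : _ = (1 / 4)%:E); last first.
    rewrite [LHS](lebesgue_measure_itv `[1 / 4, 1 / 2]) /= lte_fin ifT; last by lra.
    by rewrite -EFinB; congr (_%:E); lra.
  by rewrite -EFinM lee_fin mul1r.
apply: ge0_le_integral => //.
- by apply: measurable_itv.
- by move=> t _; rewrite /= lee_fin ltW.
- case/integrableP : fg => mf _; exact: measurable_funS mf.
move=> t; rewrite /A /= in_itv/= => /andP[t1 t2]; rewrite lee_fin mul1r /jac -[c]mul1r.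
apply: ler_pM => //; first exact: ltW.
- rewrite -[leLHS](powRr0 t); apply: ger_powR; last by lra.
  by apply/andP; split; lra.
- by apply: ge0_ler_powR; rewrite ?nnegrE//; lra.
Qed.

(* The integral of P against (1 - x^2)^a on [-1, 1], with x^2 = t: averaging over the two
   square roots of t avoids a change of variables. *)
Definition Lx (P : {poly R}) : R :=
  (I1 a (fun t => P.[Num.sqrt t]) + I1 a (fun t => P.[- Num.sqrt t])) / 2.

Let C01_sqrt (P : {poly R}) : C01 (fun t => P.[Num.sqrt t]).
Proof.
apply: continuous_poly_seg => x.
by apply: continuous_comp; [exact: sqrt_continuous|exact: continuous_horner].
Qed.

Let C01_Nsqrt (P : {poly R}) : C01 (fun t => P.[- Num.sqrt t]).
Proof.
apply: continuous_poly_seg => x.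
apply: (@continuous_comp _ _ _ (fun x : R => - Num.sqrt x)).
  by apply: cvgN; exact: sqrt_continuous.
exact: continuous_horner.
Qed.

Lemma LxD P Q : Lx (P + Q) = Lx P + Lx Q.
Proof.
have E (f : R -> R) : C01 (fun t => P.[f t]) -> C01 (fun t => Q.[f t]) ->
    I1 a (fun t => (P + Q).[f t]) = I1 a (fun t => P.[f t]) + I1 a (fun t => Q.[f t]).
  by move=> cP cQ; rewrite -I1D//; apply: eq_I1 => t _; rewrite hornerD.
by rewrite /Lx !E// -mulrDl addrACA.
Qed.

Lemma LxZ c P : Lx (c *: P) = c * Lx P.
Proof.
have E (f : R -> R) : C01 (fun t => P.[f t]) ->
    I1 a (fun t => (c *: P).[f t]) = c * I1 a (fun t => P.[f t]).
  by move=> cP; rewrite -I1Z//; apply: eq_I1 => t _; rewrite hornerZ.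
by rewrite /Lx !E// -mulrDr mulrA.
Qed.

Lemma Lx_ge0 P : (forall x, -1 <= x <= 1 -> 0 <= P.[x]) -> 0 <= Lx P.
Proof.
move=> P0; apply: divr_ge0 => //; apply: addr_ge0.
- apply: I1_ge0 => t /andP[t0 t1]; apply: P0.
  by rewrite (le_trans _ (sqrtr_ge0 t))//= -(@sqrtr1 R) ler_wsqrtr.
- apply: I1_ge0 => t /andP[t0 t1]; apply: P0.
  by rewrite lerN2 -{1}(@sqrtr1 R) ler_wsqrtr//=.
Qed.

Lemma Lx_comp (p : {poly R}) : Lx (p \Po 'X^2) = I1 a (horner p).
Proof.
have E : Lx (p \Po 'X^2) = (I1 a (horner p) + I1 a (horner p)) / 2.
  congr ((_ + _) / _); apply: eq_I1 => t /andP[t0 _];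
  by rewrite horner_comp hornerXn ?sqrrN sqr_sqrtr.
by rewrite E; field.
Qed.

Lemma Lx_odd (p : {poly R}) : Lx ('X * (p \Po 'X^2)) = 0.
Proof.
rewrite /Lx [X in _ + X](_ : _ = - I1 a (fun t => ('X * (p \Po 'X^2)).[Num.sqrt t])).
  by rewrite subrr mul0r.
rewrite -mulN1r -I1Z//; apply: eq_I1 => t _.
by rewrite !hornerM !horner_comp !hornerXn !hornerX sqrrN mulN1r mulNr.
Qed.

Lemma Lx_1_gt0 : 0 < Lx 1.
Proof.
have -> : (1 : {poly R}) = 1 \Po 'X^2 by rewrite comp_polyC.
rewrite Lx_comp (@eq_I1 _ (fun=> 1)); first exact: I1_1_gt0.
by move=> t _; rewrite hornerC.
Qed.

(** By linearity it suffices to treat monomials. Even powers produce an odd polynomial, killed by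
    the symmetric average; odd powers produce, in [y = x^2], twice the identity of [jac_pearson]. *)
Lemma Lx_pearson (r : {poly R}) :
  Lx ((1 - 'X^2) * r^`() - (2 * (a + 1 / 2) + 1) *: ('X * r)) = 0.
Proof.
pose T (r : {poly R}) := (1 - 'X^2) * r^`() - (2 * (a + 1 / 2) + 1) *: ('X * r).
have TD r1 r2 : T (r1 + r2) = T r1 + T r2.
  by rewrite /T derivD !mulrDr scalerDr opprD addrACA.
have TZ c r1 : T (c *: r1) = c *: T r1.
  rewrite /T derivZ -!scalerAr scalerBr; congr (_ - _).
  by rewrite !scalerA (mulrC c).
have L0 : Lx 0 = 0 by rewrite -(scale0r 0) LxZ mul0r.
rewrite -/(T r) -[r]coefK poly_def.
elim/big_ind: _ => [|r1 r2 H1 H2|i _].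
- by rewrite -(scale0r 0) TZ LxZ mul0r.
- by rewrite TD LxD H1 H2 addr0.
rewrite TZ LxZ; apply/eqP; rewrite mulf_eq0; apply/orP; right; apply/eqP.
have [j [->|->]] : exists j, (i : nat) = j.*2 \/ (i : nat) = j.*2.+1.
  exists (i./2); rewrite -{1 3}(odd_double_half i).
  by case: (odd i); [right|left].
- rewrite /T derivXn.
  (* The exponent [j.*2.-1] is truncated at [j = 0], where the derivative term is zero. *)
  have [->|j0] := posnP j.
    rewrite /= mulr0n mulr0 add0r -scaleNr LxZ expr0 -[X in Lx ('X * X)](comp_polyC _ 'X^2).
    by rewrite Lx_odd mulr0.
  have -> : (1 - 'X^2) * ('X^(j.*2.-1) *+ j.*2) - (2 * (a + 1 / 2) + 1) *: ('X * 'X^(j.*2)) =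
    'X * ((j.*2%:R *: ((1 - 'X) * 'X^(j.-1)) - ((2 * (a + 1 / 2) + 1) *: 'X^j)) \Po 'X^2).
    rewrite comp_polyB !comp_polyZ comp_polyM comp_polyB comp_polyC comp_polyX.
    rewrite !rmorphXn /= comp_polyX -!exprM !mul2n mulrBr -!scalerAr; congr (_ - _).
    rewrite -scaler_nat -scalerAr; congr (_ *: _); rewrite mulrCA -exprS; congr (_ * 'X^ _).
    by case: j j0 => // j _; rewrite doubleS.
  exact: Lx_odd.
- rewrite /T derivXn /=.
  have -> : (1 - 'X^2) * ('X^(j.*2) *+ j.*2.+1) - (2 * (a + 1 / 2) + 1) *: ('X * 'X^(j.*2.+1)) =
    ((2:R) *: ((j%:R + 1 / 2) *: 'X^j - (j%:R + a + 3 / 2) *: 'X^(j.+1))) \Po 'X^2.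
    rewrite comp_polyZ comp_polyB !comp_polyZ !rmorphXn /= comp_polyX -!exprM !mul2n.
    have e1 : (j.*2.+1)%:R = 2 * (j%:R + 1 / 2) :> R.
      by rewrite -natr1 -muln2 natrM; field.
    have e2 : 2 * (a + 1 / 2) + 1 = 2 * (j%:R + a + 3 / 2) - 2 * (j%:R + 1 / 2) by field.
    rewrite doubleS -scaler_nat e1 e2 !exprS.
    move: ('X^(j.*2)) (j%:R + 1 / 2) (j%:R + a + 3 / 2) => u A B.
    by rewrite -!mul_polyC !(polyCM, polyCB, polyCN, polyCD); ring.
  rewrite Lx_comp (@eq_I1 _ (fun t => 2 * ((j%:R + 1 / 2) * t ^+ j -
      (j%:R + a + 3 / 2) * t ^+ j.+1))); last first.
    by move=> t _; rewrite hornerZ hornerD hornerN !hornerZ !hornerXn.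
  rewrite I1Z ?jac_pearson ?mulr0//; apply: continuous_poly_seg => x.
  by apply: cvgB; apply: cvgM; try exact: cvg_cst; exact: exprn_continuous.
Qed.

End Functional.

End JacobiWeight.

(** * Iterated integrals over the cube *)

Section Cube.
Variables (R : realType) (m : nat).
Implicit Types (H G : ('I_m -> R) -> R) (y z : 'I_m -> R).

Definition cube y : Prop := forall i, 0 <= y i <= 1.

Definition dist1 y z : R := \sum_i `|y i - z i|.

(* Lipschitz continuity on the cube is preserved by partial integration, which makes every
   inner function of an iterated integral continuous, hence integrable. *)
Definition lipc H : Prop := exists L : R, 0 <= L /\
  forall y z, cube y -> cube z -> `|H y - H z| <= L * dist1 y z.

Lemma cube0 : cube (fun _ => 0).
Proof. by move=> i; rewrite lexx ler01. Qed.

Lemma cube_upd y j t : cube y -> 0 <= t <= 1 -> cube (upd y j t).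
Proof. by move=> cy t01 i; rewrite /upd; case: ifP. Qed.

Lemma dist1_upd y z j t : dist1 (upd y j t) (upd z j t) <= dist1 y z.
Proof.
by apply: ler_sum => i _; rewrite /upd; case: ifP => // _; rewrite subrr normr0.
Qed.

Lemma dist1_upd2 y j s t : dist1 (upd y j s) (upd y j t) <= `|s - t|.
Proof.
rewrite /dist1; have [jm|mj] := ltnP j m.
  rewrite (bigD1 (Ordinal jm)) //= {1 2}/upd eqxx big1 ?addr0// => i ij.
  by rewrite /upd (_ : (val i == j) = false) ?subrr ?normr0//; apply/negbTE.
rewrite big1 ?normr_ge0// => i _; rewrite /upd (_ : (val i == j) = false) ?subrr ?normr0//.
by apply/eqP => ij; have := ltn_ord i; rewrite -[X in (X < _)%N]/(val i) ij ltnNge mj.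
Qed.

Lemma lipc_bounded H : lipc H -> exists2 M, 0 <= M & forall y, cube y -> `|H y| <= M.
Proof.
move=> [L [L0 HL]]; exists (`|H (fun _ => 0)| + L * m%:R).
  by rewrite addr_ge0// mulr_ge0.
move=> y cy; have := HL _ _ cy cube0.
have : dist1 y (fun _ => 0) <= m%:R.
  rewrite -[leRHS](_ : \sum_(i < m) 1 = m%:R); last by rewrite sumr_const card_ord.
  by apply: ler_sum => i _; rewrite subr0; case/andP: (cy i) => y0 y1; rewrite ger0_norm.
move=> /(ler_wpM2l L0) H1 H2; have H3 := le_trans H2 H1.
rewrite -[H y](subrK (H (fun _ => 0))); apply: le_trans (ler_normD _ _) _.
by rewrite addrC lerD2l.
Qed.

Lemma lipc_cst c : lipc (fun _ => c).
Proof. by exists 0; split=> // y z _ _; rewrite subrr normr0 mul0r. Qed.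

Lemma lipc_coord i : lipc (fun y => y i).
Proof.
exists 1; split => // y z _ _; rewrite mul1r /dist1 (bigD1 i)//= lerDl.
exact: sumr_ge0.
Qed.

Lemma lipcD H G : lipc H -> lipc G -> lipc (fun y => H y + G y).
Proof.
move=> [L [L0 HL]] [K [K0 GK]]; exists (L + K); split; first exact: addr_ge0.
move=> y z cy cz; rewrite opprD addrACA mulrDl.
by apply: le_trans (ler_normD _ _) _; apply: lerD; [apply: HL|apply: GK].
Qed.

Lemma lipcM H G : lipc H -> lipc G -> lipc (fun y => H y * G y).
Proof.
move=> lH lG; have [M M0 HM] := lipc_bounded lH; have [N N0 GN] := lipc_bounded lG.
case: lH lG => [L [L0 HL]] [K [K0 GK]]; exists (M * K + L * N).
split; first by rewrite addr_ge0// mulr_ge0.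
move=> y z cy cz.
have -> : H y * G y - H z * G z = H y * (G y - G z) + (H y - H z) * G z by ring.
apply: le_trans (ler_normD _ _) _; rewrite !normrM mulrDl; apply: lerD.
  by rewrite -mulrA; apply: ler_pM => //; [exact: HM|exact: GK].
by rewrite mulrAC; apply: ler_pM => //; [exact: HL|exact: GN].
Qed.

Lemma lipcZ c H : lipc H -> lipc (fun y => c * H y).
Proof. by move=> lH; apply: lipcM => //; exact: lipc_cst. Qed.

Lemma lipcN H : lipc H -> lipc (fun y => - H y).
Proof.
move=> [L [L0 HL]]; exists L; split => // y z cy cz.
by rewrite -opprD normrN; exact: HL.
Qed.

Lemma lipcB H G : lipc H -> lipc G -> lipc (fun y => H y - G y).
Proof. by move=> lH lG; apply: lipcD => //; exact: lipcN. Qed.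

Lemma lipc_norm H : lipc H -> lipc (fun y => `|H y|).
Proof.
move=> [L [L0 HL]]; exists L; split => // y z cy cz.
by apply: le_trans (ler_dist_dist _ _) _; exact: HL.
Qed.

Lemma lipcX H n : lipc H -> lipc (fun y => H y ^+ n).
Proof.
move=> lH; elim: n => [|n IH]; first exact: (lipc_cst 1).
have -> : (fun y => H y ^+ n.+1) = fun y => H y * H y ^+ n by apply/funext => y; rewrite exprS.
exact: lipcM.
Qed.

Lemma lipc_sum (I : Type) (s : seq I) (P : pred I) (F : I -> ('I_m -> R) -> R) :
  (forall i, lipc (F i)) -> lipc (fun y => \sum_(i <- s | P i) F i y).
Proof.
move=> lF; elim: s => [|i s IH].
  have -> : (fun y => \sum_(i <- [::] | P i) F i y) = fun=> 0.
    by apply/funext => y; rewrite big_nil.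
  exact: lipc_cst.
have -> : (fun y => \sum_(j <- i :: s | P j) F j y) =
    fun y => (if P i then F i y else 0) + \sum_(j <- s | P j) F j y.
  by apply/funext => y; rewrite big_cons; case: (P i); rewrite ?add0r.
by apply: lipcD => //; case: (P i) => //; exact: lipc_cst.
Qed.

Lemma lipc_prod (I : Type) (s : seq I) (P : pred I) (F : I -> ('I_m -> R) -> R) :
  (forall i, lipc (F i)) -> lipc (fun y => \prod_(i <- s | P i) F i y).
Proof.
move=> lF; elim: s => [|i s IH].
  have -> : (fun y => \prod_(i <- [::] | P i) F i y) = fun=> 1.
    by apply/funext => y; rewrite big_nil.
  exact: lipc_cst.
have -> : (fun y => \prod_(j <- i :: s | P j) F j y) =
    fun y => (if P i then F i y else 1) * \prod_(j <- s | P j) F j y.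
  by apply/funext => y; rewrite big_cons; case: (P i); rewrite ?mul1r.
by apply: lipcM => //; case: (P i) => //; exact: lipc_cst.
Qed.

Lemma C01_lipschitz (h : R -> R) (L : R) : 0 <= L ->
  (forall s t, 0 <= s <= 1 -> 0 <= t <= 1 -> `|h s - h t| <= L * `|s - t|) -> C01 h.
Proof.
(* Composing with the retraction onto the unit interval extends [h] to a Lipschitz function on the
   line, whose restriction is continuous. *)
move=> L0 HL; pose clamp (t : R) : R := if t < 0 then 0 else if 1 < t then 1 else t.
have c01 t : 0 <= clamp t <= 1.
  by rewrite /clamp; case: ltP => t0; [lra|case: ltP => t1; lra].
have cK s t : `|clamp s - clamp t| <= `|s - t|.
  rewrite ler_norml -[`|s - t|]opprK opprK; apply/andP.
  have := ler_norm (s - t); have := ler_norm (t - s); rewrite distrC /clamp.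
  by case: (ltP s 0) => ?; case: (ltP t 0) => ?; case: (ltP 1 s) => ?; case: (ltP 1 t) => ?; split; lra.
apply: (@subspace_eq_continuous _ _ _ (h \o clamp)).
  move=> t; rewrite inE /= in_itv/= => /andP[t0 t1]; rewrite /clamp.
  by rewrite ltNge t0 /= ltNge t1.
apply: continuous_subspaceT => x; apply/cvgrPdist_lt => e e0.
have L1 : 0 < L + 1 by lra.
near=> t; apply: le_lt_trans (HL _ _ (c01 _) (c01 _)) _.
apply: (@le_lt_trans _ _ (L * `|x - t|)); first exact: ler_wpM2l.
have : `|x - t| < e / (L + 1).
  by near: t; apply: cvgr_dist_lt => //; rewrite divr_gt0.
rewrite ltr_pdivlMr// => H1; apply: le_lt_trans H1; rewrite mulrC.
by apply: ler_wpM2l => //; lra.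
Unshelve. all: by end_near. Qed.

Lemma lipc_C01 H y j : lipc H -> cube y -> C01 (fun t => H (upd y j t)).
Proof.
move=> [L [L0 HL]] cy; apply: (C01_lipschitz L0) => s t s01 t01.
apply: le_trans (HL _ _ (cube_upd j cy s01) (cube_upd j cy t01)) _.
by apply: ler_wpM2l => //; exact: dist1_upd2.
Qed.

Arguments lipc_C01 : clear implicits.

Section Integral.
Variable a : R.
Hypothesis a1 : 1 <= a.

Lemma lipc_I1 H j : lipc H -> lipc (fun y => I1 a (fun t => H (upd y j t))).
Proof.
move=> lH; case: (lH) => L [L0 HL]; exists (L * I1 a (fun=> 1)).
split; first by rewrite mulr_ge0// ltW// I1_1_gt0.
move=> y z cy cz; have cyj := lipc_C01 H y j lH cy; have czj := lipc_C01 H z j lH cz.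
rewrite -I1B// mulrAC; apply: I1_norm_le => //.
  by apply: C01D => //; exact: C01N.
move=> t t01; apply: le_trans (HL _ _ (cube_upd j cy t01) (cube_upd j cz t01)) _.
by apply: ler_wpM2l => //; exact: dist1_upd.
Qed.

(** The counterpart of [iter_int] with the one-variable weight built into each integration, so that
    the integrands stay Lipschitz. *)
Fixpoint iterI (j : nat) H y : R :=
  if j is j'.+1 then I1 a (fun t => iterI j' H (upd y j' t)) else H y.

Lemma lipc_iterI j H : lipc H -> lipc (iterI j H).
Proof. by elim: j => //= j IH lH; apply: lipc_I1; exact: IH. Qed.

Lemma eq_iterI j H G y : cube y -> (forall z, cube z -> H z = G z) ->
  iterI j H y = iterI j G y.
Proof.
elim: j y => /= [|j IH] y cy HG; first exact: HG.
by apply: eq_I1 => t t01; apply: IH => //; exact: cube_upd.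
Qed.

Lemma iterID j H G y : lipc H -> lipc G -> cube y ->
  iterI j (fun y => H y + G y) y = iterI j H y + iterI j G y.
Proof.
move=> lH lG; elim: j y => //= j IH y cy.
rewrite -I1D//; [|exact: lipc_C01 (lipc_iterI _ _) _..].
by apply: eq_I1 => t t01; apply: IH; exact: cube_upd.
Qed.

Lemma iterIZ j c H y : lipc H -> cube y ->
  iterI j (fun y => c * H y) y = c * iterI j H y.
Proof.
move=> lH; elim: j y => //= j IH y cy.
rewrite -I1Z//; last exact: lipc_C01 (lipc_iterI _ _) _.
by apply: eq_I1 => t t01; apply: IH; exact: cube_upd.
Qed.

Lemma iterI_ge0 j H y : cube y -> (forall z, cube z -> 0 <= H z) -> 0 <= iterI j H y.
Proof.
elim: j y => /= [|j IH] y cy H0; first exact: H0.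
by apply: I1_ge0 => t t01; apply: IH => //; exact: cube_upd.
Qed.

Lemma iterI_prod j (p : 'I_m -> {poly R}) y : (j <= m)%N -> cube y ->
  iterI j (fun y => \prod_i (p i).[y i]) y =
  \prod_(i < m) if (i < j)%N then I1 a (horner (p i)) else (p i).[y i].
Proof.
elim: j y => [|j IH] y jm cy /=; first by apply: eq_bigr.
pose J := Ordinal jm.
pose C := \prod_(i < m | i != J) if (i < j)%N then I1 a (horner (p i)) else (p i).[y i].
rewrite (@eq_I1 _ _ _ (fun t => C * (p J).[t])); last first.
  move=> t t01; rewrite IH ?(ltnW jm)//; last exact: cube_upd.
  rewrite (bigD1 J)//= ltnn mulrC /upd eqxx; congr (_ * _).
  by apply: eq_bigr => i; rewrite -val_eqE /= => /negbTE ->.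
rewrite I1Z//; last exact: C01_horner.
rewrite [RHS](bigD1 J)//= ltnSn mulrC; congr (_ * _).
apply: eq_bigr => i iJ; have e : (nat_of_ord i == j) = false by apply/negbTE.
by rewrite [in RHS]ltnS [in RHS]leq_eqVlt e.
Qed.

(** After [j] integrations the weights of the remaining coordinates are constants that factor out;
    carrying them in the statement makes the induction work. For [j = m] that product is empty. *)
Lemma iter_int_jac j H y : (j <= m)%N -> lipc H -> cube y ->
  iter_int j (fun y => H y * \prod_i jac a (y i)) y =
  (\prod_(i < m | (j <= i)%N) jac a (y i)) * iterI j H y.
Proof.
move=> jm lH; elim: j jm y => [|j IH] jm y cy /=; first by rewrite mulrC.
pose J := Ordinal jm.
rewrite -RintegralZl//; last first.
  apply: integrable_jac; first exact: le_trans a1.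
  exact: lipc_C01 (lipc_iterI _ _) _.
apply: eq_Rintegral => t; rewrite inE /= in_itv/= => t01.
rewrite IH ?(ltnW jm)//; last exact: cube_upd.
rewrite (bigD1 J)//= {1}/upd eqxx.
rewrite (eq_bigl (fun i : 'I_m => (j < i)%N)); last first.
  by move=> i; rewrite -val_eqE /= ltn_neqAle eq_sym andbC.
rewrite (eq_bigr (fun i => jac a (y i))); last first.
  by move=> i ji; rewrite /upd gtn_eqF.
ring.
Qed.

Definition Icube H := iterI m H (fun _ => 0).

Lemma IcubeD H G : lipc H -> lipc G -> Icube (fun y => H y + G y) = Icube H + Icube G.
Proof. by move=> lH lG; apply: iterID => //; exact: cube0. Qed.

Lemma IcubeZ c H : lipc H -> Icube (fun y => c * H y) = c * Icube H.
Proof. by move=> lH; apply: iterIZ => //; exact: cube0. Qed.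

Lemma IcubeB H G : lipc H -> lipc G -> Icube (fun y => H y - G y) = Icube H - Icube G.
Proof.
move=> lH lG; rewrite IcubeD//; last exact: lipcN.
rewrite -[in RHS]mulN1r -IcubeZ//; congr (_ + Icube _).
by apply/funext => y; rewrite mulN1r.
Qed.

Lemma Icube_ge0 H : (forall y, cube y -> 0 <= H y) -> 0 <= Icube H.
Proof. by apply: iterI_ge0; exact: cube0. Qed.

Lemma eq_Icube H G : (forall y, cube y -> H y = G y) -> Icube H = Icube G.
Proof. by apply: eq_iterI; exact: cube0. Qed.

Lemma le_Icube H G : lipc H -> lipc G -> (forall y, cube y -> H y <= G y) -> Icube H <= Icube G.
Proof.
move=> lH lG HG; rewrite -subr_ge0 -IcubeB//.
by apply: Icube_ge0 => y cy; rewrite subr_ge0 HG.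
Qed.

Lemma Icube_sum (I : Type) (s : seq I) (P : pred I) (F : I -> ('I_m -> R) -> R) :
  (forall i, lipc (F i)) ->
  Icube (fun y => \sum_(i <- s | P i) F i y) = \sum_(i <- s | P i) Icube (F i).
Proof.
move=> lF; elim: s => [|i s IH].
  rewrite big_nil -[RHS](mul0r (Icube (fun=> 0))) -IcubeZ; last exact: lipc_cst.
  by apply: eq_Icube => y _; rewrite big_nil mul0r.
rewrite big_cons; case: ifP => Pi.
  rewrite -IH -IcubeD//; last exact: lipc_sum.
  by apply: eq_Icube => y _; rewrite big_cons Pi.
by rewrite -IH; apply: eq_Icube => y _; rewrite big_cons Pi.
Qed.

Lemma Icube_prod (p : 'I_m -> {poly R}) :
  Icube (fun y => \prod_i (p i).[y i]) = \prod_i I1 a (horner (p i)).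
Proof.
rewrite /Icube iterI_prod//; last exact: cube0.
by apply: eq_bigr => i _; rewrite ltn_ord.
Qed.

Lemma cube_int_jac H : lipc H ->
  cube_int (fun y => H y * \prod_i jac a (y i)) = Icube H.
Proof.
move=> lH; rewrite /cube_int iter_int_jac//; last exact: cube0.
by rewrite big_pred0 ?mul1r// => i; rewrite leqNgt ltn_ord.
Qed.

End Integral.
End Cube.

(** * Orthonormal Jacobi polynomials of the concrete weight *)

Section JacobiPolynomials.
Variables (R : realType) (a : R).
Hypothesis a1 : 1 <= a.

(** The Gegenbauer parameter with [(1 - x^2)^(gegpar - 1/2) = (1 - x^2)^a]. For the exponent of the
    Grassmannian weight it equals [n / 2 - m]. *)
Definition gegpar : R := a + 1 / 2.

Lemma gegpar_gt1 : 1 < gegpar.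
Proof. by have h := a1; rewrite /gegpar; lra. Qed.

Definition jacpoly : nat -> {poly R} := psi gegpar (Lx a).
Definition Ljac (p : {poly R}) : R := I1 a (horner p).

Let hD := LxD a1.
Let hZ := LxZ a1.
Let h0 := @Lx_ge0 R a.
Let h1 := Lx_1_gt0 a1.
Let hP : forall r, Lx a ((1 - 'X^2) * r^`() - (2 * gegpar + 1) *: ('X * r)) = 0 :=
  Lx_pearson a1.

Lemma LjacE p : Ljac p = Ly (Lx a) p.
Proof. by rewrite /Ljac /Ly Lx_comp. Qed.

Lemma size_jacpoly j : size (jacpoly j) = j.+1.
Proof. exact: (size_psi gegpar_gt1 hD hZ h1 hP). Qed.

Lemma Ljac_orth i j : Ljac (jacpoly i * jacpoly j) = (i == j)%:R.
Proof. by rewrite LjacE (Ly_psi_orth gegpar_gt1 hD hZ h1 hP). Qed.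

Lemma Ljac_entry_ge0 i j : 0 <= Ljac ('X * jacpoly i * jacpoly j).
Proof. by rewrite LjacE (Ly_psi_entry_ge0 gegpar_gt1 hD hZ h1 hP). Qed.

Lemma Ljac_row_le j N : \sum_(l < N) Ljac ('X * jacpoly j * jacpoly l) <= 4 * gam gegpar j.*2.+2.
Proof.
by under eq_bigr do rewrite LjacE; exact: (Ly_psi_row_le gegpar_gt1 hD hZ h1 hP).
Qed.

Lemma Ljac_nikolskii d (p : {poly R}) (b : R) : (size p <= d)%N -> 0 <= b ->
  Ljac (p ^+ 2) <= nikcst gegpar d.*2 ^+ 2 * Ljac (('X - b%:P) ^+ 2 * p ^+ 2).
Proof. by rewrite !LjacE; exact: (Ly_nikolskii gegpar_gt1 hD hZ h0 h1 hP). Qed.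

Definition jacwindow e M : {poly R} := window gegpar (Lx a) e M.

Lemma size_jacwindow e M : (size (jacwindow e M) <= (e + M).+2)%N.
Proof. exact: (size_window gegpar_gt1 hD hZ h1 hP). Qed.

Lemma Ljac_jacwindow e M : Ljac (jacwindow e M ^+ 2) = M.+2%:R.
Proof. by rewrite LjacE; exact: (Ly_window gegpar_gt1 hD hZ h1 hP). Qed.

Lemma Ljac_X_jacwindow_ge e M : M%:R * (4 * gam gegpar e.*2) <= Ljac ('X * jacwindow e M ^+ 2).
Proof. by rewrite LjacE; exact: (Ly_X_window_ge gegpar_gt1 hD hZ h1 hP). Qed.

End JacobiPolynomials.

(** * Product weights and total degree *)

Section PolyLe.
Variables (R : realType) (m : nat).
Implicit Types (P Q : ('I_m -> R) -> R) (y : 'I_m -> R).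

Definition monom (e : 'I_m -> nat) y : R := \prod_(i < m) y i ^+ e i.

Lemma poly_le_monom k (e : 'I_m -> nat) : (\sum_i e i <= k)%N -> poly_le k (monom e).
Proof.
move=> ek.
have ei i : (e i < k.+1)%N by rewrite ltnS (leq_trans _ ek)// (bigD1 i)//= leq_addr.
pose b : {ffun 'I_m -> 'I_k.+1} := [ffun i => Ordinal (ei i)].
exists (fun a => (a == b)%:R); apply/funext => y.
rewrite (bigD1 b)/=; last first.
  by rewrite (eq_bigr e)// => i _; rewrite ffunE.
rewrite eqxx mul1r [X in _ + X]big1 ?addr0; last first.
  by move=> d /andP[_ /negbTE ->]; rewrite mul0r.
by apply: eq_bigr => i _; rewrite ffunE.
Qed.

Lemma poly_le0 k : poly_le k (fun _ : 'I_m -> R => 0).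
Proof.
by exists (fun=> 0); apply/funext => y; rewrite big1// => b _; rewrite mul0r.
Qed.

Lemma poly_leD k P Q : poly_le k P -> poly_le k Q -> poly_le k (fun y => P y + Q y).
Proof.
move=> [c ->] [d ->]; exists (fun b => c b + d b); apply/funext => y.
by rewrite -big_split /=; apply: eq_bigr => b _; rewrite mulrDl.
Qed.

Lemma poly_leZ k x P : poly_le k P -> poly_le k (fun y => x * P y).
Proof.
move=> [c ->]; exists (fun b => x * c b); apply/funext => y.
by rewrite mulr_sumr; apply: eq_bigr => b _; rewrite mulrA.
Qed.

Lemma poly_le_sum k (I : Type) (s : seq I) (T : pred I) (F : I -> ('I_m -> R) -> R) :
  (forall i, T i -> poly_le k (F i)) -> poly_le k (fun y => \sum_(i <- s | T i) F i y).
Proof.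
move=> HF; elim: s => [|i s IH].
  have -> : (fun y => \sum_(i <- [::] | T i) F i y) = fun=> 0.
    by apply/funext => y; rewrite big_nil.
  exact: poly_le0.
case Ti : (T i).
  have -> : (fun y => \sum_(j <- i :: s | T j) F j y) =
      fun y => F i y + \sum_(j <- s | T j) F j y.
    by apply/funext => y; rewrite big_cons Ti.
  by apply: poly_leD => //; exact: HF.
have -> : (fun y => \sum_(j <- i :: s | T j) F j y) =
    fun y => \sum_(j <- s | T j) F j y by apply/funext => y; rewrite big_cons Ti.
exact: IH.
Qed.

(** An induction principle that hides the coefficient families: properties stable under linear
    combinations are checked on monomials. *)
Lemma poly_le_ind k (T : (('I_m -> R) -> R) -> Prop) :
  T (fun=> 0) -> (forall P Q, T P -> T Q -> T (fun y => P y + Q y)) ->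
  (forall x P, T P -> T (fun y => x * P y)) ->
  (forall e : 'I_m -> nat, (\sum_i e i <= k)%N -> T (monom e)) ->
  forall P, poly_le k P -> T P.
Proof.
move=> T0 TD TZ Tm P [c ->].
pose F (b : {ffun 'I_m -> 'I_k.+1}) y : R := c b * \prod_(i < m) y i ^+ b i.
have : forall s : seq {ffun 'I_m -> 'I_k.+1},
    T (fun y => \sum_(b <- s | (\sum_(i < m) b i <= k)%N) F b y).
  elim=> [|b s IH].
    have -> // : (fun y => \sum_(b <- [::] : seq {ffun 'I_m -> 'I_k.+1} |
        (\sum_(i < m) b i <= k)%N) F b y) = fun=> 0.
    by apply/funext => y; rewrite big_nil.
  case bk : (\sum_(i < m) b i <= k)%N.
    have -> : (fun y => \sum_(d <- b :: s | (\sum_(i < m) d i <= k)%N) F d y) =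
        fun y => F b y + \sum_(d <- s | (\sum_(i < m) d i <= k)%N) F d y.
      by apply/funext => y; rewrite big_cons bk.
    by apply: TD => //; apply: TZ; exact: (Tm (fun i => b i)).
  have -> // : (fun y => \sum_(d <- b :: s | (\sum_(i < m) d i <= k)%N) F d y) =
      fun y => \sum_(d <- s | (\sum_(i < m) d i <= k)%N) F d y.
  by apply/funext => y; rewrite big_cons bk.
exact.
Qed.

Lemma poly_le_leq k l P : (k <= l)%N -> poly_le k P -> poly_le l P.
Proof.
move=> kl; apply: poly_le_ind; first exact: poly_le0.
- by move=> ? ?; exact: poly_leD.
- by move=> ? ?; exact: poly_leZ.
- by move=> e ek; apply: poly_le_monom; exact: leq_trans kl.
Qed.

Lemma poly_leM k l P Q : poly_le k P -> poly_le l Q -> poly_le (k + l) (fun y => P y * Q y).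
Proof.
move=> kP lQ; move: P kP; apply: poly_le_ind.
- by under eq_fun do rewrite mul0r; exact: poly_le0.
- by move=> P1 P2 h1 h2; under eq_fun do rewrite mulrDl; exact: poly_leD.
- by move=> x P h; under eq_fun do rewrite -mulrA; exact: poly_leZ.
move=> e ek; move: Q lQ; apply: poly_le_ind.
- by under eq_fun do rewrite mulr0; exact: poly_le0.
- by move=> P1 P2 h1 h2; under eq_fun do rewrite mulrDr; exact: poly_leD.
- by move=> x P h; under eq_fun do rewrite mulrCA; exact: poly_leZ.
move=> f fl; have -> : (fun y => monom e y * monom f y) = monom (fun i => e i + f i)%N.
  by apply/funext => y; rewrite /monom -big_split; apply: eq_bigr => i _; rewrite exprD.
by apply: poly_le_monom; rewrite big_split leq_add.
Qed.

Lemma poly_le_cst k x : poly_le k (fun _ : 'I_m -> R => x).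
Proof.
have -> : (fun _ : 'I_m -> R => x) = fun y => x * monom (fun=> 0%N) y.
  by apply/funext => y; rewrite /monom big1 ?mulr1// => i _; rewrite expr0.
by apply: poly_leZ; apply: poly_le_monom; rewrite big1.
Qed.

Lemma poly_le_coord i : poly_le 1 (fun y => y i).
Proof.
have -> : (fun y : 'I_m -> R => y i) = monom (fun j => (j == i) : nat).
  apply/funext => y; rewrite /monom (bigD1 i)//= eqxx expr1 big1 ?mulr1//.
  by move=> j /negbTE ->; rewrite expr0.
apply: poly_le_monom; rewrite (bigD1 i)//= eqxx big1// => j /negbTE.
by move=> ->.
Qed.

Lemma poly_leX k n P : poly_le k P -> poly_le (n * k) (fun y => P y ^+ n).
Proof.
move=> kP; elim: n => [|n IH].
  by under eq_fun do rewrite expr0; exact: poly_le_cst.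
by under eq_fun do rewrite exprS; rewrite mulSn; exact: poly_leM.
Qed.

Lemma poly_le_sigma : poly_le 1 (@sigma R m).
Proof. by apply: poly_le_sum => i _; exact: poly_le_coord. Qed.

Lemma poly_le_horner d (p : {poly R}) i : (size p <= d.+1)%N ->
  poly_le d (fun y => p.[y i]).
Proof.
move=> sp; have -> : (fun y : 'I_m -> R => p.[y i]) =
    fun y => \sum_(j < d.+1) p`_j * y i ^+ j.
  by apply/funext => y; rewrite (horner_coef_wide _ sp).
apply: poly_le_sum => j _; apply: poly_leZ.
apply: (@poly_le_leq (j * 1)); first by rewrite muln1 -ltnS ltn_ord.
by apply: poly_leX; exact: poly_le_coord.
Qed.

Lemma poly_le_prod (I : Type) (s : seq I) (k : I -> nat) (F : I -> ('I_m -> R) -> R) :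
  (forall i, poly_le (k i) (F i)) ->
  poly_le (\sum_(i <- s) k i) (fun y => \prod_(i <- s) F i y).
Proof.
move=> HF; elim: s => [|i s IH].
  have -> : (fun y => \prod_(i <- [::]) F i y) = fun=> 1.
    by apply/funext => y; rewrite big_nil.
  exact: poly_le_cst.
have -> : (fun y => \prod_(j <- i :: s) F j y) = fun y => F i y * \prod_(j <- s) F j y.
  by apply/funext => y; rewrite big_cons.
by rewrite big_cons; exact: poly_leM.
Qed.

Lemma poly_le_lipc k P : poly_le k P -> lipc P.
Proof.
apply: poly_le_ind; first exact: lipc_cst.
- by move=> ? ?; exact: lipcD.
- by move=> ? ?; exact: lipcZ.
- by move=> e _; apply: lipc_prod => i; apply: lipcX; exact: lipc_coord.
Qed.

Lemma lipc_sigma : lipc (@sigma R m).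
Proof. exact: poly_le_lipc poly_le_sigma. Qed.

Lemma poly_le_slice k P y i : poly_le k P ->
  exists2 p : {poly R}, (size p <= k.+1)%N & forall t, P (upd y i t) = p.[t].
Proof.
move: P; apply: poly_le_ind.
- by exists 0; rewrite ?size_poly0// => t; rewrite horner0.
- move=> P Q [p sp Hp] [q sq Hq]; exists (p + q) => [|t]; last by rewrite Hp Hq hornerD.
  by rewrite (leq_trans (size_polyD _ _))// geq_max sp.
- move=> x P [p sp Hp]; exists (x *: p) => [|t]; last by rewrite Hp hornerZ.
  exact: leq_trans (size_scale_leq _ _) sp.
move=> e ek; have [im|mi] := ltnP i m.
  pose I := Ordinal im; pose c := \prod_(j < m | j != I) y j ^+ e j.
  exists (c *: 'X^(e I)) => [|t].
    apply: leq_trans (size_scale_leq _ _) _; rewrite size_polyXn ltnS.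
    by apply: leq_trans ek; rewrite (bigD1 I)//= leq_addr.
  rewrite hornerZ hornerXn /monom (bigD1 I)//= mulrC /upd eqxx; congr (_ * _).
  by apply: eq_bigr => j jI; rewrite (_ : (val j == i) = false)//; apply/negbTE.
(* An index [i] outside the range makes [upd] the identity, so the slice is constant. *)
exists (monom e y)%:P => [|t]; first by rewrite (leq_trans (size_polyC_leq1 _)).
rewrite hornerC; apply: eq_bigr => j _; rewrite /upd (_ : (val j == i) = false)//.
by apply/eqP => ji; have := ltn_ord j; rewrite -[X in (X < _)%N]/(val j) ji ltnNge mi.
Qed.

Variable a : R.
Hypothesis a1 : 1 <= a.

Definition jacpolym (b : 'I_m -> nat) y : R := \prod_(i < m) (jacpoly a (b i)).[y i].

Lemma poly_le_jacpolym (b : 'I_m -> nat) : poly_le (\sum_i b i) (jacpolym b).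
Proof.
by apply: poly_le_prod => i; apply: poly_le_horner; rewrite size_jacpoly.
Qed.

(** Multi-indices with entries at most [k] may have total degree up to [m k]. The vanishing clause
    records that passing to the product basis respects total degree, since ['X^n] only involves
    [jacpoly] of index at most [n]. *)
Lemma poly_le_psi k P : poly_le k P ->
  exists c : {ffun 'I_m -> 'I_k.+1} -> R,
    (forall b : {ffun 'I_m -> 'I_k.+1}, ~~ (\sum_(i < m) b i <= k)%N -> c b = 0) /\
    P = fun y => \sum_b c b * jacpolym (fun i => b i) y.
Proof.
move: P; apply: poly_le_ind.
- exists (fun=> 0); split => //; apply/funext => y.
  by rewrite big1// => b _; rewrite mul0r.
- move=> P Q [c [c0 ->]] [d [d0 ->]]; exists (fun b => c b + d b); split.
    by move=> b bk; rewrite c0// d0// addr0.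
  apply/funext => y; rewrite -big_split /=; apply: eq_bigr => b _.
  by rewrite mulrDl.
- move=> x P [c [c0 ->]]; exists (fun b => x * c b); split.
    by move=> b bk; rewrite c0// mulr0.
  by apply/funext => y; rewrite mulr_sumr; apply: eq_bigr => b _; rewrite mulrA.
move=> e ek.
have ei i : (e i <= k)%N by rewrite (leq_trans _ ek)// (bigD1 i)//= leq_addr.
(* The coefficients are extended by zero beyond [n], so that one family serves for every summation
   range [N]. *)
have HX n : exists c : nat -> R, (forall l, (n < l)%N -> c l = 0) /\
    forall N, (n < N)%N -> 'X^n = \sum_(l < N) c l *: jacpoly a l.
  have [|c Hc] := @triangular_span R (jacpoly a) n.+1 'X^n (size_jacpoly a1).
    by rewrite size_polyXn.
  exists (fun l => if (l <= n)%N then c l else 0); split.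
    by move=> l nl; rewrite leqNgt nl.
  move=> N nN; rewrite Hc.
  rewrite (big_ord_widen_cond N predT (fun l => c l *: jacpoly a l) nN) /= big_mkcond /=.
  by apply: eq_bigr => l _; rewrite ltnS; case: ifP => //; rewrite scale0r.
have [M HM] := choice HX.
exists (fun b : {ffun 'I_m -> 'I_k.+1} => \prod_i M (e i) (b i)); split.
  move=> b; rewrite -ltnNge => kb.
  have [/existsP[i ib]|nb] := boolP [exists i : 'I_m, (e i < b i)%N].
    by rewrite (bigD1 i)//= (HM _).1// mul0r.
  move: kb; rewrite ltnNge (leq_trans _ ek)//; apply: leq_sum => i _.
  by rewrite leqNgt; apply: contra nb => ib; apply/existsP; exists i.
apply/funext => y; rewrite /monom.
transitivity (\prod_(i < m) \sum_(l < k.+1) M (e i) l * (jacpoly a l).[y i]).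
  apply: eq_bigr => i _; rewrite -hornerXn ((HM (e i)).2 k.+1) ?ltnS// horner_sum.
  by apply: eq_bigr => l _; rewrite hornerZ.
rewrite bigA_distr_bigA /=; apply: eq_bigr => b _.
by rewrite /jacpolym -big_split.
Qed.

Lemma Icube_jacpolymM (b c : 'I_m -> nat) :
  Icube a (fun y => jacpolym b y * jacpolym c y) = [forall i, b i == c i]%:R.
Proof.
have -> : (fun y => jacpolym b y * jacpolym c y) = fun y => \prod_i (jacpoly a (b i) * jacpoly a (c i)).[y i].
  by apply/funext => y; rewrite /jacpolym -big_split; apply: eq_bigr => i _; rewrite hornerM.
rewrite Icube_prod//; case: (boolP [forall i, b i == c i]) => [/forallP H|].
  by rewrite big1// => i _; rewrite -/(Ljac _ _) Ljac_orth// H.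
rewrite negb_forall => /existsP[i /negbTE H].
by rewrite (bigD1 i)//= -/(Ljac _ _) Ljac_orth// H mul0r.
Qed.

(** Matrix of multiplication by [sigma] in the product basis: a sum over [i] of tensor products with
    the Jacobi matrix in coordinate [i] and the identity elsewhere. *)
Definition sigma_entry (b c : 'I_m -> nat) : R :=
  \sum_i \prod_j Ljac a ((if j == i then 'X else 1) * jacpoly a (b j) * jacpoly a (c j)).

Lemma Icube_sigma_jacpolymM (b c : 'I_m -> nat) :
  Icube a (fun y => sigma y * (jacpolym b y * jacpolym c y)) = sigma_entry b c.
Proof.
pose p i j := (if j == i then 'X else 1) * jacpoly a (b j) * jacpoly a (c j).
have -> : (fun y => sigma y * (jacpolym b y * jacpolym c y)) =
    fun y => \sum_i \prod_j (p i j).[y j].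
  apply/funext => y; rewrite /sigma mulr_suml; apply: eq_bigr => i _.
  rewrite /jacpolym -big_split /= (bigD1 i)//= [RHS](bigD1 i)//= mulrA; congr (_ * _).
    by rewrite /p eqxx !hornerM hornerX mulrA.
  by apply: eq_bigr => j /negbTE ji; rewrite /p ji mul1r hornerM.
rewrite Icube_sum//; last first.
  move=> i; apply: lipc_prod => j.
  by apply: poly_le_lipc; apply: (poly_le_horner (d := size (p i j))).
by apply: eq_bigr => i _; rewrite Icube_prod.
Qed.

Lemma lipc_jacpolym b : lipc (jacpolym b).
Proof.
apply: lipc_prod => j.
by apply: poly_le_lipc; apply: (poly_le_horner (d := size (jacpoly a (b j)))).
Qed.

Lemma Icube_sqr_expand (T : finType) (f : T -> 'I_m -> nat) (c : T -> R) G : lipc G ->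
  Icube a (fun y => G y * (\sum_b c b * jacpolym (f b) y) ^+ 2) =
  \sum_b \sum_d c b * c d * Icube a (fun y => G y * (jacpolym (f b) y * jacpolym (f d) y)).
Proof.
move=> lG.
have -> : (fun y => G y * (\sum_b c b * jacpolym (f b) y) ^+ 2) =
    fun y => \sum_b \sum_d (c b * c d) * (G y * (jacpolym (f b) y * jacpolym (f d) y)).
  apply/funext => y; rewrite expr2 mulr_suml mulr_sumr; apply: eq_bigr => b _.
  by rewrite mulr_sumr mulr_sumr; apply: eq_bigr => d _; ring.
have lp b d : lipc (fun y => G y * (jacpolym (f b) y * jacpolym (f d) y)).
  by apply: lipcM => //; apply: lipcM; exact: lipc_jacpolym.
rewrite Icube_sum//; last by move=> b; apply: lipc_sum => d; apply: lipcZ.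
apply: eq_bigr => b _; rewrite Icube_sum//; last by move=> d; apply: lipcZ.
by apply: eq_bigr => d _; rewrite IcubeZ.
Qed.

Lemma Icube_parseval k (c : {ffun 'I_m -> 'I_k.+1} -> R) :
  Icube a (fun y => (\sum_b c b * jacpolym (fun i => b i) y) ^+ 2) = \sum_b c b ^+ 2.
Proof.
transitivity (Icube a (fun y => 1 * (\sum_b c b * jacpolym (fun i => b i) y) ^+ 2)).
  by apply: eq_Icube => y _; rewrite mul1r.
rewrite Icube_sqr_expand; last exact: lipc_cst.
have E (b d : {ffun 'I_m -> 'I_k.+1}) : Icube a (fun y => 1 * (jacpolym (fun i => b i) y * jacpolym (fun i => d i) y)) =
    (b == d)%:R.
  rewrite -[RHS](_ : [forall i, (b i : nat) == d i]%:R = _); last first.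
    congr (_%:R); congr nat_of_bool; apply/forallP/eqP => [H|-> //].
    by apply/ffunP => i; apply/val_inj; exact/eqP/(H i).
  by rewrite -Icube_jacpolymM; apply: eq_Icube => y _; rewrite mul1r.
apply: eq_bigr => b _; rewrite (bigD1 b)//= E eqxx mulr1 big1 ?addr0 ?expr2//.
by move=> d db; rewrite E eq_sym (negbTE db) mulr0.
Qed.

(** By Parseval a vanishing integral forces all coefficients to vanish, which spares any argument
    about null sets. *)
Lemma Icube_sqr_gt0 k P : poly_le k P -> P <> (fun=> 0) -> 0 < Icube a (fun y => P y ^+ 2).
Proof.
move=> /poly_le_psi[c [_ ->]] P0; rewrite Icube_parseval lt_neqAle.
rewrite sumr_ge0 ?andbT; last by move=> b _; exact: sqr_ge0.
apply/eqP => /esym/eqP; rewrite psumr_eq0; last by move=> b _; exact: sqr_ge0.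
move=> /allP H; apply: P0; apply/funext => y; rewrite big1// => b _.
have := H b (mem_index_enum b); rewrite /= sqrf_eq0 => /eqP ->.
by rewrite mul0r.
Qed.

(** The value of [m (1 - lam (lam - 1) / x^2)] at [x = lam + 2 + 2 k / m], that is, when the total
    degree [k] is spread evenly over the variables. *)
Definition sigma_bound (k : nat) : R :=
  m%:R * (1 - gegpar a * (gegpar a - 1) / (gegpar a + 2 + 2 * k%:R / m%:R) ^+ 2).

(* Convexity of [x |-> x^-2], through its tangent at the mean. *)
Lemma sum_gam_le k (b : 'I_m -> nat) : (0 < m)%N -> (\sum_i b i <= k)%N ->
  \sum_i 4 * gam (gegpar a) (b i).*2.+2 <= sigma_bound k.
Proof.
move=> m0 bk; have l1 := gegpar_gt1 a1.
have m0R : (0 : R) < m%:R by rewrite ltr0n.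
pose x0 : R := gegpar a + 2 + 2 * k%:R / m%:R.
pose x (i : 'I_m) : R := gegpar a + 2 + 2 * (b i)%:R.
have x00 : 0 < x0.
  have : 0 <= 2 * k%:R / m%:R :> R by rewrite divr_ge0 ?mulr_ge0.
  by rewrite /x0; lra.
have xi0 i : 0 < x i by have := ler0n R (b i); rewrite /x; lra.
have c0 : 0 < gegpar a * (gegpar a - 1) by apply: mulr_gt0; lra.
have g i : 4 * gam (gegpar a) (b i).*2.+2 <=
    1 - gegpar a * (gegpar a - 1) * (x0 ^- 2 - 2 * (x i - x0) / x0 ^+ 3).
  have -> : 4 * gam (gegpar a) (b i).*2.+2 = 1 - gegpar a * (gegpar a - 1) * (x i * (x i - 1))^-1.
    have := gamE l1 (b i).*2.+2.
    have -> : ((b i).*2.+2)%:R + gegpar a = x i.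
      by rewrite -natr1 -natr1 -muln2 natrM /x; ring.
    by move=> H; lra.
  rewrite lerD2l lerN2; apply: ler_wpM2l; first exact: ltW.
  have b0 := ler0n R (b i).
  have x1 : 0 < x i - 1 by rewrite /x; lra.
  have xn : x i != 0 by rewrite gt_eqF.
  have xn0 : x0 != 0 by rewrite gt_eqF.
  apply: (@le_trans _ _ (x i ^- 2)).
    rewrite -subr_ge0.
    have -> : x i ^- 2 - (x0 ^- 2 - 2 * (x i - x0) / x0 ^+ 3) =
        (x i - x0) ^+ 2 * (2 * x i + x0) / (x i ^+ 2 * x0 ^+ 3).
      by field; rewrite xn xn0.
     have xi := xi0 i; apply: divr_ge0; last by apply: mulr_ge0; apply: exprn_ge0; exact: ltW.
    by apply: mulr_ge0 (sqr_ge0 _) _; lra.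
  rewrite lef_pV2 ?posrE ?exprn_gt0 ?mulr_gt0// expr2 ler_pM2l//; lra.
apply: (le_trans (ler_sum _ (fun i _ => g i))).
rewrite sumrB sumr_const card_ord -mulr_sumr sumrB sumr_const card_ord -mulr_suml -mulr_sumr.
have S : \sum_i (x i - x0) <= 0.
  have E : \sum_i x i = m%:R * (gegpar a + 2) + 2 * (\sum_i b i)%:R.
    by rewrite /x big_split /= sumr_const card_ord -mulr_sumr natr_sum -[_ *+ m]mulr_natl.
  have bkR : ((\sum_i b i)%:R : R) <= k%:R by rewrite ler_nat.
  have mx : m%:R * x0 = m%:R * (gegpar a + 2) + 2 * k%:R by rewrite /x0; field; rewrite gt_eqF.
  by rewrite sumrB sumr_const card_ord -[_ *+ m]mulr_natl E mx; lra.
have q : 0 <= - (2 * (\sum_i (x i - x0)) / x0 ^+ 3).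
  rewrite oppr_ge0; apply: mulr_le0_ge0; last by rewrite invr_ge0 exprn_ge0// ltW.
  by rewrite pmulr_rle0.
have {q} := mulr_ge0 (ltW c0) q; rewrite /sigma_bound -/x0 -[x0 ^- 2 *+ m]mulr_natl.
move: (x0 ^- 2) (2 * _ / x0 ^+ 3) (gegpar a * (gegpar a - 1)) => u v D; lra.
Qed.

(** In the row of the multi-index [b], the [i]-th tensor term contributes the one-variable row sum
    at [b i]; by Schur's test the bound becomes a sum of [4 gam] over the degrees, to which
    [sum_gam_le] applies. *)
Lemma Icube_sigma_le k P : (0 < m)%N -> poly_le k P ->
  Icube a (fun y => sigma y * P y ^+ 2) <= sigma_bound k * Icube a (fun y => P y ^+ 2).
Proof.
move=> m0 /poly_le_psi[c [c0 ->]]; rewrite Icube_parseval.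
rewrite (@Icube_sqr_expand _ (fun (b : {ffun 'I_m -> 'I_k.+1}) i => b i) c sigma lipc_sigma).
under eq_bigr do under eq_bigr do rewrite Icube_sigma_jacpolymM.
apply: le_trans (schur_test _ _ _) _.
- move=> b d; apply: sumr_ge0 => i _; apply: prodr_ge0 => j _.
  case: ifP => _; first exact: Ljac_entry_ge0.
  by rewrite mul1r Ljac_orth.
- move=> b d; apply: eq_bigr => i _; apply: eq_bigr => j _.
  by congr Ljac; ring.
rewrite mulr_sumr; apply: ler_sum => b _.
have [bk|bk] := boolP (\sum_(i < m) b i <= k)%N; last by rewrite c0// expr0n !mul0r mulr0.
rewrite mulrC; apply: ler_wpM2r; first exact: sqr_ge0.
apply: le_trans (sum_gam_le m0 bk).
(* Summing a tensor product over all columns gives the product of one-variable row sums, all equal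
   to 1 except the one at [i]. *)
rewrite exchange_big /=; apply: ler_sum => i _.
rewrite -(bigA_distr_bigA (fun j (l : 'I_k.+1) =>
  Ljac a ((if j == i then 'X else 1) * jacpoly a (b j) * jacpoly a l))) /=.
rewrite (bigD1 i)//= eqxx [X in _ * X]big1 ?mulr1; first exact: Ljac_row_le.
move=> j /negbTE ->; rewrite (bigD1 (b j))//= mul1r Ljac_orth// eqxx big1 ?addr0// => l lb.
by rewrite Ljac_orth// eq_sym (negbTE (_ : (l != b j :> nat))).
Qed.

End PolyLe.

(** * Removing the Vandermonde factor *)

Section LogConvex.
Variables (R : realFieldType) (M : nat -> R).
Hypothesis M0 : forall j, 0 <= M j.
Hypothesis logcvx : forall j, M j.+1 ^+ 2 <= M j * M j.+2.

(** The ratios [M j.+1 / M j] do not decrease, so the first one bounds the others from below; the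
    argument avoids dividing by terms that may vanish. *)
Lemma logconvex_ge s n : 0 <= s -> s * M 0 <= M 1 -> s ^+ n * M 0 <= M n.
Proof.
move=> s0 s1; have H j : s * M j <= M j.+1.
  elim: j => // j IH; have [Mj|Mj|Mj] := ltgtP (M j) 0.
  - by have := M0 j; rewrite leNgt Mj.
  - rewrite -(ler_pM2l Mj) mulrCA; apply: le_trans (logcvx j).
    by rewrite expr2 mulrA ler_wpM2r.
  (* If [M j] is zero, log-convexity makes the next term zero as well. *)
  - have : M j.+1 ^+ 2 <= 0 by have := logcvx j; rewrite Mj mul0r.
    by rewrite le_eqVlt ltNge sqr_ge0 orbF sqrf_eq0 => /eqP ->; rewrite mulr0.
elim: n => [|n IH]; first by rewrite expr0 mul1r.
by rewrite exprS -mulrA; apply: le_trans (H n); exact: ler_wpM2l.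
Qed.

(** The mirror statement: a bound on the last ratio propagates down to all earlier ones. *)
Lemma logconvex_le r n : 0 <= r -> M n.+1 <= r * M n -> M n <= r ^+ n * M 0.
Proof.
move=> r0; elim: n => [|n IH] Hn; first by rewrite expr0 mul1r.
have Hn' : M n.+1 <= r * M n.
  have [Mn|Mn|Mn] := ltgtP (M n.+1) 0.
  - by have := M0 n.+1; rewrite leNgt Mn.
  - rewrite -(ler_pM2r Mn) -expr2; apply: le_trans (logcvx n) _.
    by rewrite [r * _]mulrC -mulrA; exact: ler_wpM2l.
  - by rewrite Mn mulr_ge0.
apply: (le_trans Hn'); rewrite exprS -mulrA; apply: ler_wpM2l => //; exact: IH Hn'.
Qed.

End LogConvex.

(** The discriminant inequality, by evaluation at the minimizer [B / A]. If [A = 0] and [B] is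
    nonzero, the point [(C + 1) / B] would make the affine function negative. *)
Lemma sqr_le_of_quadratic (R : realFieldType) (A B C : R) : 0 <= A -> 0 <= C ->
  (forall u, 0 <= C - 2 * u * B + u ^+ 2 * A) -> B ^+ 2 <= A * C.
Proof.
move=> A0 C0 H; have [A00|An] := eqVneq A 0; last first.
  have Ap : 0 < A by rewrite lt_def An.
  have := H (B / A).
  have -> : C - 2 * (B / A) * B + (B / A) ^+ 2 * A = (A * C - B ^+ 2) / A by field.
  by rewrite pmulr_lge0 ?invr_gt0// subr_ge0.
have [->|B0] := eqVneq B 0; first by rewrite expr0n mulr_ge0.
have := H ((C + 1) / B); rewrite A00 mulr0 addr0.
have -> : C - 2 * ((C + 1) / B) * B = - C - 2 by field.
lra.
Qed.

Section Comparison.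
Variables (R : realType) (m : nat) (a : R).
Hypothesis a1 : 1 <= a.
Implicit Types (P Q : ('I_m -> R) -> R) (y : 'I_m -> R).

Local Notation mu0 := (I1 a (fun=> 1)).

Lemma Icube_0 : Icube a (fun _ : 'I_m -> R => 0) = 0.
Proof.
rewrite -[RHS](mul0r (Icube a (fun _ : 'I_m -> R => 0))) -IcubeZ//; last exact: lipc_cst.
by apply: eq_Icube => y _; rewrite mul0r.
Qed.

(* Integrating out coordinate i first: this replaces Fubini, as it suffices to check monomials. *)
Lemma Icube_slice k P (i : 'I_m) : poly_le k P ->
  Icube a (fun y => I1 a (fun t => P (upd y i t))) = mu0 * Icube a P.
Proof.
move=> kP.
suff [] : lipc P /\ Icube a (fun y => I1 a (fun t => P (upd y i t))) = mu0 * Icube a P by [].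
move: P kP; apply: poly_le_ind.
- split; first exact: lipc_cst.
  by rewrite Icube_0 mulr0 -[RHS]Icube_0; apply: eq_Icube => y _; rewrite I1_0.
- move=> P Q [lP HP] [lQ HQ]; split; first exact: lipcD.
  rewrite IcubeD// mulrDr -HP -HQ -IcubeD//; [|exact: lipc_I1..].
  by apply: eq_Icube => y cy; rewrite I1D//; exact: lipc_C01.
- move=> x P [lP HP]; split; first exact: lipcZ.
  rewrite IcubeZ// mulrCA -HP -IcubeZ//; last exact: lipc_I1.
  by apply: eq_Icube => y cy; rewrite I1Z//; exact: lipc_C01.
move=> e ek; split; first exact: (poly_le_lipc (poly_le_monom R ek)).
pose q (j : 'I_m) : {poly R} := if j == i then (Ljac a 'X^(e i))%:P else 'X^(e j).
transitivity (Icube a (fun y : 'I_m -> R => \prod_j (q j).[y j])).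
  apply: eq_Icube => y cy.
  rewrite (bigD1 i)//= /q eqxx hornerC mulrC /Ljac -I1Z//; last exact: C01_horner.
  apply: eq_I1 => t _; rewrite /monom (bigD1 i)//= mulrC /upd eqxx hornerXn; congr (_ * _).
  apply: eq_bigr => j ji; rewrite (negbTE ji) hornerXn (_ : (val j == i) = false)//.
  exact/negbTE.
have -> : Icube a (monom e) = Icube a (fun y : 'I_m -> R => \prod_j ('X^(e j)).[y j]).
  by apply: eq_Icube => y _; apply: eq_bigr => j _; rewrite hornerXn.
rewrite !Icube_prod// (bigD1 i)//= [in RHS](bigD1 i)//= mulrA; congr (_ * _).
  rewrite /q eqxx mulrC -/(Ljac a 'X^(e i)) -I1Z//; last exact: C01_cst.
  by apply: eq_I1 => t _; rewrite hornerC mulr1.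
by apply: eq_bigr => j ji; rewrite /q (negbTE ji).
Qed.

Lemma poly_le_sub (i j : 'I_m) : poly_le 1 (fun y : 'I_m -> R => y i - y j).
Proof.
have kN : poly_le 1 (fun y : 'I_m -> R => - y j).
  have -> : (fun y : 'I_m -> R => - y j) = fun y => -1 * y j.
    by apply/funext => y; rewrite mulN1r.
  exact: poly_leZ (poly_le_coord R j).
exact: poly_leD (poly_le_coord R i) kN.
Qed.

Lemma Icube_nikolskii_pair k P (i j : 'I_m) : i != j -> poly_le k P ->
  Icube a (fun y => P y ^+ 2) <=
  nikcst (gegpar a) k.+1.*2 ^+ 2 * Icube a (fun y => (P y * (y i - y j)) ^+ 2).
Proof.
move=> ij kP; set N := nikcst _ _ ^+ 2.
have kQ : poly_le (k + 1) (fun y => P y * (y i - y j)).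
  exact: poly_leM kP (poly_le_sub i j).
have k2 := poly_leX 2 kP; have q2 := poly_leX 2 kQ.
have lP := poly_le_lipc k2; have lQ := poly_le_lipc q2.
rewrite -(ler_pM2l (I1_1_gt0 a1)) mulrCA -(Icube_slice i k2) -(Icube_slice i q2) -IcubeZ//; last first.
  exact: (lipc_I1 a1 i lQ).
apply: le_Icube => //; [exact: (lipc_I1 a1 i lP)|exact: lipcZ (lipc_I1 a1 i lQ)|].
move=> y cy; have [p sp Hp] := poly_le_slice y i kP.
have -> : I1 a (fun t => P (upd y i t) ^+ 2) = Ljac a (p ^+ 2).
  by apply: eq_I1 => t _; rewrite Hp horner_exp.
have -> : I1 a (fun t => (P (upd y i t) * (upd y i t i - upd y i t j)) ^+ 2) =
    Ljac a (('X - (y j)%:P) ^+ 2 * p ^+ 2).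
  apply: eq_I1 => t _; rewrite Hp hornerM !horner_exp hornerD hornerN hornerX hornerC.
  rewrite /upd eqxx (_ : (val j == i) = false); last by apply/negbTE; rewrite eq_sym.
  by rewrite exprMn mulrC.
by apply: Ljac_nikolskii => //; case/andP: (cy j).
Qed.

(** The differences are inserted one at a time, each raising the degree by one; [K] dominates all
    degrees met, so the same constant is used throughout. *)
Lemma Icube_nikolskii_seq K k P (s : seq ('I_m * 'I_m)) :
  all (fun p => p.1 != p.2) s -> poly_le k P -> (k + size s <= K)%N ->
  Icube a (fun y => P y ^+ 2) <= (nikcst (gegpar a) K.+1.*2 ^+ 2) ^+ size s *
    Icube a (fun y => (P y * \prod_(p <- s) (y p.1 - y p.2)) ^+ 2).
Proof.
set N := nikcst _ _ ^+ 2; have N0 : 0 <= N by exact: sqr_ge0.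
elim: s k P => [|p s IH] k P /=.
  move=> _ _ _; rewrite expr0 mul1r le_eqVlt; apply/orP; left; apply/eqP.
  by apply: eq_Icube => y _; rewrite big_nil mulr1.
move=> /andP[pp sp] kP; rewrite addnS => kK.
have KP : poly_le K P by apply: poly_le_leq kP; lia.
apply: le_trans (Icube_nikolskii_pair pp KP) _; rewrite -/N exprS -mulrA.
apply: ler_wpM2l => //.
have kQ : poly_le (k + 1) (fun y => P y * (y p.1 - y p.2)).
  exact: poly_leM kP (poly_le_sub p.1 p.2).
have kK' : (k + 1 + size s <= K)%N by rewrite addn1.
apply: le_trans (IH _ _ sp kQ kK') _.
rewrite le_eqVlt; apply/orP; left; apply/eqP; congr (_ * _).
by apply: eq_Icube => y _; rewrite big_cons mulrA.
Qed.

Definition vdm y : R := \prod_(i < m) \prod_(j < m | (i < j)%N) `|y i - y j|.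

Lemma lipc_vdm : lipc vdm.
Proof.
apply: lipc_prod => i; apply: lipc_prod => j; apply: lipc_norm.
by apply: lipcB; exact: lipc_coord.
Qed.

Lemma vdm_ge0 y : 0 <= vdm y.
Proof. by apply: prodr_ge0 => i _; exact: prodr_ge0. Qed.

Lemma vdm_le1 y : cube y -> vdm y <= 1.
Proof.
move=> cy; apply: prodr_ile1 => i _; rewrite prodr_ge0//=.
apply: prodr_ile1 => j _; rewrite normr_ge0/=.
have /andP[? ?] := cy i; have /andP[? ?] := cy j.
by rewrite ler_norml; apply/andP; split; lra.
Qed.

(** One one-variable Nikolskii constant per pair of indices, with [m * m] as a crude bound both for
    the number of pairs and for the growth of the degree. *)
Definition vdm_cst k : R := (nikcst (gegpar a) (k + m * m).+1.*2 ^+ 2) ^+ (m * m).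

Lemma vdm_cst_gt0 k : 0 < vdm_cst k.
Proof.
have := nikcst_ge1 (gegpar_gt1 a1) (k + m * m).+1.*2 => h.
by do 2! apply: exprn_gt0; exact: lt_le_trans h.
Qed.

Lemma Icube_le_vdm k P : poly_le k P ->
  Icube a (fun y => P y ^+ 2) <= vdm_cst k * Icube a (fun y => P y ^+ 2 * vdm y).
Proof.
move=> kP; pose s := [seq p : 'I_m * 'I_m <- enum {: 'I_m * 'I_m} | (p.1 < p.2)%N].
have sm : (size s <= m * m)%N.
  by rewrite size_filter (leq_trans (count_size _ _))// -cardE card_prod card_ord.
have vE y : (\prod_(p <- s) (y p.1 - y p.2)) ^+ 2 = vdm y ^+ 2.
  rewrite -[LHS]ger0_norm ?sqr_ge0// normrX normr_prod; congr (_ ^+ 2).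
  by rewrite /vdm pair_big_dep /= big_filter big_enum_cond.
have all_s : all (fun p => p.1 != p.2) s.
  apply/allP => p; rewrite mem_filter => /andP[pp _].
  by apply/eqP => e; move: pp; rewrite e ltnn.
have ks : (k + size s <= k + m * m)%N by rewrite leq_add2l.
apply: le_trans (Icube_nikolskii_seq all_s kP ks) _.
have n1 := nikcst_ge1 (gegpar_gt1 a1) (k + m * m).+1.*2.
have lP := poly_le_lipc kP; have lv := lipc_vdm.
apply: ler_pM.
- by apply: exprn_ge0; exact: sqr_ge0.
- by apply: Icube_ge0 => y _; exact: sqr_ge0.
- by rewrite /vdm_cst; apply: ler_weXn2l => //; rewrite exprn_ege1.
(* The inequality yields the square of the Vandermonde product; on the cube [vdm <= 1], hence
   [vdm^2 <= vdm]. *)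
rewrite (@eq_Icube _ _ _ _ (fun y => (P y * vdm y) ^+ 2)); last first.
  by move=> y _; rewrite !exprMn vE.
apply: le_Icube => //; [by apply: lipcX; exact: lipcM|by apply: lipcM => //; exact: lipcX|].
move=> y cy; rewrite exprMn; apply: ler_wpM2l; first exact: sqr_ge0.
by rewrite expr2 ler_piMr ?vdm_ge0 ?vdm_le1.
Qed.

Lemma Icube_vdm_le P : lipc P ->
  Icube a (fun y => P y ^+ 2 * vdm y) <= Icube a (fun y => P y ^+ 2).
Proof.
move=> lP; have lv := lipc_vdm; apply: le_Icube => //.
- by apply: lipcM => //; exact: lipcX.
- exact: lipcX.
- by move=> y cy; rewrite ler_piMr ?sqr_ge0 ?vdm_le1.
Qed.

Lemma sigma_ge0 y : cube y -> 0 <= sigma y.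
Proof. by move=> cy; apply: sumr_ge0 => i _; case/andP: (cy i). Qed.

Definition moment W P j : R := Icube a (fun y => sigma y ^+ j * (P y ^+ 2 * W y)).

Section Moments.
Variables (W P : ('I_m -> R) -> R).
Hypotheses (lW : lipc W) (W0 : forall y, cube y -> 0 <= W y) (lP : lipc P).

Lemma lipc_moment j : lipc (fun y => sigma y ^+ j * (P y ^+ 2 * W y)).
Proof.
exact: lipcM (lipcX j (@lipc_sigma R m)) (lipcM (lipcX 2 lP) lW).
Qed.

Lemma moment_ge0 j : 0 <= moment W P j.
Proof.
apply: Icube_ge0 => y cy; apply: mulr_ge0; first by rewrite exprn_ge0 ?sigma_ge0.
by apply: mulr_ge0; [exact: sqr_ge0|exact: W0].
Qed.

(** Cauchy-Schwarz, obtained from the nonnegative integral of [sigma^j (sigma - u)^2 P^2 W] as a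
    quadratic function of [u]. *)
Lemma moment_logconvex j : moment W P j.+1 ^+ 2 <= moment W P j * moment W P j.+2.
Proof.
apply: sqr_le_of_quadratic; [exact: moment_ge0..|move=> u].
rewrite /moment -!IcubeZ//; [|exact: lipc_moment..].
rewrite -IcubeB//; [|exact: lipc_moment|by apply: lipcZ; exact: lipc_moment].
rewrite -IcubeD//; last 2 first.
- by apply: lipcB; [exact: lipc_moment|apply: lipcZ; exact: lipc_moment].
- by apply: lipcZ; exact: lipc_moment.
apply: Icube_ge0 => y cy.
have -> : sigma y ^+ j.+2 * (P y ^+ 2 * W y) - 2 * u * (sigma y ^+ j.+1 * (P y ^+ 2 * W y))
    + u ^+ 2 * (sigma y ^+ j * (P y ^+ 2 * W y)) =
    (sigma y ^+ j * (P y ^+ 2 * W y)) * (sigma y - u) ^+ 2.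
  by rewrite !exprS; ring.
apply: mulr_ge0 (sqr_ge0 _); apply: mulr_ge0; first by rewrite exprn_ge0 ?sigma_ge0.
by apply: mulr_ge0; [exact: sqr_ge0|exact: W0].
Qed.

Lemma moment_double r :
  moment W P (r + r) = Icube a (fun y => (sigma y ^+ r * P y) ^+ 2 * W y).
Proof. by apply: eq_Icube => y _; rewrite exprMn exprD; ring. Qed.

Lemma moment_doubleS r :
  moment W P (r + r).+1 = Icube a (fun y => sigma y * ((sigma y ^+ r * P y) ^+ 2 * W y)).
Proof. by apply: eq_Icube => y _; rewrite exprMn exprS exprD; ring. Qed.

End Moments.

Lemma poly_le_sigmaX k r P : poly_le k P -> poly_le (k + r) (fun y => sigma y ^+ r * P y).
Proof.
move=> kP; have := poly_leX r (@poly_le_sigma R m); rewrite muln1 addnC => h.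
exact: poly_leM h kP.
Qed.

Lemma sigma_bound_ge0 k : (0 < m)%N -> 0 <= sigma_bound m a k.
Proof.
move=> m0; have := @sum_gam_le R m a a1 k (fun=> 0%N) m0.
rewrite big1// => /(_ isT); apply: le_trans; apply: sumr_ge0 => i _.
by rewrite mulr_ge0 ?gam_ge0 ?gegpar_gt1.
Qed.

Lemma moment1E P j : moment (fun=> 1) P j = Icube a (fun y => sigma y ^+ j * P y ^+ 2).
Proof. by apply: eq_Icube => y _; rewrite mulr1. Qed.

(* Log-convexity of the moments gives s^(2r) M_0 <= M_2r for the first weight and
   M_2r <= L^(2r) M_0 for the second; the two weights differ by a factor [vdm_cst]. *)
Lemma compare_upper k r P s : (0 < m)%N -> poly_le k P -> P <> (fun=> 0) -> 0 <= s ->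
  s * Icube a (fun y => P y ^+ 2 * vdm y) <= Icube a (fun y => sigma y * (P y ^+ 2 * vdm y)) ->
  s ^+ (r + r) <= vdm_cst k * sigma_bound m a (k + r) ^+ (r + r).
Proof.
move=> m0 kP P0 s0 Hs; have lP := poly_le_lipc kP.
have lv := lipc_vdm; have v0 y (_ : cube y) := vdm_ge0 y.
have Pp := Icube_sqr_gt0 a1 kP P0.
have Cp := vdm_cst_gt0 k.
have B0 : 0 < moment vdm P 0.
  have -> : moment vdm P 0 = Icube a (fun y => P y ^+ 2 * vdm y).
    by apply: eq_Icube => y _; rewrite expr0 mul1r.
  by rewrite -(pmulr_rgt0 _ Cp); apply: lt_le_trans Pp _; exact: Icube_le_vdm.
have H1 : s ^+ (r + r) * moment vdm P 0 <= moment vdm P (r + r).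
  apply: logconvex_ge => //; [exact: moment_ge0|exact: moment_logconvex|].
  rewrite (_ : moment vdm P 0 = Icube a (fun y => P y ^+ 2 * vdm y)); last first.
    by apply: eq_Icube => y _; rewrite expr0 mul1r.
  by apply: le_trans Hs _; rewrite le_eqVlt; apply/orP; left; apply/eqP; apply: eq_Icube => y _; rewrite expr1.
have kr := poly_le_sigmaX r kP.
have H2 : moment vdm P (r + r) <= moment (fun=> 1) P (r + r).
  rewrite !moment_double; apply: le_trans (Icube_vdm_le (poly_le_lipc kr)) _.
  by rewrite le_eqVlt; apply/orP; left; apply/eqP; apply: eq_Icube => y _; rewrite mulr1.
have H3 : moment (fun=> 1) P (r + r) <= sigma_bound m a (k + r) ^+ (r + r) * moment (fun=> 1) P 0.
  apply: logconvex_le; [exact: moment_ge0| |exact: sigma_bound_ge0|].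
    by move=> j; apply: moment_logconvex => //; exact: lipc_cst.
  rewrite moment_double moment_doubleS; have := Icube_sigma_le a1 m0 kr.
  rewrite (@eq_Icube _ _ _ _ (fun y => sigma y * ((sigma y ^+ r * P y) ^+ 2 * 1))); last first.
    by move=> y _; rewrite mulr1.
  move=> /le_trans; apply; rewrite le_eqVlt; apply/orP; left; apply/eqP.
  by congr (_ * _); apply: eq_Icube => y _; rewrite mulr1.
have H4 : moment (fun=> 1) P 0 <= vdm_cst k * moment vdm P 0.
  have := Icube_le_vdm kP; rewrite moment1E.
  rewrite (@eq_Icube _ _ _ _ (fun y => sigma y ^+ 0 * P y ^+ 2)); last first.
    by move=> y _; rewrite expr0 mul1r.
  move=> /le_trans; apply; rewrite le_eqVlt; apply/orP; left; apply/eqP.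
  by congr (_ * _); apply: eq_Icube => y _; rewrite expr0 mul1r.
rewrite -(ler_pM2r B0) [X in _ <= X * _]mulrC -mulrA.
apply: le_trans H1 (le_trans H2 (le_trans H3 _)).
by apply: ler_wpM2l => //; rewrite exprn_ge0 ?sigma_bound_ge0.
Qed.

(** The roles of the two weights are exchanged: the first ratio belongs to the product weight and
    the last one to [vdm]. The comparison now acts on [sigma^r P], hence the constant at degree
    [k + r]. *)
Lemma compare_lower k r P s L : poly_le k P -> P <> (fun=> 0) -> 0 <= s -> 0 <= L ->
  s * Icube a (fun y => P y ^+ 2) <= Icube a (fun y => sigma y * P y ^+ 2) ->
  Icube a (fun y => sigma y * ((sigma y ^+ r * P y) ^+ 2 * vdm y)) <=
    L * Icube a (fun y => (sigma y ^+ r * P y) ^+ 2 * vdm y) ->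
  s ^+ (r + r) <= vdm_cst (k + r) * L ^+ (r + r).
Proof.
move=> kP P0 s0 L0 Hs HL; have lP := poly_le_lipc kP.
have lv := lipc_vdm; have v0 y (_ : cube y) := vdm_ge0 y.
have Pp := Icube_sqr_gt0 a1 kP P0.
have E0 : moment (fun=> 1) P 0 = Icube a (fun y => P y ^+ 2).
  by rewrite moment1E; apply: eq_Icube => y _; rewrite expr0 mul1r.
have H1 : s ^+ (r + r) * moment (fun=> 1) P 0 <= moment (fun=> 1) P (r + r).
  apply: logconvex_ge => //; first exact: moment_ge0.
    by move=> j; apply: moment_logconvex => //; exact: lipc_cst.
  rewrite E0 moment1E; apply: le_trans Hs _.
  by rewrite le_eqVlt; apply/orP; left; apply/eqP; apply: eq_Icube => y _; rewrite expr1.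
have kr := poly_le_sigmaX r kP.
have H2 : moment (fun=> 1) P (r + r) <= vdm_cst (k + r) * moment vdm P (r + r).
  rewrite !moment_double; apply: le_trans (Icube_le_vdm kr).
  by rewrite le_eqVlt; apply/orP; left; apply/eqP; apply: eq_Icube => y _; rewrite mulr1.
have H3 : moment vdm P (r + r) <= L ^+ (r + r) * moment vdm P 0.
  apply: logconvex_le; [exact: moment_ge0|exact: moment_logconvex|by []|].
  by rewrite moment_double moment_doubleS.
have H4 : moment vdm P 0 <= moment (fun=> 1) P 0.
  rewrite E0; apply: le_trans (Icube_vdm_le lP).
  by rewrite le_eqVlt; apply/orP; left; apply/eqP; apply: eq_Icube => y _; rewrite expr0 mul1r.
rewrite -E0 in Pp; rewrite -(ler_pM2r Pp) -mulrA.
apply: le_trans H1 (le_trans H2 _); apply: ler_wpM2l; first exact/ltW/vdm_cst_gt0.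
by apply: le_trans H3 _; apply: ler_wpM2l => //; exact: exprn_ge0.
Qed.

Definition prod_jacwindow e M y : R := \prod_(i < m) (jacwindow a e M).[y i].

Lemma poly_le_prod_jacwindow e M : poly_le (m * (e + M).+1) (prod_jacwindow e M).
Proof.
have -> : (m * (e + M).+1)%N = (\sum_(i < m) (e + M).+1)%N.
  by rewrite sum_nat_const card_ord.
by apply: poly_le_prod => i; apply: poly_le_horner; exact: size_jacwindow.
Qed.

Lemma symmetric_prod_jacwindow e M : symmetric_fun (prod_jacwindow e M).
Proof.
move=> s y; rewrite /prod_jacwindow [RHS](reindex_inj (@perm_inj _ s)) /=.
by [].
Qed.

Lemma Icube_prod_jacwindow e M : Icube a (fun y => prod_jacwindow e M y ^+ 2) = M.+2%:R ^+ m.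
Proof.
have -> : (fun y => prod_jacwindow e M y ^+ 2) = fun y => \prod_(i < m) (jacwindow a e M ^+ 2).[y i].
  apply/funext => y; rewrite /prod_jacwindow -prodrXl; apply: eq_bigr => i _.
  by rewrite horner_exp.
rewrite Icube_prod// (eq_bigr (fun=> M.+2%:R)); last by move=> i _; exact: Ljac_jacwindow.
by rewrite prodr_const card_ord.
Qed.

Lemma prod_jacwindow_neq0 e M : prod_jacwindow e M <> (fun=> 0).
Proof.
move=> P0; have := Icube_prod_jacwindow e M; rewrite P0.
rewrite (@eq_Icube _ _ _ _ (fun=> 0)); last by move=> y _; rewrite expr0n.
by rewrite Icube_0 => /esym/eqP; rewrite expf_eq0 pnatr_eq0 andbF.
Qed.

(** Each summand of [sigma] acts on one coordinate, where the window has quotient at least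
    [M / (M + 2)] times [4 gam]; the other coordinates contribute their norms. *)
Lemma Icube_sigma_prod_jacwindow e M :
  (m%:R * (M%:R / M.+2%:R * (4 * gam (gegpar a) e.*2))) * Icube a (fun y => prod_jacwindow e M y ^+ 2)
  <= Icube a (fun y => sigma y * prod_jacwindow e M y ^+ 2).
Proof.
rewrite Icube_prod_jacwindow.
pose p (i j : 'I_m) : {poly R} := (if j == i then 'X else 1) * jacwindow a e M ^+ 2.
have -> : (fun y => sigma y * prod_jacwindow e M y ^+ 2) =
    fun y : 'I_m -> R => \sum_i \prod_j (p i j).[y j].
  apply/funext => y; rewrite /sigma mulr_suml; apply: eq_bigr => i _.
  rewrite /prod_jacwindow -prodrXl (bigD1 i)//= [RHS](bigD1 i)//= mulrA; congr (_ * _).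
    by rewrite /p eqxx hornerM hornerX horner_exp.
  by apply: eq_bigr => j /negbTE ji; rewrite /p ji mul1r horner_exp.
rewrite Icube_sum//; last first.
  move=> i; apply: lipc_prod => j.
  by apply: poly_le_lipc; apply: (poly_le_horner (d := size (p i j))).
rewrite -mulrA mulr_natl -[X in _ *+ X]card_ord -sumr_const; apply: ler_sum => i _.
rewrite Icube_prod// (bigD1 i)//= (eq_bigr (fun=> M.+2%:R)); last first.
  by move=> j ji; rewrite /p (negbTE ji) mul1r; exact: Ljac_jacwindow.
have -> : \prod_(j < m | j != i) (M.+2%:R : R) = M.+2%:R ^+ m.-1.
  by rewrite prodr_const cardC1 card_ord.
have m0 : (0 < m)%N by apply: leq_ltn_trans (ltn_ord i).
rewrite -[m in leLHS](prednK m0) exprS mulrA; apply: ler_wpM2r; first exact: exprn_ge0.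
have := Ljac_X_jacwindow_ge a1 e M; rewrite /p eqxx /Ljac; apply: le_trans.
by rewrite le_eqVlt; apply/orP; left; apply/eqP; field.
Qed.

End Comparison.

(** * Eigenvalues and the Rayleigh quotient *)

(** By homogeneity the quotient is maximized over the unit vectors of [V], a compact set. The
    conclusion is free of [p d] in a denominator, which covers [d = 0]. *)
Lemma rayleigh_max (R : realType) (n : nat) (V : set 'rV[R]_n) (q p : 'rV[R]_n -> R) :
  closed V -> (forall t c, V c -> V (t *: c)) -> continuous q -> continuous p ->
  (forall t c, q (t *: c) = t ^+ 2 * q c) -> (forall t c, p (t *: c) = t ^+ 2 * p c) ->
  (forall c, V c -> c != 0 -> 0 < p c) -> (exists2 c, V c & c != 0) ->
  exists2 c, V c /\ c != 0 & forall d, V d -> q d <= q c / p c * p d.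
Proof.
move=> clV scV cq cp hq hp p0 [c0 Vc0 c00].
pose A : set 'rV[R]_n := V `&` [set x | `|x| = 1].
have An x : A x -> x != 0.
  by move=> [_ x1]; apply/eqP => x0; move: x1; rewrite /= x0 normr0 => /esym/eqP; rewrite oner_eq0.
have norm1 d : V d -> d != 0 -> A (`|d|^-1 *: d).
  move=> Vd d0; split; first exact: scV.
  by rewrite /= normrZ normfV normr_id mulVf// normr_eq0.
have cA : compact A.
  apply: bounded_closed_compact.
    by exists 1; split => // M M1 x [_ /= ->]; exact: ltW.
  apply: closedI => //.
  apply: (@preimage_closed _ _ (fun x : 'rV[R]_n => `|x|) [set 1]); last exact: closed_eq.
  by move=> x _; exact: norm_continuous.
have A0 : A !=set0 by exists (`|c0|^-1 *: c0); exact: norm1.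
have cf : {within A, continuous (fun x => q x / p x)}.
  apply: continuous_in_subspaceT => x; rewrite inE => Ax.
  have px : p x != 0 by rewrite gt_eqF// p0 ?An//; case: Ax.
  exact: (@cvgM _ _ (nbhs x) _ q (fun x => (p x)^-1) _ _ (cq x) (cvgV px (cp x))).
have [c] := EVT_max_rV A0 cA cf; rewrite inE => Ac cmax.
exists c; first by split; [case: Ac|exact: An].
move=> d Vd; have [->|d0] := eqVneq d 0.
  have z (f : 'rV[R]_n -> R) : (forall t x, f (t *: x) = t ^+ 2 * f x) -> f 0 = 0.
    by move=> hf; rewrite -(scale0r 0) hf expr0n mul0r.
  by rewrite !z// mulr0.
have Ad := norm1 d Vd d0.
have := cmax (`|d|^-1 *: d); rewrite inE => /(_ Ad).
have nd : `|d|^-1 ^+ 2 != 0 by rewrite expf_neq0// invr_eq0 normr_eq0.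
rewrite hq hp invfM mulrACA divff// mul1r.
by rewrite ler_pdivrMr// p0.
Qed.

Section Eigenvalues.
Variables (R : realType) (m n k : nat).
Let a : R := n%:R / 2 - m%:R - 1 / 2.
Hypothesis a1 : 1 <= a.
Implicit Types (P Q : ('I_m -> R) -> R) (y : 'I_m -> R).

Local Notation vdm := (@vdm R m).

Lemma vdm_int_gt0 P j : poly_le j P -> P <> (fun=> 0) ->
  0 < Icube a (fun y => P y ^+ 2 * vdm y).
Proof.
move=> kP P0; have Pp := Icube_sqr_gt0 a1 kP P0; have Cp := vdm_cst_gt0 m a1 j.
by rewrite -(pmulr_rgt0 _ Cp); apply: lt_le_trans Pp _; exact: Icube_le_vdm.
Qed.

Lemma cube_int_weight P : lipc P ->
  cube_int (fun y => P y * weight R m n y) = Icube a (fun y => P y * vdm y).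
Proof.
move=> lP; rewrite -cube_int_jac//; last exact: lipcM lP (@lipc_vdm R m).
by congr cube_int; apply/funext => y; rewrite mulrA.
Qed.

Lemma cst_gt0 : 0 < Defs.cst R m n.
Proof.
rewrite /Defs.cst invr_gt0.
have -> : weight R m n = fun y => 1 * weight R m n y.
  by apply/funext => y; rewrite mul1r.
rewrite cube_int_weight; last exact: lipc_cst.
have := @vdm_int_gt0 (fun=> 1) 0 (poly_le_cst m 0 1).
rewrite (@eq_Icube _ _ _ _ (fun y => 1 * vdm y)); last by move=> y _; rewrite expr1n.
by apply => /(congr1 (fun f => f (fun=> 0))) /eqP; rewrite oner_eq0.
Qed.

Lemma ipE P Q : lipc P -> lipc Q ->
  ip R m n P Q = Defs.cst R m n * Icube a (fun y => P y * Q y * vdm y).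
Proof. by move=> lP lQ; rewrite /ip cube_int_weight//; exact: lipcM. Qed.

Lemma S_k_lipc P : S_k R m k P -> lipc P.
Proof. by move=> [kP _]; exact: poly_le_lipc kP. Qed.

Lemma S_kD P Q : S_k R m k P -> S_k R m k Q -> S_k R m k (fun y => P y + Q y).
Proof.
move=> [kP sP] [kQ sQ]; split; first exact: poly_leD.
by move=> s y; rewrite sP sQ.
Qed.

Lemma S_kZ x P : S_k R m k P -> S_k R m k (fun y => x * P y).
Proof.
move=> [kP sP]; split; first exact: poly_leZ.
by move=> s y; rewrite sP.
Qed.

(** The projection identity is tested against the eigenfunction itself; the normalizing constant is
    positive and cancels. *)
Lemma T_eigenvalues_rayleigh lam : T_eigenvalues R m n k lam ->
  exists P, [/\ S_k R m k P, P <> (fun=> 0) &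
    Icube a (fun y => sigma y * (P y ^+ 2 * vdm y)) =
    lam * Icube a (fun y => P y ^+ 2 * vdm y)].
Proof.
move=> [P [SP [P0 [_ H]]]]; exists P; split => //.
have lP := S_k_lipc SP; have ls := @lipc_sigma R m; have lv := @lipc_vdm R m.
have := H P SP; rewrite ipE//; last by apply: lipcB; [exact: lipcM|exact: lipcZ].
move/eqP; rewrite mulf_eq0 gt_eqF ?cst_gt0//= => /eqP H0.
apply/eqP; rewrite -subr_eq0 -IcubeZ//; last by apply: lipcM => //; exact: lipcX.
rewrite -IcubeB//; last 2 first.
- by apply: lipcM => //; apply: lipcM => //; exact: lipcX.
- by apply: lipcZ; apply: lipcM => //; exact: lipcX.
by rewrite -[X in _ == X]H0; apply/eqP; apply: eq_Icube => y _; ring.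
Qed.

Local Notation T := {ffun 'I_m -> 'I_k.+1}.

(** Coordinates in the product basis identify polynomials with row vectors, where compactness of the
    sphere is available. *)
Definition comb (c : 'rV[R]_#|T|) y : R :=
  \sum_(b : T) c 0 (enum_rank b) * jacpolym a (fun i => b i) y.

(** The coordinate vectors of [S_k]: the degree bound and the symmetry are linear equations in the
    coefficients, so the set is closed and stable under scaling. *)
Definition comb_space : set 'rV[R]_#|T| :=
  [set c : 'rV[R]_#|T| | (forall b : T, ~~ (\sum_(i < m) b i <= k)%N -> c 0 (enum_rank b) = 0) /\
           symmetric_fun (comb c)].

Lemma combZ t (c : 'rV[R]_#|T|) y : comb (t *: c) y = t * comb c y.
Proof.
by rewrite /comb mulr_sumr; apply: eq_bigr => b _; rewrite mxE mulrA.
Qed.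

Lemma comb_S_k c : comb_space c -> S_k R m k (comb c).
Proof.
move=> [c0 cs]; split => //; apply: poly_le_sum => b _.
have [bk|bk] := boolP (\sum_(i < m) b i <= k)%N.
  by apply: poly_leZ; apply: poly_le_leq bk _; exact: poly_le_jacpolym.
by under eq_fun do rewrite c0// mul0r; exact: poly_le0.
Qed.

Lemma S_k_comb P : S_k R m k P -> exists2 c, comb_space c & P = comb c.
Proof.
move=> [/(poly_le_psi a1)[c [c0 E]] sP].
have EP : P = comb (\row_j c (enum_val j)).
  rewrite E; apply/funext => y; apply: eq_bigr => b _.
  by rewrite mxE enum_rankK.
exists (\row_j c (enum_val j)) => //; split; last by rewrite -EP.
by move=> b bk; rewrite mxE enum_rankK c0.
Qed.

Lemma comb_eq0 c : comb c = (fun=> 0) -> c = 0.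
Proof.
move=> cc0; have := Icube_parseval a1 (fun b : T => c 0 (enum_rank b)).
rewrite (@eq_Icube _ _ _ _ (fun=> 0)); last first.
  by move=> y _; rewrite -/(comb c y) cc0 expr0n.
rewrite Icube_0// => /esym/eqP; rewrite psumr_eq0; last by move=> b _; exact: sqr_ge0.
move=> /allP H; apply/rowP => j; rewrite mxE.
have := H (enum_val j) (mem_index_enum _).
by rewrite /= enum_valK sqrf_eq0 => /eqP.
Qed.

Lemma continuous_sumR (X : topologicalType) (I : Type) (s : seq I) (F : I -> X -> R) :
  (forall i, continuous (F i)) -> continuous (fun x => \sum_(i <- s) F i x).
Proof.
by move=> cF; apply: continuous_big => // -[x y]; exact: add_continuous.
Qed.

Lemma continuousMR (X : topologicalType) (f g : X -> R) :
  continuous f -> continuous g -> continuous (fun x => f x * g x).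
Proof. by move=> cf cg x; exact: (cvgM (cf x) (cg x)). Qed.

Lemma continuous_comb_coord (b : T) : continuous (fun c : 'rV[R]_#|T| => c 0 (enum_rank b)).
Proof. exact: coord_continuous. Qed.
Arguments continuous_comb_coord : clear implicits.

Lemma continuous_Icube_comb G : lipc G ->
  continuous (fun c => Icube a (fun y => G y * comb c y ^+ 2)).
Proof.
move=> lG.
have -> : (fun c => Icube a (fun y => G y * comb c y ^+ 2)) = fun c : 'rV[R]_#|T| =>
    \sum_(b : T) \sum_(d : T) c 0 (enum_rank b) * c 0 (enum_rank d) *
      Icube a (fun y => G y * (jacpolym a (fun i => b i) y * jacpolym a (fun i => d i) y)).
  by apply/funext => c; rewrite -Icube_sqr_expand.
apply: continuous_sumR => b; apply: continuous_sumR => d.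
apply: continuousMR; last exact: cst_continuous.
exact: continuousMR (continuous_comb_coord b) (continuous_comb_coord d).
Qed.

Lemma closed_comb_space : closed comb_space.
Proof.
have -> : comb_space =
    (\bigcap_(b in [set b : T | ~~ (\sum_(i < m) b i <= k)%N])
       [set c : 'rV[R]_#|T| | c 0 (enum_rank b) = 0]) `&`
    (\bigcap_(sy in [set: {perm 'I_m} * ('I_m -> R)])
       [set c : 'rV[R]_#|T| | comb c (fun i => sy.2 (sy.1 i)) - comb c sy.2 = 0]).
  apply/seteqP; split => c /= [c0 cs]; split => //.
    by move=> [s y] _ /=; apply/eqP; rewrite subr_eq0; apply/eqP; exact: cs.
  by move=> s y; apply/eqP; rewrite -subr_eq0; apply/eqP; exact: (cs (s, y)).
have ccomb y : continuous (comb ^~ y).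
  apply: continuous_sumR => b; apply: continuousMR; first exact: continuous_comb_coord.
  exact: cst_continuous.
apply: closedI.
  apply: closed_bigI => b _; apply: (@preimage_closed _ _ (fun c : 'rV[R]_#|T| => c 0 (enum_rank b)) [set 0]).
    by move=> c _; exact: continuous_comb_coord.
  exact: closed_eq.
apply: closed_bigI => -[s y] _; apply: (@preimage_closed _ _
  (fun c : 'rV[R]_#|T| => comb c (fun i => y (s i)) - comb c y) [set 0]).
  by move=> c _; exact: (cvgB (ccomb (fun i => y (s i)) c) (ccomb y c)).
exact: closed_eq.
Qed.

(* The maximum of the Rayleigh quotient on [S_k] is an eigenvalue: at a maximizer
   the first variation vanishes in every direction of [S_k]. *)
Lemma T_eigenvalues_max N : S_k R m k N -> N <> (fun=> 0) ->
  exists2 lam, T_eigenvalues R m n k lam & forall Q, S_k R m k Q ->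
    Icube a (fun y => sigma y * (Q y ^+ 2 * vdm y)) <=
    lam * Icube a (fun y => Q y ^+ 2 * vdm y).
Proof.
move=> SN N0; have ls := @lipc_sigma R m; have lv := @lipc_vdm R m.
pose q c := Icube a (fun y => (sigma y * vdm y) * comb c y ^+ 2).
pose p c := Icube a (fun y => vdm y * comb c y ^+ 2).
have lpsi c : lipc (comb c).
  by apply: lipc_sum => b; apply: lipcZ; exact: lipc_jacpolym.
have hom G t (c : 'rV[R]_#|T|) : lipc G -> Icube a (fun y => G y * comb (t *: c) y ^+ 2) =
    t ^+ 2 * Icube a (fun y => G y * comb c y ^+ 2).
  move=> lG; rewrite -IcubeZ//; last by apply: lipcM => //; exact: lipcX.
  by apply: eq_Icube => y _; rewrite combZ; ring.
have [||||||| c [Vc cn0]] := @rayleigh_max R _ comb_space q p closed_comb_space.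
- move=> t c [c0 cs]; split; first by move=> b bk; rewrite mxE c0// mulr0.
  by move=> s y; rewrite !combZ cs.
- by apply: continuous_Icube_comb; exact: lipcM.
- exact: continuous_Icube_comb.
- by move=> t c; apply: hom; exact: lipcM.
- by move=> t c; exact: hom.
- move=> c Vc cn0; rewrite /p (@eq_Icube _ _ _ _ (fun y => comb c y ^+ 2 * vdm y)); last first.
    by move=> y _; rewrite mulrC.
  case: (comb_S_k Vc) => kc _; apply: vdm_int_gt0 kc _.
  by move=> /comb_eq0 c00; rewrite c00 eqxx in cn0.
- have [c Vc E] := S_k_comb SN; exists c => //; apply/eqP => c0; apply: N0.
  rewrite E c0; apply/funext => y; rewrite /comb big1// => b _.
  by rewrite mxE mul0r.
set lam := q c / p c => Hmax.
have max Q : S_k R m k Q -> Icube a (fun y => sigma y * (Q y ^+ 2 * vdm y)) <=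
    lam * Icube a (fun y => Q y ^+ 2 * vdm y).
  move=> /S_k_comb[d Vd ->]; have := Hmax d Vd; rewrite /q /p.
  rewrite (@eq_Icube _ _ _ _ (fun y => sigma y * (comb d y ^+ 2 * vdm y))); last first.
    by move=> y _; ring.
  by rewrite (@eq_Icube _ _ _ (fun y => vdm y * comb d y ^+ 2)
    (fun y => comb d y ^+ 2 * vdm y))// => y _; ring.
exists lam => //; exists (comb c); split; first exact: comb_S_k.
split; first by move=> /comb_eq0 c00; rewrite c00 eqxx in cn0.
have Sc := comb_S_k Vc; split; first exact: S_kZ.
move=> Q SQ; have lQ := S_k_lipc SQ; have lc := lpsi c.
rewrite ipE//; last by apply: lipcB; [exact: lipcM|exact: lipcZ].
apply/eqP; rewrite mulf_eq0; apply/orP; right; apply/eqP.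
(* The bilinear form of [lam - sigma]: nonnegative on [S_k] and zero at the maximizer, hence the
   maximizer lies in its radical. *)
pose B (f g : ('I_m -> R) -> R) := Icube a (fun y => (lam - sigma y) * (f y * g y * vdm y)).
have lB f g : lipc f -> lipc g -> lipc (fun y => (lam - sigma y) * (f y * g y * vdm y)).
  move=> lf lg; apply: lipcM; first by apply: lipcB => //; exact: lipc_cst.
  by apply: lipcM => //; exact: lipcM.
have BE f : lipc f -> B f f =
    lam * Icube a (fun y => f y ^+ 2 * vdm y) - Icube a (fun y => sigma y * (f y ^+ 2 * vdm y)).
  move=> lf; have lf2 : lipc (fun y => f y ^+ 2 * vdm y) by apply: lipcM => //; exact: lipcX.
  rewrite -IcubeZ// -IcubeB//; [|exact: lipcZ|exact: lipcM].
  by apply: eq_Icube => y _; ring.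
have Bge0 f : S_k R m k f -> 0 <= B f f.
  by move=> Sf; rewrite BE ?subr_ge0; [exact: max|exact: S_k_lipc Sf].
have Bc : B (comb c) (comb c) = 0.
  have pc : p c != 0.
    rewrite gt_eqF// /p (@eq_Icube _ _ _ _ (fun y => comb c y ^+ 2 * vdm y)); last first.
      by move=> y _; rewrite mulrC.
    case: (Sc) => kc _; apply: vdm_int_gt0 kc _.
    by move=> /comb_eq0 c00; rewrite c00 eqxx in cn0.
  have -> : B (comb c) (comb c) = lam * p c - q c.
    rewrite BE//; congr (_ * _ - _); apply: eq_Icube => y _; ring.
  by rewrite /lam divfK// subrr.
(* This is [B] at [Q - u * comb c]; its [u^2] term vanishes, which forces the linear term to vanish
   too. *)
have quad u : 0 <= B Q Q - 2 * u * B (comb c) Q + u ^+ 2 * B (comb c) (comb c).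
  have := Bge0 _ (S_kD SQ (S_kZ (- u) Sc)); rewrite /B => H.
  rewrite -!IcubeZ//; [|exact: lB..].
  rewrite -IcubeB//; [|exact: lB|by apply: lipcZ; exact: lB].
  rewrite -IcubeD//; [|by apply: lipcB; [exact: lB|apply: lipcZ; exact: lB]|
                    by apply: lipcZ; exact: lB].
  by apply: le_trans H _; rewrite le_eqVlt; apply/orP; left; apply/eqP; apply: eq_Icube => y _; ring.
have := @sqr_le_of_quadratic R (B (comb c) (comb c)) (B (comb c) Q) (B Q Q).
rewrite Bc mul0r => /(_ (lexx _) (Bge0 _ SQ)).
move=> H; have {H} : B (comb c) Q ^+ 2 <= 0 by apply: H => u; have := quad u; rewrite Bc.
rewrite le_eqVlt ltNge sqr_ge0 orbF sqrf_eq0 => /eqP BQ.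
rewrite -[RHS]oppr0 -BQ /B -mulN1r -IcubeZ//; last exact: lB.
by apply: eq_Icube => y _; ring.
Qed.

End Eigenvalues.

(** * The supremum of the eigenvalues as the maximal Rayleigh quotient *)

Section LambdaMax.
Variables (R : realType) (m n k : nat).
Hypothesis m0 : (0 < m)%N.
Let a : R := n%:R / 2 - m%:R - 1 / 2.
Hypothesis a1 : 1 <= a.

Let one_neq0 : (fun _ : 'I_m -> R => 1 : R) <> (fun=> 0).
Proof. by move=> /(congr1 (fun f => f (fun=> 0))) /eqP; rewrite oner_eq0. Qed.

Let S_k1 : S_k R m k (fun=> 1).
Proof. by split => //; exact: poly_le_cst. Qed.

Lemma lambda_max_spec : T_eigenvalues R m n k (lambda_max R m n k) /\
  forall Q, S_k R m k Q ->
    Icube a (fun y => sigma y * (Q y ^+ 2 * vdm y)) <=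
    lambda_max R m n k * Icube a (fun y => Q y ^+ 2 * vdm y).
Proof.
have [lam Tlam Hlam] := T_eigenvalues_max a1 S_k1 one_neq0.
suff -> : lambda_max R m n k = lam by [].
have ub : ubound (T_eigenvalues R m n k) lam.
  move=> mu /(T_eigenvalues_rayleigh a1)[P [SP P0 E]].
  have := Hlam P SP; rewrite E ler_pM2r//; case: SP => kP _.
  exact: (vdm_int_gt0 a1 kP).
apply/eqP; rewrite eq_le; apply/andP; split.
  by apply: ge_sup => //; exists lam.
by apply: ub_le_sup => //; exists lam.
Qed.

Lemma lambda_max_ge0 : 0 <= lambda_max R m n k.
Proof.
have [_ /(_ _ S_k1)] := lambda_max_spec.
have D0 := vdm_int_gt0 a1 (poly_le_cst m 0 1) one_neq0.
rewrite -(pmulr_lge0 _ D0); apply: le_trans; apply: Icube_ge0 => y cy.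
by rewrite mulr_ge0 ?sigma_ge0// mulr_ge0 ?sqr_ge0 ?vdm_ge0.
Qed.

Lemma lambda_max_upper r :
  lambda_max R m n k ^+ (r + r) <= vdm_cst m a k * sigma_bound m a (k + r) ^+ (r + r).
Proof.
have [/(T_eigenvalues_rayleigh a1)[P [[kP _] P0 E]] _] := lambda_max_spec.
apply: (compare_upper a1 r m0 kP P0 lambda_max_ge0).
by rewrite -E.
Qed.

(** The degree condition places [sigma^r] times the window product in [S_k], so that [lambda_max]
    bounds its Rayleigh quotient. *)
Lemma lambda_max_lower r e M : (m * (e + M).+1 + r <= k)%N ->
  (m%:R * (M%:R / M.+2%:R * (4 * gam (gegpar a) e.*2))) ^+ (r + r) <=
  vdm_cst m a (m * (e + M).+1 + r) * lambda_max R m n k ^+ (r + r).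
Proof.
move=> kr; have [_ H] := lambda_max_spec.
apply: (compare_lower a1 (poly_le_prod_jacwindow m a1 e M) (@prod_jacwindow_neq0 R m a a1 e M)).
- apply: mulr_ge0 => //; apply: mulr_ge0; first exact: divr_ge0.
  by apply: mulr_ge0 => //; exact: gam_ge0 (gegpar_gt1 a1) _.
- exact: lambda_max_ge0.
- exact: Icube_sigma_prod_jacwindow.
- apply: H; split.
    apply: (poly_le_leq kr); apply: poly_le_sigmaX; exact: poly_le_prod_jacwindow.
  move=> s y; rewrite symmetric_prod_jacwindow; congr (_ ^+ _ * _).
  by rewrite /sigma [RHS](reindex_inj (@perm_inj _ s)).
Qed.

End LambdaMax.

(** * Asymptotics *)

Section Growth.
Variable R : realType.

Lemma bernoulli_ge (x : R) q : 0 <= x -> 1 + q%:R * x <= (1 + x) ^+ q.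
Proof.
move=> x0; elim: q => [|q IH]; first by rewrite mul0r addr0 expr0.
rewrite exprS -natr1; have q0 := ler0n R q.
apply: (@le_trans _ _ ((1 + x) * (1 + q%:R * x))); first by nra.
by apply: ler_wpM2l => //; lra.
Qed.

(** When [lam] is comparable to the degree, with ratio controlled by [B], the gap [1 - 4 gam] is at
    least [1 / B^2]; the constant then grows only like the cube of [X]. The factor 40 is [32 + 8]
    from the two terms of the numerator. *)
Lemma nikcst_le (lam B X : R) d : 2 <= lam -> d.+1%:R + lam <= X -> X <= B * (lam - 1) ->
  nikcst lam d <= 40 * B ^+ 4 * X ^+ 3.
Proof.
move=> lam2 dX XB; have lam1 : 1 < lam by lra.
have d0 := ler0n R d; rewrite -natr1 in dX.
have X1 : 1 <= X by lra.
have l0 : 0 < lam - 1 by lra.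
have B0 : 0 < B by rewrite -(pmulr_lgt0 _ l0); lra.
have c0 := gam_lt lam1 d.+1.
have N0 : 32 * d%:R * (d%:R + lam) ^+ 2 + 2 * (2 * lam + 1) ^+ 2 <= 40 * X ^+ 3.
  have h1 : 32 * d%:R * (d%:R + lam) ^+ 2 <= 32 * X * X ^+ 2.
    apply: ler_pM; [lra|exact: sqr_ge0|lra|].
    by rewrite ler_pXn2r ?nnegrE//; lra.
  have h2 : (2 * lam + 1) ^+ 2 <= (2 * X) ^+ 2 by rewrite ler_pXn2r ?nnegrE//; lra.
  have h3 : X ^+ 2 <= X ^+ 3 by rewrite ler_eXn2l//; lra.
  have -> : X ^+ 3 = X * X ^+ 2 by rewrite exprS.
  rewrite -[X ^+ 3]/(X ^+ 3) in h3; rewrite exprS in h3.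
  have -> : 40 * (X * X ^+ 2) = 32 * X * X ^+ 2 + 8 * (X * X ^+ 2) by ring.
  by apply: lerD => //; rewrite exprMn in h2; lra.
rewrite /nikcst; apply: (@le_trans _ _ (40 * X ^+ 3 / (1 - 4 * gam lam d.+1) ^+ 2)).
  by apply: ler_wpM2r => //; rewrite invr_ge0 sqr_ge0.
have -> : 40 * B ^+ 4 * X ^+ 3 = 40 * X ^+ 3 * B ^+ 4 by ring.
apply: ler_wpM2l; first by rewrite mulr_ge0// exprn_ge0//; lra.
have BX : (B ^+ 2)^-1 <= 1 - 4 * gam lam d.+1.
  rewrite (gamE lam1) -natr1.
  have p1 : 0 < d%:R + 1 + lam by lra.
  have p2 : 0 < d%:R + 1 + lam - 1 by lra.
  rewrite -[leLHS]mul1r ler_pdivrMr ?exprn_gt0// mulrAC ler_pdivlMr ?mulr_gt0// mul1r.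
  apply: (@le_trans _ _ (X ^+ 2)).
    by rewrite expr2; apply: ler_pM; lra.
  apply: (@le_trans _ _ ((B * (lam - 1)) ^+ 2)).
    by rewrite ler_pXn2r ?nnegrE//; lra.
  rewrite exprMn mulrC; apply: ler_wpM2r; first exact: sqr_ge0.
  by rewrite expr2; apply: ler_pM; lra.
have B2 : 0 < (B ^+ 2)^-1 by rewrite invr_gt0 exprn_gt0.
have -> : B ^+ 4 = (((B ^+ 2)^-1) ^+ 2)^-1.
  by rewrite exprVn invrK -exprM.
rewrite lef_pV2 ?posrE ?exprn_gt0 ?subr_gt0//.
by rewrite ler_pXn2r ?nnegrE ?subr_ge0// ltW.
Qed.

(** Per pair of indices the constant is at most [C^2 k^6]. By Bernoulli [(1 + v)^q] is at least
    [k / (2 (p + 1)^2)], and the seventh power of that exceeds [C^2 k^6] as soon as [k] passes a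
    threshold depending on [l] and [p]: this is the origin of the 7. *)
Lemma vdm_cst_le (m k k' p : nat) (a l : R) : 0 < l ->
  2 <= gegpar a -> l / 2 * k%:R <= gegpar a -> gegpar a <= (l + 1) * k%:R ->
  4 / l <= k%:R -> (2 * (m * m) + 3)%:R <= k%:R :> R -> (2 * p.+1)%:R <= k%:R :> R ->
  (40 * (4 * (l + 4) / l) ^+ 4 * (l + 4) ^+ 3) ^+ 2 * (2 * p.+1 ^ 2)%:R ^+ 7 <= k%:R ->
  (k' <= k)%N ->
  vdm_cst m a k' <=
  (1 + p.+1%:R^-1) ^+ (7 * (m * m) * (k %/ p.+1) + 7 * (m * m) * (k %/ p.+1)).
Proof.
move=> l0 lam2 lamL lamU kl km kp kC kk.
set B := 4 * (l + 4) / l; set C := 40 * B ^+ 4 * (l + 4) ^+ 3 in kC *.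
have kk' : (k'%:R : R) <= k%:R by rewrite ler_nat.
have k0 : 0 < (k%:R : R) by apply: lt_le_trans kl; apply: divr_gt0.
have kl' : 4 <= k%:R * l by rewrite -ler_pdivrMr.
have nk : nikcst (gegpar a) (k' + m * m).+1.*2 <= C * k%:R ^+ 3.
  have -> : C * k%:R ^+ 3 = 40 * B ^+ 4 * ((l + 4) * k%:R) ^+ 3.
    by rewrite /C; move: (k%:R : R) => x; clearbody B; ring.
  apply: nikcst_le => //.
    move: km; rewrite natrD natrM => km.
    rewrite -natr1 -muln2 natrM -[(_ + _).+1%:R]natr1 natrD; lra.
  rewrite /B -mulrA -[(l + 4) * _]mul1r mulrA.
  have -> : 4 * (l + 4) * (l^-1 * (gegpar a - 1)) = (l + 4) * (4 * (gegpar a - 1) / l).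
    by field; rewrite gt_eqF.
  rewrite mul1r; apply: ler_wpM2l; first lra.
  by rewrite ler_pdivlMr//; lra.
have nk1 : 1 <= nikcst (gegpar a) (k' + m * m).+1.*2 by apply: nikcst_ge1; lra.
set v := p.+1%:R^-1; have v0 : 0 < v by rewrite invr_gt0.
set q := (k %/ p.+1)%N.
(* Rounding loses at most half, because [k] is at least [2 (p + 1)]. *)
have qk : k%:R / (2 * p.+1%:R) <= q%:R :> R.
  rewrite ler_pdivrMr ?mulr_gt0//.
  have h : (k < p.+1 * q.+1)%N by rewrite mulnC ltn_ceil.
  have h2 : (k%:R : R) <= p.+1%:R * (q%:R + 1).
    by rewrite natr1 -natrM ler_nat ltnW.
  move: kp; rewrite natrM => kp; lra.
apply: (@le_trans _ _ ((1 + v) ^+ (7 * (m * m) * q))); last first.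
  by apply: ler_weXn2l; [lra|rewrite leq_addr].
rewrite /vdm_cst mulnAC [leRHS]exprM; apply: lerXn2r; rewrite ?nnegrE.
- exact: sqr_ge0.
- by apply: exprn_ge0; lra.
apply: (@le_trans _ _ ((C * k%:R ^+ 3) ^+ 2)).
  by rewrite ler_pXn2r ?nnegrE//; lra.
rewrite mulnC exprM.
have qv : k%:R / (2 * p.+1 ^ 2)%:R <= (1 + v) ^+ q.
  apply: le_trans (bernoulli_ge q (ltW v0)).
  apply: (@le_trans _ _ (q%:R * v)); last by rewrite lerDr.
  apply: le_trans (ler_wpM2r (ltW v0) qk).
  rewrite le_eqVlt; apply/orP; left; apply/eqP; rewrite natrM natrX /v.
  by field.
apply: (@le_trans _ _ ((k%:R / (2 * p.+1 ^ 2)%:R) ^+ 7)); last first.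
  apply: lerXn2r => //; rewrite nnegrE; first by rewrite divr_ge0.
  by apply: exprn_ge0; lra.
rewrite expr_div_n ler_pdivlMr; last by rewrite exprn_gt0// ltr0n muln_gt0 expn_gt0.
have -> : (C * k%:R ^+ 3) ^+ 2 * (2 * p.+1 ^ 2)%:R ^+ 7 =
   (C ^+ 2 * (2 * p.+1 ^ 2)%:R ^+ 7) * k%:R ^+ 6 by rewrite exprMn -exprM; ring.
by rewrite [leRHS]exprS; apply: ler_wpM2r => //; exact: exprn_ge0.
Qed.

End Growth.

(** * Explicit two-sided bounds for fixed [p] and large [k] *)

Section Asymptotics.
Variables (R : realType) (m n k p : nat) (l : R).
Hypothesis m0 : (0 < m)%N.
Let a : R := n%:R / 2 - m%:R - 1 / 2.
Let v : R := p.+1%:R^-1.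
(** Seven exponents per pair of indices, as in [vdm_cst_le]. Then [r <= th * k], where [th] tends to
    0 with [v]. *)
Let K : nat := 7 * (m * m).
Let r : nat := K * (k %/ p.+1).
Let th : R := K%:R * v.
Let x : R := gegpar a / k%:R.
Let u : R := k%:R^-1.

(** Conditions that hold for all large [k] once [p] is fixed: [gegpar] is comparable to [k], and [k]
    is past the threshold at which [vdm_cst] is absorbed. *)
Definition large_params : Prop := 0 < l /\ [/\ 2 <= gegpar a, l / 2 * k%:R <= gegpar a,
  gegpar a <= (l + 1) * k%:R, 4 / l <= k%:R & [/\ (2 * (m * m) + 3)%:R <= k%:R :> R,
  (2 * p.+1)%:R <= k%:R :> R &
  (40 * (4 * (l + 4) / l) ^+ 4 * (l + 4) ^+ 3) ^+ 2 * (2 * p.+1 ^ 2)%:R ^+ 7 <= k%:R]].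

Hypothesis H : large_params.

Let v0 : 0 < v. Proof. by rewrite invr_gt0. Qed.

Let lam2 : 2 <= gegpar a. Proof. by case: H => _ []. Qed.

Let a1 : 1 <= a.
Proof. by have := lam2; rewrite /gegpar => h; lra. Qed.

Let k_ge : (2 * p.+1 <= k)%N.
Proof. by case: H => _ [_ _ _ _ [_ h _]]; rewrite ler_nat in h. Qed.

Let k0 : 0 < (k%:R : R).
Proof. by rewrite ltr0n; apply: leq_trans k_ge. Qed.

Let r0 : (0 < r + r)%N.
Proof.
rewrite addn_gt0 orbb /r muln_gt0 /K !muln_gt0 m0 /= divn_gt0//.
by apply: leq_trans k_ge; rewrite leq_pmull.
Qed.

Let r_le : r%:R <= th * k%:R.
Proof.
rewrite /r natrM /th -mulrA; apply: ler_wpM2l => //.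
rewrite mulrC ler_pdivlMr// -natrM ler_nat; exact: leq_trunc_div.
Qed.

Let vdm_cst_le' k' : (k' <= k)%N -> vdm_cst m a k' <= (1 + v) ^+ (r + r).
Proof. by case: H => l0 [? ? ? ? [? ? ?]] kk; apply: (@vdm_cst_le R m k k' p a l). Qed.

(** Roots of order [2 r] turn the comparison into the factor [1 + v]. The degree [k + r] is replaced
    by [(1 + th) k], and numerator and denominator are divided by [k^2]. *)
Lemma lambda_max_asymp_upper :
  lambda_max R m n k <= (1 + v) * (m%:R *
    (1 - x * (x - u) / ((x + 2 * u + 2 * (1 + th) / m%:R) * (x + 2 * u + 2 * (1 + th) / m%:R)))).
Proof.
have rho0 := sigma_bound_ge0 a1 (k + r) m0.
have L0 := lambda_max_ge0 k a1.
have v1 : 0 <= 1 + v by have := v0; lra.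
have mR : (0 : R) < m%:R by rewrite ltr0n.
apply: (@le_trans _ _ ((1 + v) * sigma_bound m a (k + r))).
  have P0 := mulr_ge0 v1 rho0.
  rewrite -(ler_pXn2r r0) ?nnegrE// exprMn.
  apply: le_trans (lambda_max_upper k m0 a1 r) _.
  by apply: ler_wpM2r; [exact: exprn_ge0|exact: vdm_cst_le'].
apply: ler_wpM2l => //; rewrite /sigma_bound; apply: ler_wpM2l => //.
rewrite lerD2l lerN2.
have la := lam2; have kk := k0; have rl := r_le; have vv := v0.
have th0 : 0 <= th by rewrite mulr_ge0// ltW.
set D := gegpar a + 2 + 2 * ((1 + th) * k%:R) / m%:R.
have D0 : 0 < D.
  by apply: ltr_wpDr; [rewrite divr_ge0// !mulr_ge0//; lra|lra].
have -> : x * (x - u) / ((x + 2 * u + 2 * (1 + th) / m%:R) * (x + 2 * u + 2 * (1 + th) / m%:R)) =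
    gegpar a * (gegpar a - 1) / D ^+ 2.
  have -> : x + 2 * u + 2 * (1 + th) / m%:R = D / k%:R.
    by rewrite /D /x /u; field; rewrite !gt_eqF.
  by rewrite /x /u; field; rewrite !gt_eqF.
apply: ler_wpM2l; first by apply: mulr_ge0; lra.
have D1 : gegpar a + 2 + 2 * (k + r)%:R / m%:R <= D.
  rewrite lerD2l ler_pM2r ?invr_gt0// ler_pM2l// natrD; lra.
have D2 : 0 < gegpar a + 2 + 2 * (k + r)%:R / m%:R.
  by apply: ltr_wpDr; [rewrite divr_ge0// mulr_ge0|lra].
rewrite lef_pV2 ?posrE ?exprn_gt0//.
by rewrite ler_pXn2r ?nnegrE// ltW.
Qed.

Lemma lambda_max_asymp_lower :
  (m * p.+2 <= k - r)%N -> (r <= k)%N ->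
  0 < x + 2 * (1 - th) / m%:R - (2 * p + 7)%:R * u ->
  (1 + v)^-1 * ((1 + 2 * v)^-1 * (m%:R *
    (1 - x * x / ((x + 2 * (1 - th) / m%:R - (2 * p + 7)%:R * u) *
                  (x + 2 * (1 - th) / m%:R - (2 * p + 7)%:R * u))))) <= lambda_max R m n k.
Proof.
move=> mk rk; set Z := x + _ - _ => Z0.
(* The window has [M = p + 1] and is placed as high as the degree budget permits: its top degree in
   each variable is [q], the share of [k - r] per variable. *)
pose q := ((k - r) %/ m)%N; pose e := (q - p.+2)%N.
have qp : (p.+2 <= q)%N by rewrite leq_divRL// mulnC.
have eM : (e + p.+1).+1 = q by rewrite -addnS subnK.
have L0 := lambda_max_ge0 k a1.
have vv := v0; have v1 : 0 < 1 + v by lra.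
have mR : (0 : R) < m%:R by rewrite ltr0n.
have kr : (m * (e + p.+1).+1 + r <= k)%N.
  have : (m * q <= k - r)%N by rewrite mulnC leq_trunc_div.
  by move: rk; rewrite eM; move: (m * q)%N; clear; lia.
have g0 : 0 <= 4 * gam (gegpar a) e.*2.
  by apply: mulr_ge0 => //; exact: gam_ge0 (gegpar_gt1 a1) _.
have S : m%:R * (p.+1%:R / p.+3%:R * (4 * gam (gegpar a) e.*2)) <= (1 + v) * lambda_max R m n k.
  have P0 := mulr_ge0 (ltW v1) L0.
  have P1 : 0 <= m%:R * (p.+1%:R / p.+3%:R * (4 * gam (gegpar a) e.*2)).
    by apply: mulr_ge0 => //; apply: mulr_ge0 => //; exact: divr_ge0.
  rewrite -(ler_pXn2r r0) ?nnegrE// [leRHS]exprMn.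
  apply: le_trans (lambda_max_lower a1 kr) _.
  by apply: ler_wpM2r; [exact: exprn_ge0|exact: vdm_cst_le'].
rewrite mulrC ler_pdivrMr// [leRHS]mulrC; apply: le_trans S.
(* The boundary loss [M / (M + 2)] of the window. *)
have -> : p.+1%:R / p.+3%:R = (1 + 2 * v)^-1 :> R.
  have P0 : (p.+1%:R : R) != 0 by rewrite pnatr_eq0.
  have P2 : (p.+1%:R + 2 : R) != 0 by rewrite -natrD pnatr_eq0.
  rewrite /v; have -> : (p.+3%:R : R) = p.+1%:R + 2 by rewrite -natrD addn2.
  by move: (p.+1%:R : R) P0 P2 => w P0 P2; field; rewrite P0 P2.
rewrite [leRHS]mulrCA; apply: ler_wpM2l; first by rewrite invr_ge0; lra.
apply: ler_wpM2l => //.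
have la := lam2; have kk := k0; have rl := r_le.
have l1 := gegpar_gt1 a1.
(* From [e >= (1 - th) k / m - p - 3] follows [2 e - 1 >= 2 (1 - th) k / m - (2 p + 7)]; the [- 1]
   is the shift in the smaller factor of [gamE]. *)
pose Y := gegpar a + 2 * (1 - th) * k%:R / m%:R - (2 * p + 7)%:R.
have YZ : Z = Y / k%:R by rewrite /Z /Y /x /u; field; rewrite !gt_eqF.
have Y0 : 0 < Y by move: Z0; rewrite YZ pmulr_lgt0// invr_gt0.
have -> : x * x / (Z * Z) = gegpar a ^+ 2 / Y ^+ 2.
  by rewrite YZ /x; field; rewrite !gt_eqF.
have e2 : (1 - th) * k%:R / m%:R <= e%:R + p%:R + 3 :> R.
  rewrite ler_pdivrMr//.
  have h : (k - r < m * q.+1)%N by rewrite mulnC ltn_ceil.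
  have h' : (k < m * (e + p + 3) + r)%N.
    have -> : (e + p + 3 = q.+1)%N by rewrite -eM !addnS addn0.
    by move: h rk; move: (m * q.+1)%N; clear; lia.
  have : (k%:R : R) <= m%:R * (e%:R + p%:R + 3) + r%:R.
    by rewrite -!natrD -natrM -natrD ler_nat ltnW.
  by move=> h2; rewrite [leRHS]mulrC; lra.
have Ye : Y <= (e.*2)%:R + gegpar a - 1.
  by rewrite /Y -muln2 !natrD !natrM; lra.
have := gamE l1 e.*2; set G := gam _ _ => gE.
have -> : 4 * G = 1 - gegpar a * (gegpar a - 1) / (((e.*2)%:R + gegpar a) * ((e.*2)%:R + gegpar a - 1)) by lra.
rewrite lerD2l lerN2; apply: ler_pM.
- by apply: mulr_ge0; lra.
- by rewrite invr_ge0; apply: mulr_ge0; lra.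
- by rewrite expr2; apply: ler_wpM2l; lra.
rewrite lef_pV2 ?posrE ?exprn_gt0 ?mulr_gt0//; try lra.
by rewrite expr2; apply: ler_pM; lra.
Qed.

End Asymptotics.

(** * Passage to the limit *)

Section Limits.
Variable R : realType.

Lemma cvg_core (T : Type) (F : set_system T) (x y D : T -> R) (c l l' d : R) :
  Filter F -> x @ F --> l -> y @ F --> l' -> D @ F --> d -> d != 0 ->
  (c * (1 - x t * y t / (D t * D t))) @[t --> F] --> c * (1 - l * l' / (d * d)).
Proof.
move=> FF cx cy cD d0; apply: cvgM; first exact: cvg_cst.
apply: cvgB; first exact: cvg_cst.
apply: cvgM; first exact: cvgM.
by apply: cvgV; [rewrite mulf_neq0|exact: cvgM].
Qed.

End Limits.

Theorem theorem5p3 (R : realType) (m : nat) (l : R)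
  (nn kk : nat -> nat) :
  (1 <= m)%N -> 0 < l ->
  (forall j, (2 * m <= nn j)%N) ->
  ((fun j => (nn j)%:R : R) @ \oo --> +oo) ->
  ((fun j => (kk j)%:R : R) @ \oo --> +oo) ->
  ((fun j => (nn j)%:R / (2 * (kk j)%:R) : R) @ \oo --> l) ->
  ((fun j => lambda_max R m (nn j) (kk j)) @ \oo -->
     4 * (l + 1 / m%:R) / (l + 2 / m%:R) ^+ 2).
Proof.
move=> m0 l0 _ cn ck cl.
have mR : (0 : R) < m%:R by rewrite ltr0n.
pose a j : R := (nn j)%:R / 2 - m%:R - 1 / 2.
pose u j : R := (kk j)%:R^-1.
pose x j : R := gegpar (a j) / (kk j)%:R.
have cu : u @ \oo --> (0 : R).
  apply/gtr0_cvgV0 => //; near=> j.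
  apply: (@lt_le_trans _ _ 1) => //; near: j; exact: cvgry_ge.
(* Here [gegpar] is [n / 2 - m], so [x] differs from [n / (2 k)] by [m / k], which tends to zero. *)
have cx : x @ \oo --> l.
  have -> : x = fun j => (nn j)%:R / (2 * (kk j)%:R) - m%:R * u j.
    by apply/funext => j; rewrite /x /u /gegpar /a invfM; ring.
  rewrite -[X in _ --> X](subr0 l) -[X in l - X](mulr0 (m%:R : R)).
  by apply: cvgB => //; apply: cvgM => //; exact: cvg_cst.
pose K := (7 * (m * m))%N.
pose v p : R := p.+1%:R^-1.
pose th p : R := K%:R * v p.
have cv : v @ \oo --> (0 : R) by exact: cvg_harmonic.
have cth : th @ \oo --> (0 : R).
  by rewrite -[X in _ --> X](mulr0 (K%:R : R)); apply: cvgM => //; exact: cvg_cst.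
(* The limits of the two bounds as [k] grows with [p] fixed; both tend to the same value as [p]
   grows. *)
pose Uinf p : R := (1 + v p) * (m%:R * (1 - l * l /
  ((l + 2 * (1 + th p) / m%:R) * (l + 2 * (1 + th p) / m%:R)))).
pose Linf p : R := (1 + v p)^-1 * ((1 + 2 * v p)^-1 * (m%:R * (1 - l * l /
  ((l + 2 * (1 - th p) / m%:R) * (l + 2 * (1 - th p) / m%:R))))).
have tE : 4 * (l + 1 / m%:R) / (l + 2 / m%:R) ^+ 2 =
    m%:R * (1 - l * l / ((l + 2 * (1 + 0) / m%:R) * (l + 2 * (1 + 0) / m%:R))).
  have : l + 2 / m%:R != 0 by rewrite gt_eqF// addr_gt0// divr_gt0.
  have : l * m%:R + 2 != 0 by rewrite gt_eqF// addr_gt0// mulr_gt0.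
  have : m%:R != 0 :> R by rewrite gt_eqF.
  by move=> h1 h2 h3; field; rewrite h1 h2.
set t := 4 * _ / _ in tE *.
have d0 : l + 2 * (1 + 0) / m%:R != 0 by rewrite gt_eqF// addr_gt0// divr_gt0//; lra.
have cUinf : Uinf @ \oo --> t.
  rewrite -[X in _ --> X]mul1r -[X in X * t](addr0 1) tE.
  apply: cvgM; first by apply: cvgD => //; exact: cvg_cst.
  apply: cvg_core => //; try exact: cvg_cst.
  apply: cvgD; first exact: cvg_cst.
  apply: cvgM; last exact: cvg_cst.
  apply: cvgM; first exact: cvg_cst.
  by apply: cvgD => //; exact: cvg_cst.
have cLinf : Linf @ \oo --> t.
  have -> : t = (1 + 0)^-1 * ((1 + 2 * 0)^-1 * t) by rewrite mulr0 addr0 invr1 !mul1r.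
  rewrite tE; apply: cvgM.
    by apply: cvgV; [rewrite addr0 oner_eq0|apply: cvgD => //; exact: cvg_cst].
  apply: cvgM.
    apply: cvgV; first by rewrite mulr0 addr0 oner_eq0.
    by apply: cvgD; [exact: cvg_cst|apply: cvgM => //; exact: cvg_cst].
  have d1 : l + 2 * (1 + 0) / m%:R = l + 2 * (1 - 0) / m%:R by rewrite addr0 subr0.
  rewrite d1 in d0 *; apply: cvg_core => //; try exact: cvg_cst.
  apply: cvgD; first exact: cvg_cst.
  apply: cvgM; last exact: cvg_cst.
  apply: cvgM; first exact: cvg_cst.
  by apply: cvgB => //; exact: cvg_cst.
apply/cvgrPdist_lt => eps eps0.
(* The order of the limits matters: [p] is fixed in terms of [eps] first, and only then is [j] taken
   large depending on [p]. *)
near \oo => p.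
have Up : Uinf p < t + eps by near: p; apply: (cvgr_lt t) => //; rewrite ltrDl.
have Lp : t - eps < Linf p by near: p; apply: (cvgr_gt t) => //; rewrite gtrBl.
(* This keeps the limiting denominator of the lower bound positive and makes [r] at most half of
   [k]. *)
have thp : th p < 1 / 2 by near: p; apply: (cvgr_lt 0) => //; lra.
have v0 : 0 < v p by rewrite invr_gt0.
have th0 : 0 <= th p by rewrite mulr_ge0// ltW.
have dU : l + 2 * 0 + 2 * (1 + th p) / m%:R != 0.
  by rewrite gt_eqF// mulr0 addr0 addr_gt0// divr_gt0//; lra.
have dL : 0 < l + 2 * (1 - th p) / m%:R - (2 * p + 7)%:R * 0.
  by rewrite mulr0 subr0 addr_gt0// divr_gt0//; lra.
pose DU j := x j + 2 * u j + 2 * (1 + th p) / m%:R.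
pose DL j := x j + 2 * (1 - th p) / m%:R - (2 * p + 7)%:R * u j.
have cDL : DL @ \oo --> l + 2 * (1 - th p) / m%:R - (2 * p + 7)%:R * 0.
  apply: cvgB; first by apply: cvgD => //; exact: cvg_cst.
  by apply: cvgM => //; exact: cvg_cst.
have cU : ((1 + v p) * (m%:R * (1 - x j * (x j - u j) / (DU j * DU j)))) @[j --> \oo] --> Uinf p.
  rewrite /Uinf -[X in _ * X / _](subr0 l).
  have -> : l + 2 * (1 + th p) / m%:R = l + 2 * 0 + 2 * (1 + th p) / m%:R by rewrite mulr0 addr0.
  apply: cvgM; first exact: cvg_cst.
  apply: cvg_core => //; first exact: cvgB.
  apply: cvgD; last exact: cvg_cst.
  by apply: cvgD => //; apply: cvgM => //; exact: cvg_cst.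
have cL : ((1 + v p)^-1 * ((1 + 2 * v p)^-1 *
    (m%:R * (1 - x j * x j / (DL j * DL j))))) @[j --> \oo] --> Linf p.
  rewrite /Linf.
  have -> : l + 2 * (1 - th p) / m%:R = l + 2 * (1 - th p) / m%:R - (2 * p + 7)%:R * 0.
    by rewrite mulr0 subr0.
  apply: cvgM; first exact: cvg_cst.
  apply: cvgM; first exact: cvg_cst.
  by apply: cvg_core => //; rewrite gt_eqF.
near=> j.
have Uj : (1 + v p) * (m%:R * (1 - x j * (x j - u j) / (DU j * DU j))) < t + eps.
  by near: j; exact: (cvgr_lt (Uinf p)).
have Lj : t - eps < (1 + v p)^-1 * ((1 + 2 * v p)^-1 *
    (m%:R * (1 - x j * x j / (DL j * DL j)))).
  by near: j; exact: (cvgr_gt (Linf p)).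
have DLj : 0 < DL j by near: j; exact: (cvgr_gt _ cDL).
have xl : l / 2 < x j by near: j; apply: (cvgr_gt l) => //; lra.
have xu : x j < l + 1 by near: j; apply: (cvgr_lt l) => //; lra.
have k1 : 1 <= (kk j)%:R :> R by near: j; exact: cvgry_ge.
have k2 : 4 / l <= (kk j)%:R :> R by near: j; exact: cvgry_ge.
have k3 : (2 * (m * m) + 3)%:R <= (kk j)%:R :> R by near: j; exact: cvgry_ge.
have k4 : (2 * p.+1)%:R <= (kk j)%:R :> R by near: j; exact: cvgry_ge.
have k6 : (2 * (m * p.+2))%:R <= (kk j)%:R :> R by near: j; exact: cvgry_ge.
have k0 : 0 < (kk j)%:R :> R by apply: lt_le_trans k1.
have lamx : gegpar (a j) = x j * (kk j)%:R by rewrite /x divfK// gt_eqF.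
have k2' : 4 <= (kk j)%:R * l by rewrite -ler_pdivrMr.
have hA : 2 <= gegpar (a j).
  have hz : l / 2 * (kk j)%:R <= x j * (kk j)%:R by rewrite ler_wpM2r// ltW.
  by rewrite lamx; clear -hz k2'; lra.
have hB : l / 2 * (kk j)%:R <= gegpar (a j) by rewrite lamx ler_wpM2r// ltW.
have hC : gegpar (a j) <= (l + 1) * (kk j)%:R by rewrite lamx ler_wpM2r// ltW.
(* With [r <= k / 2] and [m (p + 2) <= k / 2], enough degree remains for a window of [p + 3]
   polynomials in each variable. *)
have rk : 2 * (K * (kk j %/ p.+1))%N%:R <= (kk j)%:R :> R.
  have h : ((kk j %/ p.+1)%N%:R : R) <= (kk j)%:R * v p.
    by rewrite ler_pdivlMr// -natrM ler_nat leq_trunc_div.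
  rewrite natrM; apply: (@le_trans _ _ (2 * (th p * (kk j)%:R))).
    apply: ler_wpM2l => //; rewrite /th -mulrA [v p * _]mulrC.
    exact: ler_wpM2l.
  by have h' := ler_wpM2r (ltW k0) (ltW thp); clear -h'; lra.
have rkN : (2 * (K * (kk j %/ p.+1)) <= kk j)%N by rewrite -(ler_nat R) natrM.
have k6N : (2 * (m * p.+2) <= kk j)%N by rewrite -(ler_nat R).
have Hl : large_params m (nn j) (kk j) p l.
  by split => //; split => //; split => //; near: j; exact: cvgry_ge.
have Ub := lambda_max_asymp_upper m0 Hl.
have Lb : (1 + v p)^-1 * ((1 + 2 * v p)^-1 *
    (m%:R * (1 - x j * x j / (DL j * DL j)))) <= lambda_max R m (nn j) (kk j).
  apply: (lambda_max_asymp_lower m0 Hl) => //.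
    by move: rkN k6N; rewrite -/K; move: (K * (kk j %/ p.+1))%N (m * p.+2)%N (kk j); clear; lia.
  by move: rkN; rewrite -/K; move: (K * (kk j %/ p.+1))%N (kk j); clear; lia.
rewrite ltr_norml; apply/andP; split.
  have := le_lt_trans Ub Uj; lra.
have := lt_le_trans Lj Lb; lra.
Unshelve. all: by end_near. Qed.
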